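(* Let $\lambda\in(-\sqrt{2\pi},\sqrt{2\pi})$. Then the only solution $f\in L_2(\mathbb{R}_+)$ of the integro-functional equation $$\frac{2^{3/2}}{\sqrt\pi}\,PV\int_0^\infty\left[\frac1\pi\log\left(\frac xt\right)-1\right]\frac{t f(t)}{x^2-t^2}\,dt=\frac\lambda x f\left(\frac1x\right),\quad x>0,$$ is the trivial one $f=0$.
   Context: $\mathbb{R}_+=(0,\infty)$. $PV$ denotes the Cauchy principal value at $t=x$. Equalities between $L_2$ functions are understood almost everywhere. *)

(* Defs.v *)
From HB Require Import structures.
From mathcomp Require Import all_boot all_order all_algebra.
From mathcomp Require Import complex.
From mathcomp Require Import all_classical all_reals all_analysis.
Import Order.TTheory GRing.Theory Num.Theory numFieldNormedType.Exports.

Set Implicit Arguments.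
Unset Strict Implicit.
Unset Printing Implicit Defensive.

Local Open Scope classical_set_scope.
Local Open Scope ring_scope.
Local Open Scope complex_scope.

Definition Rplus {R : realType} : set R := `]0, +oo[%classic.

(* Square-integrable functions are complex valued and are not quotiented by
   a.e. equality; values off (0, oo) are irrelevant. Measurability is with
   respect to Borel sets, which loses no L_2 class. *)
Definition in_L2 {R : realType} (f : R -> R[i]) : Prop :=
  [/\ measurable_fun Rplus (fun t => complex.Re (f t)),
      measurable_fun Rplus (fun t => complex.Im (f t)) &
      (\int[lebesgue_measure]_(t in Rplus) ((Normc.normc (f t)) ^+ 2)%:E < +oo)%E].

Definition PV_domain {R : realType} (x eps : R) : set R :=
  [set t | 0 < t /\ eps <= `|x - t|].

(* [is_PV h x v]: PV int_0^oo h(t) dt exists, with v as value and x as the only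
   singularity. Integrability is required since Rintegral is total. *)
Definition is_PV {R : realType} (h : R -> R) (x v : R) : Prop :=
  (forall eps : R, 0 < eps ->
     lebesgue_measure.-integrable (PV_domain x eps) (EFin \o h)) /\
  (\int[lebesgue_measure]_(t in PV_domain x eps) h t)%R @[eps --> 0^'+] --> v.

Definition is_PVC {R : realType} (h : R -> R[i]) (x : R) (v : R[i]) : Prop :=
  is_PV (fun t => complex.Re (h t)) x (complex.Re v) /\
  is_PV (fun t => complex.Im (h t)) x (complex.Im v).

Definition PV_kernel {R : realType} (x t : R) : R :=
  (pi^-1 * ln (x / t) - 1) * (t / (x ^+ 2 - t ^+ 2)).

(* An equality of L_2 functions, hence required for almost every x > 0; it
   includes the existence of the principal value at x. *)
Definition solves_equation {R : realType} (lambda : R) (f : R -> R[i]) : Prop :=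
  {ae lebesgue_measure, forall x : R, Rplus x ->
    exists v : R[i],
      is_PVC (fun t => (PV_kernel x t)%:C * f t) x v /\
      (2 `^ (3 / 2) / Num.sqrt pi)%:C * v = (lambda / x)%:C * f (x^-1)}.

(* Main.v *)
From HB Require Import structures.
From mathcomp Require Import all_boot all_order all_algebra.
From mathcomp Require Import complex.
From mathcomp Require Import all_classical all_reals all_analysis.
From mathcomp Require Import measurable_realfun ring lra.
Require Import Defs.
Import Order.TTheory GRing.Theory Num.Theory numFieldNormedType.Exports.

(** Why only the zero function solves the equation.

All kernels being real, it is enough to treat a real f; write D = (0, oo),
   N f(x) = int_D t f(t) / (x^2 + t^2) dt,   C f(x) = int_D f(t) / (x + t) dt,
   H f(x) = PV int_D t f(t) / (x^2 - t^2) dt,   J f(x) = f(1/x) / x.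
For x <> t, the function s |-> s/(x^2 + s^2) * t/(s^2 + t^2) has integral
t ln(x/t) / (x^2 - t^2) over D ([stieltjes_iter]).  So the logarithmic part of
the kernel is (1/pi) N N, and the equation says
   H f = (1/pi) N N f - l J f,   l = lambda sqrt(pi) / 2^(3/2),
where the bound on lambda is exactly |l| < pi/2 ([powR_sqrt_pi]).

Now apply the transpose N' of N.  One has N' N = (pi/2) C
([stieltjes_gram]), N' J = J N ([poisson_inv_Rint]), and, the key identity,
N' H = - (pi/2) N.  Hence g = N f satisfies, at every point,
   (1/2) C g + (pi/2) g = l J g.
The operator C = (2/pi) N' N is nonnegative and J is an isometry of L2(D), so
taking the inner product with g gives (pi/2) |g|^2 <= |l| |g|^2.  Therefore
g = 0 almost everywhere, C g = 0 everywhere, and the relation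
(pi/2) g(y) = l g(1/y)/y that is left, used at y and at 1/y, gives g = 0
everywhere ([inversion_equation_eq0]).  Finally N is injective
([stieltjes_inj]), because in the variable t^2 it is a Stieltjes transform,
whose vanishing makes t f(t) / (1 + t^2) orthogonal to all polynomials in
a / (a + t^2), for every a > 0.

The analytic difficulty is N' H = - (pi/2) N, since the principal value does
not converge absolutely.  H is approximated by the operators S_d with kernel
s_d = Re t/((x + i d)^2 - t^2), for d = 1/(n+1):
- if the principal value exists at x, then S_d f(x) -> H f(x), because up to
  an absolutely convergent error the kernel s_d is a weighted average of the
  truncations that define the principal value ([PV_average],
  [PV_re_kernel_cvg]);
- S_d is bounded on L2(D) uniformly in d.  With r_d = - Im of the same
  function, the kernels of S_d' S_d and R_d' R_d agree off the diagonal
  ([re_im_gram]), and R_d is a positive kernel dominated by the Poisson kernel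
  ([re_kernel_bound]);
- N' S_d is explicit: its kernel is - (pi/2) t / (t^2 + (y + d)^2)
  ([poisson_re_kernel_int]).
Bounded sequences in L2 that converge almost everywhere converge weakly
([weak_cvg]), so the last identity passes to the limit ([re_kernel_limit]).
What is needed about H is thus only the existence of the principal value almost
everywhere, which is part of the equation.

Conversely, a function that is 0 almost everywhere has all its principal values
equal to 0, and x |-> f (1/x) is also 0 almost everywhere ([inv_ae]). *)

Local Open Scope classical_set_scope.
Local Open Scope ring_scope.

(** * Measurability and Fubini on the half-line *)

Lemma measurable_Rplus {R : realType} : measurable (@Rplus R).
Proof. exact: measurable_itv. Qed.
#[local] Hint Extern 0 (measurable _) => solve [exact: measurable_Rplus] : core.

Section Fubini.
Context {R : realType}.
Local Notation mu := (@lebesgue_measure R).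
Local Notation D := (@Rplus R).

Lemma RplusE (x : R) : D x = (0 < x) :> Prop.
Proof. by rewrite /Rplus /= in_itv/= andbT. Qed.

(** Inversion is continuous off 0, and a single point is a measurable set. *)
Lemma measurable_inv : measurable_fun [set: R] (fun x : R => x^-1).
Proof.
have -> : [set: R] = [set x | x != 0] `|` [set 0].
  by apply/seteqP; split => x //= _; case: (eqVneq x 0); [right|left].
have mo : open [set x : R | x != 0].
  have -> : [set x : R | x != 0] = ~` [set 0].
    by apply/seteqP; split => x /=; [move/eqP|move=> ?; exact/eqP].
  by rewrite openC; apply: accessible_closed_set1; exact/hausdorff_accessible/Rhausdorff.
apply/measurable_funU; [exact: open_measurable|exact: measurable_set1|split=> /=].
  apply: open_continuous_measurable_fun => // x; rewrite inE/= => x0.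
  exact: inv_continuous.
exact: measurable_fun_set1.
Qed.

Lemma measurable_funV d (T : measurableType d) (f : T -> R) :
  measurable_fun setT f -> measurable_fun setT (fun x => (f x)^-1).
Proof. exact: (measurableT_comp measurable_inv). Qed.

Definition measurable2 (F : R -> R -> R) :=
  measurable_fun [set: R * R] (fun z => F z.1 z.2).

Lemma measurable2_1 F : measurable2 F -> forall x, measurable_fun setT (F x).
Proof.
by move=> mF x; exact: (measurable_fun_pair2 (f:=fun z => F z.1 z.2)).
Qed.

Lemma measurable2_2 F : measurable2 F -> forall t, measurable_fun setT (F^~ t).
Proof.
by move=> mF x; exact: (measurable_fun_pair1 (f:=fun z => F z.1 z.2)).
Qed.

Lemma measurable2C F : measurable2 F -> measurable2 (fun x t => F t x).
Proof.
by move=> mF; apply: (measurableT_comp (f := fun z => F z.1 z.2) (g := fun z => (z.2, z.1))) => //;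
  apply/measurable_fun_pairP; split; [exact: measurable_snd|exact: measurable_fst].
Qed.

(** Extension by 0 off D x D, which transfers the theorems of Tonelli and
    Fubini from the plane to the quadrant. *)
Let Fpatch (F : R -> R -> \bar R) : R * R -> \bar R :=
  (fun z => F z.1 z.2) \_ (D `*` D).

Let int_Fpatch F x : (\int[mu]_t Fpatch F (x, t) =
  ((fun x => \int[mu]_(t in D) F x t) \_ D) x)%E.
Proof.
rewrite patchE; case: ifPn => Dx.
  rewrite [RHS]integral_mkcond; apply: eq_integral => t _.
  rewrite /Fpatch !patchE/= in_setX Dx/=.
  by [].
rewrite integral0_eq// => t _.
by rewrite /Fpatch !patchE/= in_setX (negbTE Dx).
Qed.

Let int_Fpatch2 F t : (\int[mu]_x Fpatch F (x, t) =
  ((fun t => \int[mu]_(x in D) F x t) \_ D) t)%E.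
Proof.
rewrite patchE; case: ifPn => Dx.
  rewrite [RHS]integral_mkcond; apply: eq_integral => x _.
  by rewrite /Fpatch !patchE/= in_setX Dx andbT.
rewrite integral0_eq// => x _.
by rewrite /Fpatch !patchE/= in_setX (negbTE Dx) andbF.
Qed.

Let mFpatch (F : R -> R -> \bar R) : measurable_fun setT (fun z => F z.1 z.2) ->
  measurable_fun setT (Fpatch F).
Proof.
move=> mF; apply/measurable_restrict => //; first exact: measurableX.
exact: measurable_funTS.
Qed.

Lemma tonelli (F : R -> R -> \bar R) :
  measurable_fun setT (fun z => F z.1 z.2) ->
  (forall x t, 0 < x -> 0 < t -> (0 <= F x t)%E) ->
  (\int[mu]_(x in D) \int[mu]_(t in D) F x t =
   \int[mu]_(t in D) \int[mu]_(x in D) F x t)%E.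
Proof.
move=> mF F0.
rewrite integral_mkcond [RHS]integral_mkcond.
have F0' z : (0 <= Fpatch F z)%E.
  rewrite /Fpatch patchE; case: ifPn => // /[!inE] -[/=]; rewrite !RplusE; exact: F0.
have /= := fubini_tonelli (m1 := mu) (m2 := mu) (Fpatch F) (mFpatch _ mF) F0'.
under eq_integral do rewrite int_Fpatch.
by under [X in _ = X -> _]eq_integral do rewrite int_Fpatch2.
Qed.

Lemma measurable_int_ge0 (F : R -> R -> \bar R) :
  measurable_fun setT (fun z => F z.1 z.2) ->
  (forall x t, (0 <= F x t)%E) ->
  measurable_fun setT (fun x => \int[mu]_(t in D) F x t)%E.
Proof.
move=> mF F0.
pose G (z : R * R) := ((fun z => F z.1 z.2) \_ (setT `*` D)) z.
have mG : measurable_fun setT G.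
  apply/measurable_restrict => //; first exact: measurableX.
  exact: measurable_funTS.
have G0 z : (0 <= G z)%E by rewrite /G patchE; case: ifP.
have := measurable_fun_fubini_tonelli_F (m2 := mu) G mG G0.
congr measurable_fun; apply/funext => x; rewrite /fubini_F [RHS]integral_mkcond.
by apply: eq_integral => t _; rewrite /G !patchE/= in_setX in_setT.
Qed.

Lemma measurable_Rint (F : R -> R -> R) : measurable2 F ->
  measurable_fun setT (fun x => \int[mu]_(t in D) F x t).
Proof.
move=> mF; rewrite /Rintegral; apply: measurableT_comp => //.
have mF' : measurable_fun setT (fun z : R * R => (F z.1 z.2)%:E).
  exact/measurable_EFinP.
under eq_fun do rewrite integralE.
apply: emeasurable_funB.
  apply: (measurable_int_ge0 (fun x => (EFin \o F x)^\+%E)) => [|x t].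
    rewrite (_ : (fun z => _) = (fun z : R * R => (F z.1 z.2)%:E)^\+%E); last first.
      by apply/funext => z; rewrite !funeposE.
    exact: measurable_funepos.
  exact: funepos_ge0.
apply: (measurable_int_ge0 (fun x => (EFin \o F x)^\-%E)) => [|x t].
  rewrite (_ : (fun z => _) = (fun z : R * R => (F z.1 z.2)%:E)^\-%E); last first.
    by apply/funext => z; rewrite !funenegE.
  exact: measurable_funeneg.
exact: funeneg_ge0.
Qed.

Let iFpatch F : measurable2 F ->
  (\int[mu]_(x in D) \int[mu]_(t in D) `|F x t|%:E < +oo)%E ->
  (mu \x mu)%E.-integrable setT (Fpatch (fun x t => (F x t)%:E)).
Proof.
move=> mF iF; apply/integrable12ltyP => //.
  by apply: mFpatch; exact/measurable_EFinP.
rewrite (le_lt_trans _ iF)// integral_mkcond [in X in (_ <= X)%E]integral_mkcond.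
under [X in (_ <= X)%E]eq_integral do rewrite -int_Fpatch.
rewrite le_eqVlt; apply/orP; left; apply/eqP.
apply: eq_integral => x _; rewrite patchT ?inE//; apply: eq_integral => t _.
by rewrite /Fpatch !patchE; case: ifP; rewrite // abse0.
Qed.

Let iF1 F : measurable2 F ->
  (\int[mu]_(x in D) \int[mu]_(t in D) `|F x t|%:E < +oo)%E ->
  mu.-integrable D (fun x => \int[mu]_(t in D) (F x t)%:E)%E.
Proof.
move=> mF iF.
apply/integrable_mkcond => //.
have := integrable_fubini_F (iFpatch _ mF iF).
by apply: eq_integrable => // x _; rewrite -int_Fpatch.
Qed.

Let iFswap F : measurable2 F ->
  (\int[mu]_(x in D) \int[mu]_(t in D) `|F x t|%:E < +oo)%E ->
  (\int[mu]_(t in D) \int[mu]_(x in D) `|F x t|%:E < +oo)%E.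
Proof.
by move=> mF iF; rewrite -tonelli//; apply/measurable_EFinP/measurableT_comp.
Qed.

Lemma integrable_fubini1 F : measurable2 F ->
  (\int[mu]_(x in D) \int[mu]_(t in D) `|F x t|%:E < +oo)%E ->
  mu.-integrable D (fun x => (\int[mu]_(t in D) F x t)%:E).
Proof.
move=> mF iF.
apply: le_integrable (iF1 _ mF iF) => //.
  by apply/measurable_EFinP/measurable_funTS; exact: measurable_Rint.
move=> x _; rewrite /Rintegral.
by case: (integral _ _ _) => //=; rewrite ?normr0 ?leey.
Qed.

Lemma integrable_fubini2 F : measurable2 F ->
  (\int[mu]_(x in D) \int[mu]_(t in D) `|F x t|%:E < +oo)%E ->
  mu.-integrable D (fun t => (\int[mu]_(x in D) F x t)%:E).
Proof.
by move=> mF iF; apply: integrable_fubini1 (measurable2C _ mF) (iFswap _ mF iF).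
Qed.

Lemma fubini_Rint F : measurable2 F ->
  (\int[mu]_(x in D) \int[mu]_(t in D) `|F x t|%:E < +oo)%E ->
  \int[mu]_(x in D) (\int[mu]_(t in D) F x t) =
  \int[mu]_(t in D) (\int[mu]_(x in D) F x t).
Proof.
move=> mF iF.
have i1 := iF1 _ mF iF.
have i2 := iF1 _ (measurable2C _ mF) (iFswap _ mF iF).
rewrite /Rintegral; congr fine.
transitivity (\int[mu]_(x in D) \int[mu]_(t in D) (F x t)%:E)%E.
  apply: ae_eq_integral => //.
  - exact: (measurable_int _ (integrable_fubini1 _ mF iF)).
  - exact: (measurable_int _ i1).
  - have /(_ measurable_Rplus) := integrable_ae _ i1.
    by apply: filterS => x /= h Dx; rewrite fineK// h.
transitivity (\int[mu]_(t in D) \int[mu]_(x in D) (F x t)%:E)%E.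
  have := Fubini (iFpatch _ mF iF).
  under eq_integral do rewrite int_Fpatch.
  under [X in _ = X -> _]eq_integral do rewrite int_Fpatch2.
  by rewrite -!integral_mkcond.
apply: ae_eq_integral => //.
- exact: (measurable_int _ i2).
- exact: (measurable_int _ (integrable_fubini2 _ mF iF)).
- have /(_ measurable_Rplus) := integrable_ae _ i2.
  by apply: filterS => x /= h Dx; rewrite fineK// h.
Qed.
End Fubini.

(** * The fundamental theorem of calculus on the half-line *)

Section FTC.
Context {R : realType}.
Local Notation mu := (@lebesgue_measure R).
Local Notation D := (@Rplus R).

(** Compact intervals exhausting D, on each of which the theorem for
    continuous functions on a segment applies. *)
Let E (n : nat) : set R := `[n.+1%:R^-1, n.+1%:R]%classic.

Let E_bigcup : \bigcup_n E n = D.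
Proof.
apply/seteqP; split => [x [n _]|x].
  rewrite /E/= in_itv/= RplusE => /andP[h _]; apply: lt_le_trans h.
  by rewrite invr_gt0.
rewrite RplusE => x0.
pose n := (Num.trunc x + Num.trunc x^-1)%N; exists n => //.
rewrite /E /= in_itv/= -(invrK x) lef_pV2 ?posrE ?invr_gt0// invrK.
apply/andP; split.
  apply: le_trans (ltW (truncnS_gt _)) _.
  by rewrite ler_nat ltnS /n leq_addl.
apply: le_trans (ltW (truncnS_gt _)) _.
by rewrite ler_nat ltnS /n leq_addr.
Qed.

Let E_nd : {homo E : n m / (n <= m)%N >-> (n <= m)%O}.
Proof.
move=> n m nm; rewrite subsetEset; apply: subset_itv; rewrite bnd_simp.
  by rewrite lef_pV2 ?posrE// ler_nat.
by rewrite ler_nat.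
Qed.

Variables f F : R -> R.
Hypothesis dF : forall x : R, 0 < x -> is_derive x 1 F (f x).
Hypothesis cf : forall x : R, 0 < x -> {for x, continuous f}.

Let cE n : {within E n, continuous f}.
Proof.
apply: continuous_in_subspaceT => x; rewrite inE /E/= in_itv/= => /andP[h _].
by apply: cf; apply: lt_le_trans h; rewrite invr_gt0.
Qed.

Let mf : measurable_fun D f.
Proof.
apply: open_continuous_measurable_fun; first exact: interval_open.
by move=> x; rewrite inE RplusE; exact: cf.
Qed.

Let FTC_E n : (0 < n)%N ->
  (\int[mu]_(x in E n) (f x)%:E = (F n.+1%:R - F n.+1%:R^-1)%:E)%E.
Proof.
move=> n0; have n1 : (n.+1%:R^-1 : R) < n.+1%:R.
  apply: (@lt_trans _ _ 1); first by rewrite invf_lt1// ltr1n ltnS.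
  by rewrite ltr1n ltnS.
have pos (x : R) : n.+1%:R^-1 <= x -> 0 < x.
  by move=> h; apply: lt_le_trans h; rewrite invr_gt0.
have ctF (x : R) : 0 < x -> {for x, continuous F}.
  move=> x0; have [dFx _] := dF _ x0.
  by apply: differentiable_continuous; exact/derivable1_diffP.
rewrite (continuous_FTC2 n1 (cE n) (F := F)) ?EFinB//.
  split.
  - move=> x; rewrite in_itv/= => /andP[h _].
    by have [] := dF _ (pos _ (ltW h)).
  - by apply/cvg_at_right_filter/ctF/pos.
  - by apply/cvg_at_left_filter/ctF/pos/ltW.
move=> x; rewrite in_itv/= => /andP[h _].
by have [_ <-] := dF _ (pos _ (ltW h)); rewrite derive1E.
Qed.

Variables a b : R.
Hypothesis Fa : F x @[x --> 0^'+] --> a.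
Hypothesis Fb : F x @[x --> +oo%R] --> b.

Let FTC_lim : (\int[mu]_(x in E n) (f x)%:E @[n --> \oo] --> (b - a)%:E)%E.
Proof.
have cn : (n.+1%:R : R) @[n --> \oo] --> +oo%R.
  by apply/cvgryPge => A; near=> n; apply: le_trans (ltW (truncnS_gt A)) _;
     rewrite ler_nat ltnS; near: n; exact: nbhs_infty_ge.
apply: (@cvg_trans _ ((F n.+1%:R - F n.+1%:R^-1)%:E @[n --> \oo])).
  by apply: near_eq_cvg; near=> n; rewrite FTC_E//; near: n; exact: nbhs_infty_gt.
apply: cvg_EFin; first by near=> n.
apply: cvgB.
  exact: (cvg_comp _ _ cn Fb).
have c0 : (n.+1%:R^-1 : R) @[n --> \oo] --> 0^'+.
  move=> P [e /= e0 eP].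
  have : \forall n \near \oo, `|0 - n.+1%:R^-1 : R| < e.
    by near=> n; rewrite sub0r normrN ger0_norm//; near: n; exact: near_infty_natSinv_lt (PosNum e0).
  by apply: filterS => n h; apply: eP => //=.
exact: (cvg_comp _ _ c0 Fa).
Unshelve. all: by end_near. Qed.

(** Monotone convergence along the exhaustion; no integrability has to be
    known beforehand, so this also serves to prove it. *)
Lemma FTC_ge0 : (forall x : R, 0 < x -> 0 <= f x) ->
  (\int[mu]_(x in D) (f x)%:E = (b - a)%:E)%E.
Proof.
move=> f0; rewrite -E_bigcup.
apply/esym; apply: (cvg_unique _ FTC_lim) => //.
apply: ge0_nondecreasing_set_cvg_integral => //.
- by move=> i; exact: measurable_itv.
- move=> i; apply/measurable_EFinP; apply: measurable_funS mf => //.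
  by rewrite -E_bigcup => x Ex; exists i.
- move=> i x Ex; rewrite lee_fin f0// -RplusE -E_bigcup.
  by exists i.
Qed.

(** The signed counterpart of [FTC_ge0], by dominated convergence. *)
Lemma FTC_integrable : mu.-integrable D (EFin \o f) ->
  \int[mu]_(x in D) f x = b - a.
Proof.
move=> iF; rewrite /Rintegral.
suff -> : (\int[mu]_(x in D) (f x)%:E = (b - a)%:E)%E by [].
apply/esym; apply: (cvg_unique _ FTC_lim) => //.
have ED n : E n `<=` D by rewrite -E_bigcup => x Ex; exists n.
pose g n x := ((EFin \o f) \_ (E n)) x.
have -> : (fun n => \int[mu]_(x in E n) (f x)%:E)%E =
          (fun n => \int[mu]_(x in D) g n x)%E.
  apply/funext => n; rewrite /g -integral_mkcondr; congr integral.
  by apply/esym/setIidr/ED.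
have [] // := @dominated_convergence _ _ _ mu D measurable_Rplus g (EFin \o f) (EFin \o (Num.norm \o f)).
- move=> n; apply/measurable_restrict => //; first exact: measurable_itv.
  by apply/measurable_EFinP; apply: measurable_funS mf => // x [].
- exact: measurable_int iF.
- apply: aeW => x Dx; apply: cvg_near_cst.
  move: (Dx); rewrite -E_bigcup => -[n _ Enx].
  near=> m; rewrite /g patchT// inE.
  suff : (E n <= E m)%O by rewrite subsetEset; apply.
  by apply: E_nd; near: m; exact: nbhs_infty_ge.
- exact: integrable_norm.
- apply: aeW => x n Dx; rewrite /g patchE; case: ifP => //=.
  by rewrite normr0 lee_fin.
Unshelve. all: by end_near. Qed.
End FTC.

(** * Integrable and square integrable functions on the half-line *)

Section L2.
Context {R : realType}.
Local Notation mu := (@lebesgue_measure R).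
Local Notation D := (@Rplus R).

(** The letter D in the names below stands for the half-line. *)
Definition intD (f : R -> R) := mu.-integrable D (EFin \o f).

(** Measurability is required on the whole line, so that composites such as
    x |-> f (1/x) are measurable without a discussion of their domain. *)
Definition L2 (f : R -> R) :=
  measurable_fun setT f /\ (\int[mu]_(t in D) (f t ^+ 2)%:E < +oo)%E.

Definition kernel_op (k : R -> R -> R) (f : R -> R) (x : R) :=
  \int[mu]_(t in D) (k x t * f t).

Lemma intDP (f : R -> R) : measurable_fun setT f ->
  (\int[mu]_(t in D) `|f t|%:E < +oo)%E -> intD f.
Proof.
move=> mf h; apply/integrableP; split => //.
by apply/measurable_EFinP; exact: measurable_funTS.
Qed.

Lemma intD_dom (f g : R -> R) : measurable_fun setT f ->
  (forall t : R, 0 < t -> `|f t| <= g t) -> intD g -> intD f.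
Proof.
move=> mf fg ig; apply: le_integrable ig => //.
  by apply/measurable_EFinP; exact: measurable_funTS.
move=> x; rewrite RplusE => x0 /=; rewrite lee_fin.
by rewrite (le_trans (fg _ x0))// ler_norm.
Qed.

Lemma intD_fin (f : R -> R) : intD f ->
  (\int[mu]_(t in D) (f t)%:E)%E = (\int[mu]_(t in D) f t)%:E.
Proof. by move=> h; rewrite /Rintegral fineK//; exact: integrable_fin_num. Qed.

Lemma intD_norm_lty (f : R -> R) : intD f -> (\int[mu]_(t in D) `|f t|%:E < +oo)%E.
Proof. by case/integrableP. Qed.

Lemma intDD (f g : R -> R) : intD f -> intD g -> intD (fun t => f t + g t).
Proof. by move=> h1 h2; apply: (integrableD _ h1 h2). Qed.

Lemma intDZ (c : R) (f : R -> R) : intD f -> intD (fun t => c * f t).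
Proof. by move=> h1; apply: (integrableZl _ c h1). Qed.

Lemma intDB (f g : R -> R) : intD f -> intD g -> intD (fun t => f t - g t).
Proof. by move=> h1 h2; apply: (integrableB _ h1 h2). Qed.

Lemma intD_norm (f : R -> R) : intD f -> intD (fun t => `|f t|).
Proof. exact: integrable_norm. Qed.

Lemma eq_intD (f g : R -> R) : (forall t : R, 0 < t -> f t = g t) -> intD f -> intD g.
Proof.
move=> fg; apply: eq_integrable => // x; rewrite inE RplusE => x0 /=.
by rewrite fg.
Qed.

Lemma eq_RintD (f g : R -> R) : (forall t : R, 0 < t -> f t = g t) ->
  \int[mu]_(t in D) f t = \int[mu]_(t in D) g t.
Proof. by move=> fg; apply: eq_Rintegral => x; rewrite inE RplusE; exact: fg. Qed.

Lemma le_RintD (f g : R -> R) : intD f -> intD g ->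
  (forall t : R, 0 < t -> f t <= g t) ->
  \int[mu]_(t in D) f t <= \int[mu]_(t in D) g t.
Proof.
by move=> h1 h2 fg; apply: le_Rintegral => // x; rewrite RplusE; exact: fg.
Qed.

Lemma RintD_Z (c : R) (f : R -> R) : intD f ->
  \int[mu]_(t in D) (c * f t) = c * \int[mu]_(t in D) f t.
Proof. by move=> h; rewrite RintegralZl. Qed.

Lemma RintD_D (f g : R -> R) : intD f -> intD g ->
  \int[mu]_(t in D) (f t + g t) = \int[mu]_(t in D) f t + \int[mu]_(t in D) g t.
Proof. by move=> h1 h2; rewrite RintegralD. Qed.

Lemma L2_sqr (f : R -> R) : L2 f -> intD (fun t => f t ^+ 2).
Proof.
move=> [mf f2]; apply: intDP; first exact: measurable_funX.
by under eq_integral do rewrite ger0_norm ?sqr_ge0//.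
Qed.

Lemma L2P (f : R -> R) : measurable_fun setT f -> intD (fun t => f t ^+ 2) -> L2 f.
Proof.
move=> mf /intD_norm_lty; split => //.
by under eq_integral do rewrite -[_ ^+ 2]ger0_norm ?sqr_ge0//.
Qed.

Lemma L2_mul (f g : R -> R) : L2 f -> L2 g -> intD (fun t => f t * g t).
Proof.
move=> f2 g2; apply: (intD_dom _ (fun t => f t ^+ 2 + g t ^+ 2)).
- by apply: measurable_funM; [case: f2|case: g2].
- move=> t _; rewrite normrM -(real_normK (num_real (f t))) -(real_normK (num_real (g t))).
  by have := sqr_ge0 (`|f t| - `|g t|); have := sqr_ge0 (`|f t| + `|g t|); nra.
- by apply: intDD; exact: L2_sqr.
Qed.

Lemma L2_dom (f g : R -> R) : measurable_fun setT f -> L2 g ->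
  (forall t : R, 0 < t -> `|f t| <= `|g t|) -> L2 f.
Proof.
move=> mf g2 fg; apply: L2P => //.
apply: (intD_dom _ _ _ _ (L2_sqr _ g2)) => [|t t0]; first exact: measurable_funX.
by rewrite normrX -(real_normK (num_real (g t))) ler_pXn2r ?nnegrE// fg.
Qed.

Lemma L2_norm (f : R -> R) : L2 f -> L2 (fun t => `|f t|).
Proof.
move=> f2; apply: (L2_dom _ f) => //; first by apply: measurableT_comp => //; case: f2.
by move=> t _; rewrite normr_id.
Qed.

Lemma L2_Z (c : R) (f : R -> R) : L2 f -> L2 (fun t => c * f t).
Proof.
move=> f2; apply: L2P; first by apply: measurable_funM => //; case: f2.
apply: (eq_intD (fun t => c ^+ 2 * f t ^+ 2)) => [t _|]; first by rewrite exprMn.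
exact/intDZ/L2_sqr.
Qed.

(** The weight m is what the Schur test needs.  With I the integral of
    m a b, the inequality follows from integrating
    0 <= m (c a - b)^2 for the single value c = I / A. *)
Lemma cauchy_schwarz (m a b : R -> R) (A : R) :
  measurable_fun setT m -> measurable_fun setT a -> measurable_fun setT b ->
  (forall t : R, 0 < t -> 0 <= m t) -> 0 < A ->
  (\int[mu]_(t in D) (m t * a t ^+ 2)%:E <= A%:E)%E ->
  (((\int[mu]_(t in D) (m t * a t * b t)) ^+ 2)%:E <=
   A%:E * \int[mu]_(t in D) (m t * b t ^+ 2)%:E)%E.
Proof.
move=> mm ma mb m0 A0 hA.
have D0 (u : R -> R) t : D t -> (0 <= (m t * u t ^+ 2)%:E)%E.
  by rewrite RplusE lee_fin => t0; rewrite mulr_ge0 ?sqr_ge0 ?m0.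
have mq (u : R -> R) : measurable_fun setT u -> measurable_fun setT (fun t => m t * u t ^+ 2).
  by move=> mu_; apply: measurable_funM => //; exact: measurable_funX.
have intq (u : R -> R) : measurable_fun setT u ->
    (\int[mu]_(t in D) (m t * u t ^+ 2)%:E < +oo)%E -> intD (fun t => m t * u t ^+ 2).
  move=> mu_ h; apply: intDP; first exact: mq.
  rewrite (_ : integral _ _ _ = \int[mu]_(t in D) (m t * u t ^+ 2)%:E)%E//.
  apply: eq_integral => t; rewrite inE => Dt; rewrite ger0_norm//.
  by have := D0 u t Dt; rewrite lee_fin.
have [Q|] := ltP (\int[mu]_(t in D) (m t * b t ^+ 2)%:E)%E +oo%E; last first.
  by rewrite leye_eq => /eqP ->; rewrite gt0_muley ?leey// lte_fin.
have ia := intq a ma (le_lt_trans hA (ltry A)).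
have ib := intq b mb Q.
have iab : intD (fun t => m t * a t * b t).
  apply: (intD_dom _ _ _ _ (intDD _ _ ia ib)).
    by do 2 apply: measurable_funM => //.
  move=> t t0; have m0' := m0 t t0; rewrite -mulrA normrM (ger0_norm m0') -mulrDr.
  apply: ler_wpM2l => //; rewrite normrM.
  rewrite -(real_normK (num_real (a t))) -(real_normK (num_real (b t))).
  by have := sqr_ge0 (`|a t| - `|b t|); have := sqr_ge0 (`|a t| + `|b t|); nra.
move: hA; rewrite (intD_fin _ ia) (intD_fin _ ib) -EFinM !lee_fin => hA.
set I := (\int[mu]_(t in D) (m t * a t * b t)).
(* the minimizer of the quadratic polynomial c |-> c^2 A - 2 c I *)
pose c := I / A.
have : 2 * c * I <= c ^+ 2 * \int[mu]_(t in D) (m t * a t ^+ 2) +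
                    \int[mu]_(t in D) (m t * b t ^+ 2).
  rewrite /I -RintD_Z// -RintD_Z// -RintegralD//; last exact: intDZ.
  apply: le_RintD => [||t t0]; [exact: intDZ|by apply: intDD => //; exact: intDZ|].
  have := m0 t t0; have := sqr_ge0 (c * a t - b t) => h1 h2.
  rewrite -subr_ge0 (_ : _ - _ = m t * (c * a t - b t) ^+ 2); last by ring.
  exact: mulr_ge0.
set qa := \int[mu]_(t in D) _; set qb := \int[mu]_(t in D) _ => h.
have h2 : 2 * c * I <= c ^+ 2 * A + qb.
  by apply: (le_trans h); rewrite lerD2r ler_wpM2l// sqr_ge0.
have e1 : A * c = I by rewrite /c mulrC divfK// gt_eqF.
rewrite -e1 in h2 *.
have := ler_wpM2l (ltW A0) h2; nra.
Qed.
End L2.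

(** * Integral operators: Schur test and transposition *)

(** Closes measurability goals built from arithmetic operations and
    hypotheses of the context, including those on functions of two variables. *)
Ltac meas := repeat first
  [ exact: measurable_cst | exact: measurable_fst | exact: measurable_snd
  | exact: measurable_id | assumption
  | exact/EFin_measurable
  | apply: measurable_funM | apply: measurable_funD | apply: measurable_funB
  | apply: measurable_funN | apply: measurable_funX | apply: measurable_funV
  | match goal with
    | H : measurable_fun _ ?f |- context [?f (fst _)] =>
        apply: (measurableT_comp H); exact: measurable_fst
    | H : measurable_fun _ ?f |- context [?f (snd _)] =>
        apply: (measurableT_comp H); exact: measurable_snd
    | |- measurable_fun _ (fun _ => `| _ |) => apply: (measurableT_comp (@normr_measurable _ setT))
    end ].

Section Op.
Context {R : realType}.
Local Notation mu := (@lebesgue_measure R).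
Local Notation D := (@Rplus R).

Lemma measurable_op (k : R -> R -> R) f : measurable2 k -> measurable_fun setT f ->
  measurable_fun setT (kernel_op k f).
Proof.
move=> mk mf; rewrite /kernel_op; apply: (measurable_Rint (fun x t => k x t * f t)).
by rewrite /measurable2; meas.
Qed.

(** The Schur test for a nonnegative kernel.  Splitting k f as the product of
    (k w)^(1/2) and (k / w)^(1/2) f, the Cauchy-Schwarz inequality bounds
    (K f)^2 by A w times the integral of (k / w) f^2; integrating in x, the
    column estimate gives the second factor A. *)
Lemma schur (k : R -> R -> R) (w : R -> R) (A : R) (f : R -> R) :
  measurable2 k -> measurable_fun setT w -> measurable_fun setT f -> 0 < A ->
  (forall x t : R, 0 < x -> 0 < t -> 0 <= k x t) ->
  (forall t : R, 0 < t -> 0 < w t) ->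
  (forall x : R, 0 < x -> (\int[mu]_(t in D) (k x t * w t)%:E <= (A * w x)%:E)%E) ->
  (forall t : R, 0 < t -> (\int[mu]_(x in D) (k x t * w x)%:E <= (A * w t)%:E)%E) ->
  (\int[mu]_(x in D) (kernel_op k f x ^+ 2)%:E <=
   (A ^+ 2)%:E * \int[mu]_(t in D) (f t ^+ 2)%:E)%E.
Proof.
move=> mk mw mf A0 k0 w0 row col.
have mk1 := measurable2_1 _ mk; have mk2 := measurable2_2 _ mk.
have nn x t : D x -> D t -> (0 <= (k x t / w t * f t ^+ 2)%:E)%E.
  rewrite !RplusE lee_fin => x0 t0; apply: mulr_ge0; last exact: sqr_ge0.
  by apply: divr_ge0; [exact: k0|exact/ltW/w0].
apply: (@le_trans _ _ (\int[mu]_(x in D) ((A * w x)%:E *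
    \int[mu]_(t in D) (k x t / w t * f t ^+ 2)%:E))%E).
  have mI : measurable_fun setT (fun x => \int[mu]_(t in D) `|k x t / w t * f t ^+ 2|%:E)%E.
    apply: (measurable_int_ge0 (fun x t => `|k x t / w t * f t ^+ 2|%:E)) => [|x t].
      by apply/measurable_EFinP; rewrite /measurable2 in mk; meas.
    by rewrite lee_fin.
  have eI x : D x -> (\int[mu]_(t in D) (k x t / w t * f t ^+ 2)%:E =
      \int[mu]_(t in D) `|k x t / w t * f t ^+ 2|%:E)%E.
    move=> Dx; apply: eq_integral => t; rewrite inE => Dt.
    by rewrite ger0_norm// -lee_fin nn.
  apply: ge0_le_integral => //.
  - by move=> x _; rewrite lee_fin sqr_ge0.
  - by apply/measurable_EFinP/measurable_funTS/measurable_funX; exact: measurable_op.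
  - apply: (eq_measurable_fun (fun x => (A * w x)%:E *
       \int[mu]_(t in D) `|k x t / w t * f t ^+ 2|%:E)%E).
      by move=> x; rewrite inE => Dx; rewrite eI.
    apply: measurable_funTS; apply: emeasurable_funM => //.
    by apply/measurable_EFinP; exact: measurable_funM.
  - move=> x Dx; have x0 : 0 < x by rewrite -RplusE.
    have := @cauchy_schwarz R (fun t => k x t / w t) w f (A * w x).
    rewrite (_ : (\int[mu]_(t in D) (k x t / w t * w t * f t))%R = kernel_op k f x); last first.
      by apply: eq_RintD => t t0; rewrite divfK// gt_eqF// w0.
    apply => //; [by have ? := mk1 x; meas|by move=> t t0; rewrite divr_ge0 ?k0 ?ltW ?w0| |].
      by rewrite mulr_gt0 ?w0.
    apply: le_trans (row _ x0); rewrite le_eqVlt; apply/orP; left; apply/eqP.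
    apply: eq_integral => t; rewrite inE RplusE => t0.
    by rewrite expr2 mulrA divfK// gt_eqF// w0.
apply: (@le_trans _ _ (\int[mu]_(x in D) \int[mu]_(t in D)
    `|A * w x * (k x t / w t * f t ^+ 2)|%:E)%E).
  rewrite le_eqVlt; apply/orP; left; apply/eqP.
  apply: eq_integral => x; rewrite inE => Dx; have x0 : 0 < x by rewrite -RplusE.
  rewrite -ge0_integralZl//.
  - apply: eq_integral => t; rewrite inE => Dt; rewrite -EFinM ger0_norm//.
    apply: mulr_ge0; last by have := nn x t Dx Dt; rewrite lee_fin.
    by rewrite mulr_ge0 ?ltW ?w0.
  - by apply/measurable_EFinP/measurable_funTS; have ? := mk1 x; meas.
  - by move=> t Dt; exact: nn.
  - by rewrite lee_fin mulr_ge0 ?ltW ?w0.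
rewrite tonelli; last 2 first.
- by apply/measurable_EFinP; rewrite /measurable2 in mk; meas.
- by move=> x t _ _; rewrite lee_fin.
rewrite -ge0_integralZl//; last 3 first.
- by apply/measurable_EFinP/measurable_funTS; meas.
- by move=> t _; rewrite lee_fin sqr_ge0.
- by rewrite lee_fin sqr_ge0.
apply: ge0_le_integral => //.
- by move=> t _; apply: integral_ge0 => x _; rewrite lee_fin.
- apply: measurable_funTS.
  apply: (measurable_int_ge0 (fun t x => `|A * w x * (k x t / w t * f t ^+ 2)|%:E)) => [|x t].
    have mk' := measurable2C _ mk.
    by apply/measurable_EFinP; rewrite /measurable2 in mk'; meas.
  by rewrite lee_fin.
- by apply/measurable_EFinP/measurable_funTS; meas.
move=> t Dt; have t0 : 0 < t by rewrite -RplusE.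
rewrite (_ : integral _ _ _ = ((A / w t * f t ^+ 2)%:E *
    \int[mu]_(x in D) (k x t * w x)%:E)%E); last first.
  rewrite -ge0_integralZl//.
  - apply: eq_integral => x; rewrite inE => Dx; have x0 : 0 < x by rewrite -RplusE.
    rewrite -EFinM ger0_norm.
      by congr EFin; field; rewrite gt_eqF// w0.
    apply: mulr_ge0; last by have := nn x t Dx Dt; rewrite lee_fin.
    by rewrite mulr_ge0 ?ltW ?w0.
  - by apply/measurable_EFinP/measurable_funTS; have ? := mk2 t; meas.
  - by move=> x; rewrite RplusE => x0; rewrite lee_fin mulr_ge0 ?k0 ?ltW ?w0.
  - by rewrite lee_fin mulr_ge0 ?sqr_ge0 ?divr_ge0 ?ltW ?w0.
apply: le_trans (lee_wpmul2l _ (col _ t0)) _.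
  by rewrite lee_fin mulr_ge0 ?sqr_ge0 ?divr_ge0 ?ltW ?w0.
rewrite -!EFinM lee_fin le_eqVlt; apply/orP; left; apply/eqP.
by field; rewrite gt_eqF// w0.
Qed.

(** Fubini: the transpose of an integral operator, under absolute
    convergence of the double integral. *)
Lemma pairing (k : R -> R -> R) (p f : R -> R) :
  measurable2 k -> measurable_fun setT p -> measurable_fun setT f ->
  (\int[mu]_(x in D) \int[mu]_(t in D) `|p x * k x t * f t|%:E < +oo)%E ->
  (forall x : R, 0 < x -> intD (fun t => k x t * f t)) ->
  (forall t : R, 0 < t -> intD (fun x => p x * k x t)) ->
  \int[mu]_(x in D) (p x * kernel_op k f x) =
  \int[mu]_(t in D) (f t * \int[mu]_(x in D) (p x * k x t)).
Proof.
move=> mk mp mf h h1 h2.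
have mF : measurable2 (fun x t => p x * k x t * f t) by rewrite /measurable2 in mk *; meas.
have := fubini_Rint _ mF h.
rewrite (eq_RintD _ (fun x => p x * kernel_op k f x)); last first.
  move=> x x0; rewrite /kernel_op -RintD_Z; last exact: h1.
  by apply: eq_RintD => t _; rewrite mulrA.
move=> ->; apply: eq_RintD => t t0; rewrite -RintD_Z; last exact: h2.
by apply: eq_RintD => x _; rewrite mulrC.
Qed.
End Op.

(** * Computing derivatives and limits at infinity *)

Section Deriv.
Context {R : realType}.
Implicit Types (f g : R -> R) (x a b : R).

(** A copy of [is_derive] along 1 that typeclass resolution does not see, so
    that the form of the derivative computed by [deriv] is the one given by the
    rules below. *)
Definition isd (x : R) (f : R -> R) (a : R) := is_derive x 1 f a.

Lemma isd_is_derive f x a : isd x f a -> is_derive x 1 f a. Proof. by []. Qed.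
Lemma isd_eq f x a b : isd x f a -> a = b -> isd x f b.
Proof. by move=> h <-. Qed.
Lemma isd_cst x (c : R) : isd x (fun _ : R => c) 0.
Proof. exact: is_derive_cst. Qed.
Lemma isd_id x : isd x (fun y : R => y) 1.
Proof. exact: is_derive_id. Qed.
Lemma isdD f g x a b : isd x f a -> isd x g b ->
  isd x (fun y => f y + g y) (a + b).
Proof. by move=> h1 h2; exact: is_deriveD. Qed.
Lemma isdB f g x a b : isd x f a -> isd x g b ->
  isd x (fun y => f y - g y) (a - b).
Proof. by move=> h1 h2; exact: is_deriveB. Qed.
Lemma isdN f x a : isd x f a -> isd x (fun y => - f y) (- a).
Proof. by move=> h1; exact: is_deriveN. Qed.
Lemma isdM f g x a b : isd x f a -> isd x g b ->
  isd x (fun y => f y * g y) (f x * b + g x * a).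
Proof. by move=> h1 h2; exact: is_deriveM. Qed.
Lemma isdX f x a : isd x f a -> isd x (fun y => f y ^+ 2) (2 * f x * a).
Proof.
move=> h1; have h := is_deriveX 2 h1; apply: is_derive_eq h _.
by rewrite /GRing.scale/= expr1 -mulrA -mulr_natl.
Qed.
Lemma isdV f x a : f x != 0 -> isd x f a ->
  isd x (fun y => (f y)^-1) (- a / f x ^+ 2).
Proof.
move=> f0 h1; have h := is_deriveV f0 h1; apply: is_derive_eq h _.
by rewrite /GRing.scale/= mulNr mulNr mulrC.
Qed.
Lemma isd_ln f x a : 0 < f x -> isd x f a ->
  isd x (fun y => ln (f y)) (a / f x).
Proof.
move=> f0 h1; have h := is_derive1_comp (is_derive1_ln f0) h1; apply: is_derive_eq h _.
exact: mulrC.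
Qed.
Lemma isd_atan f x a : isd x f a ->
  isd x (fun y => atan (f y)) (a / (1 + f x ^+ 2)).
Proof.
move=> h1; have h := is_derive1_comp (is_derive1_atan (f x)) h1; apply: is_derive_eq h _.
exact: mulrC.
Qed.
Lemma isd_sqrt f x a : 0 < f x -> isd x f a ->
  isd x (fun y => Num.sqrt (f y)) (a / (2 * Num.sqrt (f x))).
Proof.
move=> f0 h1; have h := is_derive1_comp (is_derive1_sqrt f0) h1; apply: is_derive_eq h _.
exact: mulrC.
Qed.

Lemma isd_continuous f x a : isd x f a -> {for x, continuous f}.
Proof.
move=> [h _]; apply: differentiable_continuous; exact/derivable1_diffP.
Qed.

End Deriv.
(** Differentiates an explicit expression by structural recursion, leaving the
    nonvanishing and positivity conditions as goals. *)
Ltac deriv := first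
  [ exact: isd_id | exact: isd_cst
  | eapply isdD; deriv | eapply isdB; deriv | eapply isdN; deriv | eapply isdM; deriv
  | eapply isdX; deriv | eapply isdV; [|deriv]
  | eapply isd_ln; [|deriv] | eapply isd_atan; deriv
  | eapply isd_sqrt; [|deriv] | eapply isd_sqrt; [|exact: isd_id] | eapply isd_ln; [|exact: isd_id]
  | idtac ].
Ltac derivE := apply: isd_is_derive; eapply isd_eq; [deriv|cbv beta].

Section Lim.
Context {R : realType}.

Lemma cvgy_inv (f : R -> R) : f x @[x --> +oo%R] --> +oo%R ->
  (f x)^-1 @[x --> +oo%R] --> (0 : R).
Proof.
move=> h; apply/(gtr0_cvgV0 _) => //.
by move/cvgryPgt : h; apply.
Unshelve. all: by end_near. Qed.

Lemma cvgy_Mp (c : R) (f : R -> R) : 0 < c -> f x @[x --> +oo%R] --> +oo%R ->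
  f x * c @[x --> +oo%R] --> +oo%R.
Proof.
move=> c0 h; apply/cvgryPge => A; near=> x; rewrite -ler_pdivrMr//.
by near: x; move/cvgryPge : h; apply.
Unshelve. all: by end_near. Qed.

Lemma cvgy_atan_comp (f : R -> R) : f x @[x --> +oo%R] --> +oo%R ->
  atan (f x) @[x --> +oo%R] --> (pi / 2 : R).
Proof. by move=> h; exact: (cvg_comp _ _ h (@cvgy_atan R)). Qed.

Lemma cvgy_sqrt : Num.sqrt x @[x --> +oo%R] --> (+oo%R : set_system R).
Proof.
apply/cvgryPge => A; near=> x.
have h : `|A| ^+ 2 <= x by near: x; exact: nbhs_pinfty_ge.
rewrite (le_trans (ler_norm A))// -(sqrtr_sqr A) ler_sqrt ?sqr_ge0//.
Unshelve. all: by end_near. Qed.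

End Lim.

(** * The Carleman kernel and the kernels that it dominates *)

Section Carleman.
Context {R : realType}.
Local Notation mu := (@lebesgue_measure R).
Local Notation D := (@Rplus R).

Definition carleman (x t : R) : R := (x + t)^-1.

Lemma measurable2_carleman : measurable2 carleman.
Proof. by rewrite /measurable2 /carleman; meas. Qed.

Lemma carlemanC x t : carleman x t = carleman t x.
Proof. by rewrite /carleman addrC. Qed.

Lemma carleman_gt0 (x t : R) : 0 < x -> 0 < t -> 0 < carleman x t.
Proof. by move=> x0 t0; rewrite invr_gt0 addr_gt0. Qed.

Lemma FTC_ge0_at0 (f F : R -> R) (b : R) :
  (forall x : R, 0 < x -> isd x F (f x)) ->
  (forall x : R, 0 < x -> {for x, continuous f}) ->
  {for 0, continuous F} -> F x @[x --> +oo%R] --> b ->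
  (forall x : R, 0 < x -> 0 <= f x) ->
  (\int[mu]_(x in D) (f x)%:E = (b - F 0)%:E)%E.
Proof.
move=> dF cf F0 Fb f0; apply: (FTC_ge0 f F) => //.
exact: cvg_at_right_filter.
Qed.

Lemma carleman_sqr_int (x : R) : 0 < x ->
  (\int[mu]_(t in D) (carleman x t ^+ 2)%:E = (x^-1)%:E)%E.
Proof.
move=> x0.
have nz (t : R) : 0 <= t -> x + t != 0 by move=> t0; rewrite gt_eqF// ltr_wpDr.
rewrite (FTC_ge0_at0 (fun t => carleman x t ^+ 2) (fun t => - (x + t)^-1) 0).
- by rewrite addr0 sub0r opprK.
- by move=> t /ltW t0; derivE; [exact: nz|have := nz t t0 => h; rewrite /carleman; field].
- move=> t /ltW t0; rewrite /carleman; apply: isd_continuous; deriv; exact: nz.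
- by apply: isd_continuous; deriv; exact: nz.
- rewrite -[X in _ --> X]oppr0; apply: cvgN; apply: cvgy_inv; exact: cvg_addrl.
- by move=> t _; rewrite sqr_ge0.
Qed.

Lemma L2_carleman (x : R) : 0 < x -> L2 (carleman x).
Proof.
move=> x0; split; last by rewrite carleman_sqr_int ?ltry.
exact: (measurable2_1 _ measurable2_carleman).
Qed.

(** The weight 1/sqrt t is an eigenfunction of the Carleman operator, with
    eigenvalue pi, which is what the Schur test asks for. *)
Lemma carleman_sqrtV_int (x : R) : 0 < x ->
  (\int[mu]_(t in D) (carleman x t * (Num.sqrt t)^-1)%:E = (pi * (Num.sqrt x)^-1)%:E)%E.
Proof.
move=> x0.
have sx0 : 0 < Num.sqrt x by rewrite sqrtr_gt0.
rewrite (FTC_ge0 _ (fun t => 2 / Num.sqrt x * atan (Num.sqrt t / Num.sqrt x)) _ _ 0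
  (2 / Num.sqrt x * (pi / 2))).
- by rewrite subr0; congr EFin; field; rewrite gt_eqF.
- move=> t t0; have st0 : 0 < Num.sqrt t by rewrite sqrtr_gt0.
  derivE => //; rewrite /carleman.
  have -> : x + t = Num.sqrt x ^+ 2 + Num.sqrt t ^+ 2 by rewrite !sqr_sqrtr ?ltW.
  field; rewrite !gt_eqF//=.
  by rewrite addr_gt0// exprn_gt0.
- move=> t t0; apply: isd_continuous; rewrite /carleman; deriv => //.
    by rewrite gt_eqF// addr_gt0.
  by rewrite gt_eqF// sqrtr_gt0.
- have e0 : 2 / Num.sqrt x * atan (Num.sqrt 0 / Num.sqrt x) = 0.
    by rewrite sqrtr0 mul0r atan0 mulr0.
  rewrite -[X in _ --> X]e0; apply: cvgMr; apply: cvg_at_right_filter.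
  apply: (@continuous_comp _ _ _ (fun t : R => Num.sqrt t / Num.sqrt x) (@atan R)).
    by apply: cvgM; [exact: sqrt_continuous|exact: cvg_cst].
  exact: continuous_atan.
- apply: cvgMr; apply: cvgy_atan_comp; apply: cvgy_Mp; last exact: cvgy_sqrt.
  by rewrite invr_gt0.
- move=> t t0; rewrite mulr_ge0// ?invr_ge0 ?sqrtr_ge0// ltW//.
  exact: addr_gt0.
Qed.

(** Hilbert's inequality: the Carleman operator is bounded on L2(D), by the
    Schur test with weight 1/sqrt t. *)
Lemma L2_op_carleman (f : R -> R) : L2 f -> L2 (kernel_op carleman f).
Proof.
move=> [mf f2]; split; first exact: measurable_op measurable2_carleman mf.
have := @schur R carleman (fun t => (Num.sqrt t)^-1) pi f measurable2_carleman.
move=> /(_ _ mf (pi_gt0 R)) h; apply: le_lt_trans (h _ _ _ _ _) _.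
- apply: measurable_funV; apply: continuous_measurable_fun; exact: sqrt_continuous.
- by move=> x t x0 t0; rewrite ltW// carleman_gt0.
- by move=> t t0; rewrite invr_gt0 sqrtr_gt0.
- by move=> x x0; rewrite carleman_sqrtV_int.
- move=> t t0; under eq_integral do rewrite carlemanC.
  by rewrite carleman_sqrtV_int.
- by rewrite lte_mul_pinfty// lee_fin sqr_ge0.
Qed.

(** Kernels for which boundedness on L2(D) and the exchange of integrals are
    inherited from the Carleman kernel. *)
Definition carleman_dom (k : R -> R -> R) :=
  measurable2 k /\ exists c : R, forall x t : R, 0 < x -> 0 < t -> `|k x t| <= c * carleman x t.

Lemma carleman_domC k : carleman_dom k -> carleman_dom (fun x t => k t x).
Proof.
move=> [mk [c hc]]; split; first exact: measurable2C.
by exists c => x t x0 t0; rewrite carlemanC hc.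
Qed.

Lemma carleman_dom_L2 k : carleman_dom k -> forall x : R, 0 < x -> L2 (k x).
Proof.
move=> [mk [c hc]] x x0; apply: (L2_dom _ (fun t => c * carleman x t)).
- exact: measurable2_1.
- exact/L2_Z/L2_carleman.
- by move=> t t0; apply: (le_trans (hc _ _ x0 t0)); exact: ler_norm.
Qed.

Lemma carleman_dom_int k f : carleman_dom k -> L2 f -> forall x : R, 0 < x -> intD (fun t => k x t * f t).
Proof. by move=> hk f2 x x0; apply: L2_mul => //; exact: carleman_dom_L2. Qed.

Lemma carleman_dom_L2_op k f : carleman_dom k -> L2 f -> L2 (kernel_op k f).
Proof.
move=> hk f2; have [mk [c hc]] := hk.
apply: (L2_dom _ (fun x => c * kernel_op carleman (fun t => `|f t|) x)).
- by apply: measurable_op => //; case: f2.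
- exact/L2_Z/L2_op_carleman/L2_norm.
move=> x x0; rewrite /kernel_op -RintD_Z; last first.
  by apply: L2_mul; [exact: L2_carleman|exact: L2_norm].
have i1 := carleman_dom_int _ _ hk f2 x x0.
apply: (le_trans (le_normr_Rintegral _ i1)) => //.
rewrite (le_trans _ (ler_norm _))//; apply: le_RintD.
- exact: intD_norm.
- by apply: intDZ; apply: L2_mul; [exact: L2_carleman|exact: L2_norm].
- by move=> t t0; rewrite normrM mulrA ler_wpM2r// hc.
Qed.

(** The absolute double integral is the pairing of |p| with the image of |f|
    under the kernel |k|, which is again dominated by the Carleman kernel. *)
Lemma carleman_dom_abs k p f : carleman_dom k -> L2 p -> L2 f ->
  (\int[mu]_(x in D) \int[mu]_(t in D) `|p x * k x t * f t|%:E < +oo)%E.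
Proof.
move=> hk p2 f2; have [mk [c hc]] := hk.
have hk' : carleman_dom (fun x t => `|k x t|).
  split; first by rewrite /measurable2 in mk *; meas.
  by exists c => x t x0 t0; rewrite normr_id hc.
have := intD_norm_lty _ (L2_mul _ _ p2 (carleman_dom_L2_op _ _ hk' (L2_norm _ f2))).
apply: le_lt_trans; rewrite le_eqVlt; apply/orP; left; apply/eqP.
apply: eq_integral => x; rewrite inE RplusE => x0.
rewrite intD_fin; last first.
  apply: intD_norm; apply: (eq_intD (fun t => p x * (k x t * f t))).
    by move=> t _; rewrite mulrA.
  by apply: intDZ; exact: carleman_dom_int.
rewrite normrM (ger0_norm (x := kernel_op _ _ _)); last first.
  by apply: Rintegral_ge0 => t _; exact: mulr_ge0.
rewrite /kernel_op -RintD_Z; last exact: (carleman_dom_int _ _ hk' (L2_norm _ f2)).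
by congr EFin; apply: eq_RintD => t t0; rewrite !normrM mulrA.
Qed.

Lemma carleman_dom_pairing k p f : carleman_dom k -> L2 p -> L2 f ->
  \int[mu]_(x in D) (p x * kernel_op k f x) =
  \int[mu]_(t in D) (f t * \int[mu]_(x in D) (p x * k x t)).
Proof.
move=> hk p2 f2; apply: pairing; [by case: hk|by case: p2|by case: f2| | |].
- exact: carleman_dom_abs.
- exact: carleman_dom_int.
- move=> t t0; apply: L2_mul => //.
  exact: (carleman_dom_L2 _ (carleman_domC _ hk)).
Qed.

(** The right-hand side of [carleman_dom_pairing] is a convergent integral,
    which is what allows constants and differences to be moved through it. *)
Lemma carleman_dom_pairing_int k p f : carleman_dom k -> L2 p -> L2 f ->
  intD (fun t => f t * \int[mu]_(x in D) (p x * k x t)).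
Proof.
move=> hk p2 f2; have [mk _] := hk; have [mp _] := p2; have [mf _] := f2.
have mF : measurable2 (fun x t => p x * k x t * f t) by rewrite /measurable2 in mk *; meas.
have := integrable_fubini2 _ mF (carleman_dom_abs _ _ _ hk p2 f2).
apply: eq_integrable => // t; rewrite inE RplusE => t0 /=; congr EFin.
rewrite -RintD_Z; first by apply: eq_RintD => x _; rewrite mulrC.
by apply: L2_mul => //; exact: (carleman_dom_L2 _ (carleman_domC _ hk)).
Qed.
End Carleman.

(** * The Stieltjes kernel *)

Section Kernels.
Context {R : realType}.
Local Notation mu := (@lebesgue_measure R).
Local Notation D := (@Rplus R).
Implicit Types (x y t u d : R).

Lemma cvgy_sqrD (a : R) : x ^+ 2 + a @[x --> +oo%R] --> +oo%R.
Proof.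
apply/cvgryPge => A; near=> x; rewrite -lerBlDr.
near: x; have /cvgryPge := @cvgr_expr2 R; exact.
Unshelve. all: by end_near. Qed.

Lemma cvgy_sqrDV (a : R) : (x ^+ 2 + a)^-1 @[x --> +oo%R] --> (0 : R).
Proof. exact/cvgy_inv/cvgy_sqrD. Qed.

Lemma cvgy_atan_div (a c : R) : 0 < c -> atan ((x + a) / c) @[x --> +oo%R] --> (pi / 2 : R).
Proof.
move=> c0; apply: cvgy_atan_comp; apply: cvgy_Mp; first by rewrite invr_gt0.
exact: cvg_addrr.
Qed.

Lemma cvgy_atan_div0 (c : R) : 0 < c -> atan (x / c) @[x --> +oo%R] --> (pi / 2 : R).
Proof.
move=> c0; apply: cvgy_atan_comp; apply: cvgy_Mp; first by rewrite invr_gt0.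
exact: cvg_id.
Qed.

Lemma cvgy_xV (a : R) : 0 < a -> x / (x ^+ 2 + a) @[x --> +oo%R] --> (0 : R).
Proof.
move=> a0; apply: (@squeeze_cvgr _ _ _ _ (fun=> 0) (fun x => x^-1)).
- near=> x; have x0 : 0 < x by near: x; exact: nbhs_pinfty_gt.
  apply/andP; split; first by rewrite divr_ge0 ?ltW// ltr_wpDl ?sqr_ge0.
  rewrite ler_pdivrMr; last by rewrite ltr_wpDl ?sqr_ge0.
  by rewrite -(@ler_pM2l _ x)// mulrA mulfV ?mul1r ?gt_eqF// -expr2 lerDl ltW.
- exact: cvg_cst.
- apply: cvgy_inv; exact: cvg_id.
Unshelve. all: by end_near. Qed.

Lemma cvg_ln1 {T : Type} (F : set_system T) {FF : Filter F} (f : T -> R) :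
  f x @[x --> F] --> (1 : R) -> ln (f x) @[x --> F] --> (0 : R).
Proof.
move=> h; rewrite -(@ln1 R); apply: cvg_comp h _; exact: continuous_ln.
Qed.

Lemma sqrD_gt0 x t : 0 < t -> 0 < x ^+ 2 + t ^+ 2.
Proof. by move=> t0; rewrite ltr_wpDl ?sqr_ge0// exprn_gt0. Qed.

(** After the substitution s = x^2, u = t^2 the operator with this kernel
    becomes, up to a factor 1/2, the Stieltjes transform with kernel 1/(s + u). *)
Definition stieltjes x t : R := t / (x ^+ 2 + t ^+ 2).

Lemma stieltjes_ge0 x t : 0 < t -> 0 <= stieltjes x t.
Proof. by move=> t0; rewrite divr_ge0 ?ltW// sqrD_gt0. Qed.

Lemma carleman_dom_stieltjes : carleman_dom stieltjes.
Proof.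
split; first by rewrite /measurable2 /stieltjes; meas.
exists 2 => x t x0 t0; rewrite ger0_norm ?stieltjes_ge0// /stieltjes /carleman.
rewrite ler_pdivrMr ?sqrD_gt0// mulrAC ler_pdivlMr ?addr_gt0//.
have := sqr_ge0 (x - t); nra.
Qed.

(** The Gram kernel of the Stieltjes operator is a multiple of the Carleman
    kernel, which shows that the Carleman operator is nonnegative.  The primitive
    comes from partial fractions; the confluent case y = t needs its own. *)
Lemma stieltjes_gram y t : 0 < y -> 0 < t ->
  \int[mu]_(x in D) (stieltjes x y * stieltjes x t) = pi / 2 * carleman y t.
Proof.
move=> y0 t0; rewrite /Rintegral.
have yn x := lt0r_neq0 (sqrD_gt0 x y y0); have tn x := lt0r_neq0 (sqrD_gt0 x t t0).
have y1 := lt0r_neq0 y0; have t1 := lt0r_neq0 t0.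
have yt0 : y + t != 0 by rewrite gt_eqF// addr_gt0.
have cts x : {for x, continuous (fun x => stieltjes x y * stieltjes x t)}.
  by apply: isd_continuous; rewrite /stieltjes; deriv.
have ge0 x : 0 < x -> 0 <= stieltjes x y * stieltjes x t by move=> _; rewrite mulr_ge0// stieltjes_ge0.
have lim := cvgy_atan_div0.
have [<-|yt] := eqVneq y t.
  rewrite (FTC_ge0_at0 (fun x => stieltjes x y * stieltjes x y)
    (fun x => (x / (x ^+ 2 + y ^+ 2) + atan (x / y) / y) / 2) (pi / 2 / y / 2))//=.
  - by rewrite !mul0r atan0 mul0r addr0 mul0r subr0 /carleman; field; rewrite y1 gt_eqF ?addr_gt0.
  - move=> x _; derivE => //; rewrite /stieltjes; field; by rewrite yn y1.
  - by move=> x _; apply: isd_continuous; rewrite /stieltjes; deriv.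
  - by apply: isd_continuous; deriv.
  - apply: cvgMl; rewrite -[X in _ --> X]add0r; apply: cvgD; last by apply: cvgMl; exact: lim.
    exact/cvgy_xV/exprn_gt0.
  - by move=> x _; rewrite mulr_ge0// stieltjes_ge0.
have ytn : t ^+ 2 - y ^+ 2 != 0.
  rewrite subr_sqr; apply: mulf_neq0; last by rewrite addrC.
  by rewrite subr_eq0 eq_sym.
rewrite (FTC_ge0_at0 (fun x => stieltjes x y * stieltjes x t)
  (fun x => y * t / (t ^+ 2 - y ^+ 2) * (atan (x / y) / y - atan (x / t) / t))
  (y * t / (t ^+ 2 - y ^+ 2) * (pi / 2 / y - pi / 2 / t)))//=.
- rewrite !mul0r atan0 !mul0r subr0 mulr0 subr0 /carleman.
  field; rewrite yt0 ytn y1 t1/=; done.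
- move=> x _; derivE => //; rewrite /stieltjes; field.
  by rewrite yn tn y1 t1 ytn.
- by apply: isd_continuous; deriv.
- by apply: cvgMr; apply: cvgB; apply: cvgMl; exact: lim.
Qed.

(** The kernel of the square of the Stieltjes operator is pi times the
    logarithmic part of the kernel of the equation. *)
Lemma stieltjes_iter x t : 0 < x -> 0 < t -> x != t ->
  \int[mu]_(s in D) (stieltjes x s * stieltjes s t) = t * ln (x / t) / (x ^+ 2 - t ^+ 2).
Proof.
move=> x0 t0 xt; rewrite /Rintegral.
have xn s := lt0r_neq0 (sqrD_gt0 s x x0); have tn s := lt0r_neq0 (sqrD_gt0 s t t0).
have xn' s : x ^+ 2 + s ^+ 2 != 0 by rewrite addrC.
have xtn : x ^+ 2 - t ^+ 2 != 0.
  by rewrite subr_sqr mulf_neq0// ?subr_eq0// gt_eqF// addr_gt0.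
have a0 s : 0 < 1 + (t ^+ 2 - x ^+ 2) / (s ^+ 2 + x ^+ 2).
  have -> : 1 + (t ^+ 2 - x ^+ 2) / (s ^+ 2 + x ^+ 2) = (s ^+ 2 + t ^+ 2) / (s ^+ 2 + x ^+ 2).
    by field.
  by rewrite divr_gt0// sqrD_gt0.
rewrite (FTC_ge0_at0 (fun s => stieltjes x s * stieltjes s t)
  (fun s => t / (2 * (x ^+ 2 - t ^+ 2)) * ln (1 + (t ^+ 2 - x ^+ 2) / (s ^+ 2 + x ^+ 2))) 0)/=.
- rewrite sub0r expr0n/= add0r.
  have -> : 1 + (t ^+ 2 - x ^+ 2) / x ^+ 2 = (x / t) ^- 2.
    by field; rewrite !gt_eqF.
  rewrite lnV ?posrE ?exprn_gt0 ?divr_gt0// lnXn ?divr_gt0// -mulr_natl.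
  by field.
- move=> s s0; derivE => //; rewrite /stieltjes; field.
  by rewrite tn xn' xtn.
- move=> s s0; apply: isd_continuous; rewrite /stieltjes; deriv => //.
- by apply: isd_continuous; deriv.
- rewrite -(mulr0 (t / (2 * (x ^+ 2 - t ^+ 2)))); apply: cvgMr; apply: cvg_ln1.
  rewrite -[X in _ --> X]addr0; apply: cvgD; first exact: cvg_cst.
  rewrite -[X in _ --> X](mulr0 (t ^+ 2 - x ^+ 2)); apply: cvgMr; exact: cvgy_sqrDV.
- move=> s s0; by rewrite mulr_ge0// stieltjes_ge0.
Qed.
End Kernels.

(** * The regularized Cauchy kernel *)

Section Cauchy.
Context {R : realType}.
Local Notation mu := (@lebesgue_measure R).
Local Notation D := (@Rplus R).
Implicit Types (x y t u d : R).

(** With z = x + i d one has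
    t / (z^2 - t^2) = (1/(z - t) - 1/(z + t)) / 2,  and
    1/(u + i d) = conj_poisson d u - i poisson d u,
    so re_kernel d x t is the real part of t / (z^2 - t^2) and im_kernel d x t
    the opposite of its imaginary part. *)
Definition conj_poisson d u : R := u / (u ^+ 2 + d ^+ 2).
Definition poisson d u : R := d / (u ^+ 2 + d ^+ 2).
Definition re_kernel d x t : R := (conj_poisson d (x - t) - conj_poisson d (x + t)) / 2.
Definition im_kernel d x t : R := (poisson d (x - t) - poisson d (x + t)) / 2.

Lemma measurable2_re_kernel d : measurable2 (re_kernel d).
Proof. by rewrite /measurable2 /re_kernel /conj_poisson; meas. Qed.

Lemma measurable2_im_kernel d : measurable2 (im_kernel d).
Proof. by rewrite /measurable2 /im_kernel /poisson; meas. Qed.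

(** The left-hand side is t^2 |z^2 - t^2|^-2, with |z + t|^2 >= t^2. *)
Lemma re_im_sqr_le d x t : 0 < d -> 0 < x -> 0 < t ->
  re_kernel d x t ^+ 2 + im_kernel d x t ^+ 2 <= poisson d (x - t) / d.
Proof.
move=> d0 x0 t0; rewrite /re_kernel /im_kernel /conj_poisson /poisson.
have P0 := sqrD_gt0 (x - t) d d0; have Q0 := sqrD_gt0 (x + t) d d0.
have Pn := lt0r_neq0 P0; have Qn := lt0r_neq0 Q0; have dn := lt0r_neq0 d0.
set P := (x - t) ^+ 2 + d ^+ 2; set Q := (x + t) ^+ 2 + d ^+ 2.
have -> : (((x - t) / P - (x + t) / Q) / 2) ^+ 2 + ((d / P - d / Q) / 2) ^+ 2 =
          t ^+ 2 / (P * Q).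
  by rewrite /P /Q; field; rewrite Pn Qn.
rewrite (_ : d / P / d = P^-1); last by field; rewrite dn Pn.
rewrite invfM mulrCA -[leRHS]mulr1 ler_wpM2l ?invr_ge0 ?ltW//.
by rewrite ltr_pdivrMr// mul1r /Q; nra.
Qed.

(** The Poisson kernel has mass pi on the whole line. *)
Lemma poisson_int d t : 0 < d -> 0 < t ->
  (\int[mu]_(x in D) (poisson d (x - t))%:E <= pi%:E)%E.
Proof.
move=> d0 t0; have dn := lt0r_neq0 d0.
have nz x := lt0r_neq0 (sqrD_gt0 x d d0).
rewrite (FTC_ge0_at0 (fun x => poisson d (x - t)) (fun x => atan ((x + - t) / d)) (pi / 2)).
- rewrite lee_fin add0r mulNr atanN opprK [leRHS](_ : pi = pi / 2 + pi / 2); last by field.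
  by rewrite lerD2l ltW// atan_ltpi2.
- move=> x _; derivE => //; rewrite /poisson; field.
  by rewrite nz dn.
- by move=> x _; rewrite /poisson; apply: isd_continuous; deriv; exact: nz.
- by apply: isd_continuous; deriv.
- exact: cvgy_atan_div.
- by move=> x _; rewrite /poisson divr_ge0 ?ltW// sqrD_gt0.
Qed.

Lemma poissonC d x t : poisson d (x - t) = poisson d (t - x).
Proof. by rewrite /poisson -opprB sqrrN. Qed.

Lemma intD_poisson_shift d t : 0 < d -> 0 < t -> intD (fun x => poisson d (x - t) / d).
Proof.
move=> d0 t0; apply: (eq_intD (fun x => d^-1 * poisson d (x - t))); first by move=> x _; rewrite mulrC.
apply: intDZ; apply: intDP; first by rewrite /poisson; meas.
apply: le_lt_trans (_ : (pi%:E < +oo)%E); last exact: ltry.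
rewrite (le_trans _ (poisson_int d t d0 t0))// le_eqVlt; apply/orP; left; apply/eqP.
by apply: eq_integral => x _; rewrite ger0_norm// /poisson divr_ge0 ?ltW// sqrD_gt0.
Qed.

Lemma L2_re_kernel2 d t : 0 < d -> 0 < t -> L2 (fun x => re_kernel d x t).
Proof.
move=> d0 t0; have mk := measurable2_2 _ (measurable2_re_kernel d) t; apply: L2P => //.
apply: (intD_dom _ _ _ _ (intD_poisson_shift d t d0 t0)); first exact: measurable_funX.
move=> x x0; rewrite ger0_norm ?sqr_ge0//.
by apply: le_trans (re_im_sqr_le _ _ _ d0 x0 t0); rewrite lerDl sqr_ge0.
Qed.

Lemma L2_re_kernel1 d x : 0 < d -> 0 < x -> L2 (re_kernel d x).
Proof.
move=> d0 x0; have mk := measurable2_1 _ (measurable2_re_kernel d) x; apply: L2P => //.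
apply: (intD_dom _ _ _ _ (intD_poisson_shift d x d0 x0)); first exact: measurable_funX.
move=> t t0; rewrite ger0_norm ?sqr_ge0// poissonC.
by apply: le_trans (re_im_sqr_le _ _ _ d0 x0 t0); rewrite lerDl sqr_ge0.
Qed.

Lemma L2_im_kernel2 d t : 0 < d -> 0 < t -> L2 (fun x => im_kernel d x t).
Proof.
move=> d0 t0; have mk := measurable2_2 _ (measurable2_im_kernel d) t; apply: L2P => //.
apply: (intD_dom _ _ _ _ (intD_poisson_shift d t d0 t0)); first exact: measurable_funX.
move=> x x0; rewrite ger0_norm ?sqr_ge0//.
by apply: le_trans (re_im_sqr_le _ _ _ d0 x0 t0); rewrite lerDr sqr_ge0.
Qed.

Lemma L2_im_kernel1 d x : 0 < d -> 0 < x -> L2 (im_kernel d x).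
Proof.
move=> d0 x0; have mk := measurable2_1 _ (measurable2_im_kernel d) x; apply: L2P => //.
apply: (intD_dom _ _ _ _ (intD_poisson_shift d x d0 x0)); first exact: measurable_funX.
move=> t t0; rewrite ger0_norm ?sqr_ge0// poissonC.
by apply: le_trans (re_im_sqr_le _ _ _ d0 x0 t0); rewrite lerDr sqr_ge0.
Qed.

Lemma im_kernel_ge0 d x t : 0 < d -> 0 < x -> 0 < t -> 0 <= im_kernel d x t.
Proof.
move=> d0 x0 t0; rewrite /im_kernel /poisson mulr_ge0// subr_ge0.
rewrite ler_pM2l// lef_pV2 ?posrE ?sqrD_gt0//; nra.
Qed.

Lemma im_kernel_le d x t : 0 < d -> 0 < x -> 0 < t -> im_kernel d x t <= poisson d (x - t).
Proof.
move=> d0 x0 t0; rewrite /im_kernel.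
have h : 0 <= poisson d (x + t) by rewrite /poisson divr_ge0 ?ltW// sqrD_gt0.
have h' : 0 <= poisson d (x - t) by rewrite /poisson divr_ge0 ?ltW// sqrD_gt0.
lra.
Qed.

(** The squared modulus of (z - v)/(z + v) for z = x + i d; its logarithm is a
    primitive of a multiple of the real kernel. *)
Definition square_ratio d v x : R := ((x - v) ^+ 2 + d ^+ 2) / ((x + v) ^+ 2 + d ^+ 2).

Lemma isd_ln_square_ratio d v x : 0 < d ->
  isd x (fun x => ln (square_ratio d v x)) (4 * re_kernel d x v).
Proof.
move=> d0; have nz y := lt0r_neq0 (sqrD_gt0 y d d0).
rewrite /square_ratio; eapply isd_eq; first by deriv => //; rewrite divr_gt0// sqrD_gt0.
by cbv beta; rewrite /re_kernel /conj_poisson; field; rewrite !nz.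
Qed.

Lemma cvgy_ln_square_ratio d v : 0 < d -> 0 < v -> ln (square_ratio d v x) @[x --> +oo%R] --> (0 : R).
Proof.
move=> d0 v0; apply: cvg_ln1.
have nz y := lt0r_neq0 (sqrD_gt0 y d d0).
have -> : square_ratio d v = (fun x => 1 - 4 * v * (x / ((x + v) ^+ 2 + d ^+ 2))).
  by apply/funext => x; rewrite /square_ratio; field; exact: nz.
rewrite -[X in _ --> X]subr0; apply: cvgB; first exact: cvg_cst.
rewrite -(mulr0 (4 * v)); apply: cvgMr.
apply: (@squeeze_cvgr _ _ _ _ (fun=> 0) (fun x => x / (x ^+ 2 + d ^+ 2))).
- near=> x; have x0 : 0 < x by near: x; exact: nbhs_pinfty_gt.
  apply/andP; split; first by rewrite divr_ge0 ?ltW ?sqrD_gt0.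
  rewrite ler_pM2l// lef_pV2 ?posrE ?sqrD_gt0//.
  by rewrite lerD2r; nra.
- exact: cvg_cst.
- exact/cvgy_xV/exprn_gt0.
Unshelve. all: by end_near. Qed.

(** The difference of the two integrands is the real part of
    t u / ((z^2 - t^2) (z^2 - u^2)) with z = x + i d, because
    Re (a b) = Re a Re b - Im a Im b.  By partial fractions this
    has a primitive built from the logarithms of [square_ratio], which vanish at
    x = 0 and at infinity. *)
Lemma re_im_gram d t u : 0 < d -> 0 < t -> 0 < u -> t != u ->
  \int[mu]_(x in D) (re_kernel d x t * re_kernel d x u) =
  \int[mu]_(x in D) (im_kernel d x t * im_kernel d x u).
Proof.
move=> d0 t0 u0 tu.
have is_ := L2_mul _ _ (L2_re_kernel2 _ _ d0 t0) (L2_re_kernel2 _ _ d0 u0).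
have ir := L2_mul _ _ (L2_im_kernel2 _ _ d0 t0) (L2_im_kernel2 _ _ d0 u0).
apply/eqP; rewrite -subr_eq0 -RintegralB//; apply/eqP.
have nz y := lt0r_neq0 (sqrD_gt0 y d d0).
have tun : t ^+ 2 - u ^+ 2 != 0.
  by rewrite subr_sqr mulf_neq0// ?subr_eq0// gt_eqF// addr_gt0.
pose c := t * u / (t ^+ 2 - u ^+ 2).
rewrite (FTC_integrable (fun x => re_kernel d x t * re_kernel d x u - im_kernel d x t * im_kernel d x u)
  (fun x => c * (ln (square_ratio d t x) / (4 * t) - ln (square_ratio d u x) / (4 * u))) _ _ 0 0);
  first by rewrite subr0.
- move=> x x0; apply: isd_is_derive; eapply isd_eq.
    eapply isdM; [exact: isd_cst|eapply isdB; (eapply isdM; [exact: isd_ln_square_ratio|exact: isd_cst])].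
  cbv beta; rewrite !mulr0 !add0r addr0 /re_kernel /im_kernel /conj_poisson /poisson /c; field.
  by rewrite !nz tun (gt_eqF t0) (gt_eqF u0).
- move=> x x0; apply: isd_continuous; rewrite /re_kernel /im_kernel /conj_poisson /poisson; deriv => //.
- have e0 : c * (ln (square_ratio d t 0) / (4 * t) - ln (square_ratio d u 0) / (4 * u)) = 0.
    have w1 v : square_ratio d v 0 = 1 by rewrite /square_ratio !add0r sqrrN divff.
    by rewrite !w1 ln1 !mul0r subr0 mulr0.
  rewrite -[X in _ --> X]e0; apply: cvg_at_right_filter.
  apply: (@isd_continuous _ (fun x => c * (ln (square_ratio d t x) / (4 * t) - ln (square_ratio d u x) / (4 * u)))).
  eapply isdM; [exact: isd_cst|eapply isdB; (eapply isdM; [exact: isd_ln_square_ratio|exact: isd_cst])].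
- rewrite -(mulr0 c); apply: cvgMr; rewrite -[X in _ --> X](subr0 0).
  apply: cvgB.
    by rewrite -[X in _ --> X](mul0r (4 * t)^-1); apply: cvgMl; exact: cvgy_ln_square_ratio.
  by rewrite -[X in _ --> X](mul0r (4 * u)^-1); apply: cvgMl; exact: cvgy_ln_square_ratio.
- exact: intDB.
Qed.

(** Partial fractions for 1/(x + i y) times 1/(x - t + i d), in real form; the
    two denominators come from the combinations of i y with i d and - i d. *)
Lemma poisson_conj_fraction y d x t : 0 < y -> 0 < d -> t != 0 ->
  2 * (poisson y x * conj_poisson d (x - t)) =
  (- t * (poisson y x - poisson d (x - t)) - (y - d) * (conj_poisson y x - conj_poisson d (x - t)))
    / (t ^+ 2 + (y - d) ^+ 2) +
  (- t * (poisson y x + poisson d (x - t)) - (y + d) * (conj_poisson y x - conj_poisson d (x - t)))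
    / (t ^+ 2 + (y + d) ^+ 2).
Proof.
move=> y0 d0 t0.
have h1 v := lt0r_neq0 (sqrD_gt0 v d d0); have h2 v := lt0r_neq0 (sqrD_gt0 v y y0).
have h3 v : t ^+ 2 + v ^+ 2 != 0 by rewrite paddr_eq0 ?sqr_ge0// sqrf_eq0 (negbTE t0).
by rewrite /poisson /conj_poisson; field; rewrite h1 h2 !h3.
Qed.

(** Convolving a Poisson kernel with a conjugate Poisson kernel adds their
    parameters, and re_kernel is even in x, so that the half-line carries half of
    the convolution.  The proof writes down the primitive given by
    [poisson_conj_fraction] at t and at - t. *)
Lemma poisson_re_kernel_int y d t : 0 < y -> 0 < d -> 0 < t ->
  \int[mu]_(x in D) (poisson y x * re_kernel d x t) = - (pi / 2) * (t / (t ^+ 2 + (y + d) ^+ 2)).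
Proof.
move=> y0 d0 t0.
have h1 v := lt0r_neq0 (sqrD_gt0 v d d0); have h2 v := lt0r_neq0 (sqrD_gt0 v y y0).
have h3 v : t ^+ 2 + v ^+ 2 != 0 by rewrite addrC; apply/lt0r_neq0/sqrD_gt0.
have tn := lt0r_neq0 t0; have yn := lt0r_neq0 y0; have dn := lt0r_neq0 d0.
(* F 0 = 0, and at infinity only the arctangents of the second fraction remain *)
pose F x := ((- t * (2 * atan (x / y) - atan ((x - t) / d) - atan ((x + t) / d))
    + (y - d) * (ln (square_ratio d t x) / 2)) / (t ^+ 2 + (y - d) ^+ 2)
  + (- t * (2 * atan (x / y) + atan ((x - t) / d) + atan ((x + t) / d))
    + (y + d) * (ln (square_ratio d t x) / 2)) / (t ^+ 2 + (y + d) ^+ 2)) / 4.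
have datan1 x v : isd x (fun x => atan ((x + v) / d)) (poisson d (x + v)).
  eapply isd_eq; first by deriv.
  by cbv beta; rewrite /poisson; field; rewrite h1.
have datan0 x : isd x (fun x => atan (x / y)) (poisson y x).
  eapply isd_eq; first by deriv.
  by cbv beta; rewrite /poisson; field; rewrite h2.
have dF x : isd x F (poisson y x * re_kernel d x t).
  eapply isd_eq.
    rewrite /F; eapply isdM; last exact: isd_cst.
    eapply isdD; (eapply isdM; [eapply isdD; (eapply isdM; [exact: isd_cst|])|exact: isd_cst]).
    - eapply isdB; [eapply isdB|]; [eapply isdM; [exact: isd_cst|exact: datan0]|exact: datan1|exact: datan1].
    - eapply isdM; [exact: isd_ln_square_ratio|exact: isd_cst].
    - eapply isdD; [eapply isdD|]; [eapply isdM; [exact: isd_cst|exact: datan0]|exact: datan1|exact: datan1].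
    - eapply isdM; [exact: isd_ln_square_ratio|exact: isd_cst].
  cbv beta; rewrite !mulr0 !add0r !addr0.
  have := poisson_conj_fraction y d x t y0 d0 tn.
  have := poisson_conj_fraction y d x (- t) y0 d0 (_ : - t != 0).
  rewrite oppr_eq0 => /(_ tn); rewrite opprK sqrrN => e1 e2.
  rewrite /re_kernel (_ : poisson y x * _ =
    (2 * (poisson y x * conj_poisson d (x - t)) - 2 * (poisson y x * conj_poisson d (x + t))) / 4); last by field.
  rewrite e1 e2; field; by rewrite !h3.
rewrite (FTC_integrable (fun x => poisson y x * re_kernel d x t) F _ _ 0 (- (pi / 2) * (t / (t ^+ 2 + (y + d) ^+ 2)))).
- by rewrite subr0.
- by move=> x _; apply: isd_is_derive.
- by move=> x _; apply: isd_continuous; rewrite /poisson /re_kernel /conj_poisson; deriv.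
- have e0 : F 0 = 0.
    have w1 : square_ratio d t 0 = 1 by rewrite /square_ratio !add0r sqrrN divff.
    rewrite /F (_ : (0 - t) / d = - ((0 + t) / d)); last by field.
    by rewrite w1 ln1 !mul0r atan0 atanN; field; rewrite !h3.
  by rewrite -[X in _ --> X]e0; apply: cvg_at_right_filter; apply: isd_continuous; exact: dF.
- have -> : - (pi / 2) * (t / (t ^+ 2 + (y + d) ^+ 2)) =
    ((- t * (2 * (pi / 2) - pi / 2 - pi / 2) + (y - d) * (0 / 2)) / (t ^+ 2 + (y - d) ^+ 2)
   + (- t * (2 * (pi / 2) + pi / 2 + pi / 2) + (y + d) * (0 / 2)) / (t ^+ 2 + (y + d) ^+ 2)) / 4.
    by field; rewrite !h3.
  have l1 := cvgy_atan_div0 y y0; have l2 := cvgy_atan_div t d d0.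
  have l3 := cvgy_atan_div (- t) d d0; have l4 := cvgy_ln_square_ratio d t d0 t0.
  apply: cvgMl; apply: cvgD; apply: cvgMl; apply: cvgD; apply: cvgMr.
  + by apply: cvgB => //; apply: cvgB => //; apply: cvgMr.
  + exact: cvgMl.
  + by apply: cvgD => //; apply: cvgD => //; apply: cvgMr.
  + exact: cvgMl.
- apply: L2_mul; last exact: L2_re_kernel2.
  exact: (carleman_dom_L2 _ (carleman_domC _ carleman_dom_stieltjes) y y0).
Qed.
End Cauchy.

(** * Almost everywhere limits and Gram kernels *)

Section Bound.
Context {R : realType}.
Local Notation mu := (@lebesgue_measure R).
Local Notation D := (@Rplus R).

Lemma ae_imp (P Q : R -> Prop) : (forall x, P x -> Q x) ->
  {ae mu, forall x, P x} -> {ae mu, forall x, Q x}.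
Proof. by move=> PQ; apply: filterS => //; exact: (ae_filter_ringOfSetsType mu). Qed.

Lemma ae_and (P Q : R -> Prop) : {ae mu, forall x, P x} -> {ae mu, forall x, Q x} ->
  {ae mu, forall x, P x /\ Q x}.
Proof. by move=> hP hQ; apply: filterI => //; exact: (ae_filter_ringOfSetsType mu). Qed.

Lemma limn_einf_le (u : nat -> \bar R) (C : \bar R) :
  (forall n, (u n <= C)%E) -> (limn_einf u <= C)%E.
Proof.
move=> uC; rewrite limn_einf_lim; apply: lime_le; first exact: is_cvg_einfs.
apply: nearW => n; apply: le_trans (uC n); apply: ereal_inf_lbound.
by exists n => /=.
Qed.

(** Fatou's lemma for squares, with the limit known only almost everywhere. *)
Lemma fatou_sqr (u : nat -> R -> R) (v : R -> R) (C : \bar R) :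
  (forall n, measurable_fun setT (u n)) -> measurable_fun setT v ->
  {ae mu, forall x, D x -> u n x @[n --> \oo] --> v x} ->
  (forall n, \int[mu]_(x in D) (u n x ^+ 2)%:E <= C)%E ->
  (\int[mu]_(x in D) (v x ^+ 2)%:E <= C)%E.
Proof.
move=> mu_ mv uv uC; apply: le_trans (limn_einf_le _ _ uC).
have m2 (w : R -> R) : measurable_fun setT w -> measurable_fun D (fun x : R => (w x ^+ 2)%:E).
  by move=> mw; apply/measurable_EFinP/measurable_funTS; exact: measurable_funX.
apply: le_trans (fatou _ _ _ _) => //; last first.
- by move=> n x _; rewrite lee_fin sqr_ge0.
- by move=> n; exact: m2.
apply: ae_ge0_le_integral => //.
- by move=> x _; rewrite lee_fin sqr_ge0.
- exact: m2.
- move=> x _; rewrite limn_einf_lim; apply: lime_ge; first exact: is_cvg_einfs.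
  apply: nearW => n; apply: le_ereal_inf_tmp => _ [m _ <-].
  by rewrite lee_fin sqr_ge0.
- apply: (@emeasurable_fun_cvg _ _ _ _ (fun n x => einfs (fun m => (u m x ^+ 2)%:E) n)).
    by move=> n; apply: measurable_fun_einfs => // m; exact: m2.
  by move=> x _; rewrite limn_einf_lim; exact: is_cvg_einfs.
- move: uv; apply: ae_imp => x uv Dx.
  have h : (u n x ^+ 2)%:E @[n --> \oo] --> (v x ^+ 2)%:E.
    apply: cvg_EFin; first by near=> n.
    by rewrite !expr2; apply: cvgM; exact: uv.
  by rewrite is_cvg_limn_einfE ?(cvg_lim _ h)//; apply/cvg_ex; exists (v x ^+ 2)%:E.
Unshelve. all: by end_near. Qed.

(** A point is negligible, so kernels may be compared off the diagonal. *)
Lemma eq_Rint_ne (F G : R -> R) (t : R) :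
  measurable_fun setT F -> measurable_fun setT G ->
  (forall u : R, 0 < u -> u != t -> F u = G u) ->
  \int[mu]_(u in D) F u = \int[mu]_(u in D) G u.
Proof.
move=> mF mG FG; rewrite /Rintegral; congr fine; apply: ae_eq_integral => //.
- by apply/measurable_EFinP; exact: measurable_funTS.
- by apply/measurable_EFinP; exact: measurable_funTS.
exists [set t]; split; [exact: measurable_set1|exact: lebesgue_measure_set1|].
move=> u /= h; apply: contrapT => /eqP ut; apply: h; rewrite RplusE => u0.
by rewrite FG.
Qed.

(** Operators whose kernel has square integrable rows and uniformly square
    integrable columns map L1 and L2 functions to L2, and their norm is computed
    by the Gram kernel, by absolute convergence. *)
Section gram.
Variables (k : R -> R -> R) (M : R).
Hypothesis mk : measurable2 k.
Hypothesis k1 : forall x : R, 0 < x -> L2 (k x).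
Hypothesis k2 : forall t : R, 0 < t -> L2 (fun x => k x t).
Hypothesis kM : forall t : R, 0 < t -> \int[mu]_(x in D) (k x t ^+ 2) <= M.
Variable f : R -> R.
Hypothesis f1 : intD f.
Hypothesis f2 : L2 f.

Let mf : measurable_fun setT f. Proof. by case: f2. Qed.
Let mk1 := measurable2_1 _ mk.
Let mk2 := measurable2_2 _ mk.

Let ak (x t : R) : R := `|k x t|.
Let mak : measurable2 ak. Proof. by rewrite /measurable2 /ak; have := mk; rewrite /measurable2 => ?; meas. Qed.

Let int_kf : forall x : R, 0 < x -> intD (fun t => k x t * f t).
Proof. by move=> x x0; apply: L2_mul => //; exact: k1. Qed.

Let int_akf : forall x : R, 0 < x -> intD (fun t => ak x t * `|f t|).
Proof. by move=> x x0; apply: L2_mul; [exact/L2_norm/k1|exact: L2_norm]. Qed.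

(** Cauchy-Schwarz with the finite weight |f|, then Tonelli and the column
    bound. *)
Lemma gram_abs_L2 : L2 (kernel_op ak (fun t => `|f t|)).
Proof.
split; first by apply: measurable_op => //; meas.
(* the extra 1 makes A positive even when f vanishes *)
pose A := \int[mu]_(t in D) `|f t| + 1.
have A0 : 0 < A by rewrite ltr_wpDl// Rintegral_ge0.
have M0 : 0 <= M by apply: le_trans (kM 1 ltr01); apply: Rintegral_ge0 => x _; exact: sqr_ge0.
have mS : measurable_fun setT (fun z : R * R => (`|f z.2| * ak z.1 z.2 ^+ 2)%:E).
  by apply/measurable_EFinP; have := mak; rewrite /measurable2 => ?; meas.
apply: (@le_lt_trans _ _ (A%:E * \int[mu]_(x in D) \int[mu]_(t in D) (`|f t| * ak x t ^+ 2)%:E)%E).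
  rewrite -ge0_integralZl//; last 3 first.
  - apply: measurable_funTS; apply: (measurable_int_ge0 (fun x t => (`|f t| * ak x t ^+ 2)%:E)) => //.
    by move=> x t; rewrite lee_fin mulr_ge0 ?sqr_ge0.
  - by move=> x _; apply: integral_ge0 => t _; rewrite lee_fin mulr_ge0 ?sqr_ge0.
  - by rewrite lee_fin ltW.
  apply: ge0_le_integral => //.
  - by move=> x _; rewrite lee_fin sqr_ge0.
  - by apply/measurable_EFinP/measurable_funTS/measurable_funX; apply: measurable_op => //; meas.
  - apply: measurable_funTS; apply: emeasurable_funM => //.
    apply: (measurable_int_ge0 (fun x t => (`|f t| * ak x t ^+ 2)%:E)) => //.
    by move=> x t; rewrite lee_fin mulr_ge0 ?sqr_ge0.
  move=> x; rewrite RplusE => x0.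
  have := @cauchy_schwarz R (fun t => `|f t|) (fun=> 1) (ak x) A.
  rewrite (_ : (\int[mu]_(t in D) (`|f t| * 1 * ak x t))%R = kernel_op ak (fun t => `|f t|) x); last first.
    by apply: eq_RintD => t _; rewrite mulr1 mulrC.
  apply => //; [by meas|exact: (measurable2_1 _ mak)|].
  under eq_integral do rewrite expr1n mulr1.
  by rewrite (intD_fin _ (intD_norm _ f1)) lee_fin /A lerDl.
rewrite lte_mul_pinfty//; [by rewrite lee_fin ltW|].
rewrite (tonelli (fun x t => (`|f t| * ak x t ^+ 2)%:E))//; last first.
  by move=> x t _ _; rewrite lee_fin mulr_ge0 ?sqr_ge0.
apply: (@le_lt_trans _ _ (M%:E * \int[mu]_(t in D) `|f t|%:E)%E); last first.
  by rewrite lte_mul_pinfty// ?lee_fin//; exact: intD_norm_lty.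
rewrite -ge0_integralZl//; last first.
  by apply/measurable_EFinP/measurable_funTS; meas.
apply: ge0_le_integral => //.
- by move=> t _; apply: integral_ge0 => x _; rewrite lee_fin mulr_ge0 ?sqr_ge0.
- apply: measurable_funTS.
  apply: (measurable_int_ge0 (fun t x => (`|f t| * ak x t ^+ 2)%:E)) => [|x t].
    by apply/measurable_EFinP; have := measurable2C _ mak; rewrite /measurable2 => ?; meas.
  by rewrite lee_fin mulr_ge0 ?sqr_ge0.
- by apply: measurable_funTS; apply/measurable_EFinP; meas.
move=> t; rewrite RplusE => t0.
have i2 := L2_sqr _ (k2 t t0).
rewrite (intD_fin (fun x => `|f t| * ak x t ^+ 2)).
  rewrite -EFinM lee_fin RintD_Z.
    rewrite mulrC ler_wpM2r//; apply: le_trans (kM _ t0).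
    by rewrite (eq_RintD _ (fun x => k x t ^+ 2))// => x _; rewrite /ak real_normK ?num_real.
  by apply: (eq_intD _ _ _ i2) => x _; rewrite /ak real_normK ?num_real.
apply: intDZ.
by apply: (eq_intD _ _ _ i2) => x _; rewrite /ak real_normK ?num_real.
Qed.

Lemma gram_L2 : L2 (kernel_op k f).
Proof.
apply: (L2_dom _ _ _ gram_abs_L2); first exact: measurable_op.
move=> x x0; rewrite (le_trans _ (ler_norm _))//.
apply: (le_trans (le_normr_Rintegral _ (int_kf x x0))) => //.
by rewrite (eq_RintD _ (fun t => ak x t * `|f t|))// => t _; rewrite normrM.
Qed.

Lemma gram_pairing p : L2 p ->
  \int[mu]_(x in D) (p x * kernel_op k f x) =
  \int[mu]_(t in D) (f t * \int[mu]_(x in D) (p x * k x t)).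
Proof.
move=> p2; apply: pairing => //; first by case: p2.
- have := intD_norm_lty _ (L2_mul _ _ p2 gram_abs_L2).
  apply: le_lt_trans; rewrite le_eqVlt; apply/orP; left; apply/eqP.
  apply: eq_integral => x; rewrite inE RplusE => x0.
  rewrite intD_fin; last first.
    apply: intD_norm; apply: (eq_intD (fun t => p x * (k x t * f t))).
      by move=> t _; rewrite mulrA.
    exact/intDZ/int_kf.
  rewrite normrM (ger0_norm (x := kernel_op _ _ _)); last first.
    by apply: Rintegral_ge0 => t _; rewrite /ak mulr_ge0.
  rewrite /kernel_op -RintD_Z; last exact: int_akf.
  by congr EFin; apply: eq_RintD => t t0; rewrite !normrM mulrA.
- by move=> t t0; apply: L2_mul => //; exact: k2.
Qed.

Lemma gram_norm :
  \int[mu]_(x in D) (kernel_op k f x ^+ 2) =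
  \int[mu]_(t in D) (f t *
    \int[mu]_(u in D) (f u * \int[mu]_(x in D) (k x t * k x u))).
Proof.
rewrite (eq_RintD _ (fun x => kernel_op k f x * kernel_op k f x)) => [|x _]; last by rewrite expr2.
rewrite gram_pairing; last exact: gram_L2.
apply: eq_RintD => t t0; congr (_ * _).
rewrite -gram_pairing; last exact: k2.
by apply: eq_RintD => x _; rewrite mulrC.
Qed.
End gram.
End Bound.

(** * The uniform bound on the regularized Cauchy operator *)

Section ReKernelBound.
Context {R : realType}.
Local Notation mu := (@lebesgue_measure R).
Local Notation D := (@Rplus R).
Implicit Types (x t d : R).

Lemma column_norm_le d t (k : R -> R -> R) : 0 < d -> 0 < t ->
  (forall x, 0 < x -> k x t ^+ 2 <= poisson d (x - t) / d) -> L2 (fun x => k x t) ->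
  \int[mu]_(x in D) (k x t ^+ 2) <= pi / d.
Proof.
move=> d0 t0 hk k2.
apply: (@le_trans _ _ (\int[mu]_(x in D) (poisson d (x - t) / d))).
  by apply: le_RintD => //; [exact: L2_sqr|exact: intD_poisson_shift].
have i := intD_poisson_shift d t d0 t0.
rewrite (eq_RintD _ (fun x => d^-1 * (d * (poisson d (x - t) / d)))); last first.
  by move=> x _; rewrite mulKf// gt_eqF.
rewrite RintD_Z; last exact: intDZ.
rewrite mulrC ler_pM2r ?invr_gt0//.
have e : (\int[mu]_(x in D) (d * (poisson d (x - t) / d)))%R = (\int[mu]_(x in D) poisson d (x - t))%R.
  by apply: eq_RintD => x _; rewrite mulrCA divff ?mulr1// gt_eqF.
rewrite e -lee_fin -intD_fin; first exact: poisson_int.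
by apply: (eq_intD _ _ _ (intDZ d _ i)) => x _; rewrite mulrCA divff ?mulr1// gt_eqF.
Qed.

Lemma L2_eint_eq (f g : R -> R) : L2 f -> L2 g ->
  \int[mu]_(x in D) (f x ^+ 2) = \int[mu]_(x in D) (g x ^+ 2) ->
  (\int[mu]_(x in D) (f x ^+ 2)%:E = \int[mu]_(x in D) (g x ^+ 2)%:E)%E.
Proof. by move=> f2 g2 e; rewrite !intD_fin ?e//; exact: L2_sqr. Qed.

(** By [re_im_gram] the Gram kernels of the real and imaginary parts agree off
    the diagonal, so the two operators have the same norm on L1 and L2; the
    imaginary part is positive with rows and columns of mass at most pi, and the
    Schur test applies to it with constant weight. *)
Lemma re_kernel_bound_L1 d f : 0 < d -> intD f -> L2 f ->
  (\int[mu]_(x in D) (kernel_op (re_kernel d) f x ^+ 2)%:E <=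
   (pi ^+ 2)%:E * \int[mu]_(t in D) (f t ^+ 2)%:E)%E.
Proof.
move=> d0 f1 f2.
have mf : measurable_fun setT f by case: f2.
have colS t : 0 < t -> \int[mu]_(x in D) (re_kernel d x t ^+ 2) <= pi / d.
  move=> t0; apply: column_norm_le => //; last exact: L2_re_kernel2.
  by move=> x x0; apply: le_trans (re_im_sqr_le _ _ _ d0 x0 t0); rewrite lerDl sqr_ge0.
have colR t : 0 < t -> \int[mu]_(x in D) (im_kernel d x t ^+ 2) <= pi / d.
  move=> t0; apply: column_norm_le => //; last exact: L2_im_kernel2.
  by move=> x x0; apply: le_trans (re_im_sqr_le _ _ _ d0 x0 t0); rewrite lerDr sqr_ge0.
have sS1 x : 0 < x -> L2 (re_kernel d x) by exact: L2_re_kernel1.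
have sS2 t : 0 < t -> L2 (fun x => re_kernel d x t) by exact: L2_re_kernel2.
have sR1 x : 0 < x -> L2 (im_kernel d x) by exact: L2_im_kernel1.
have sR2 t : 0 < t -> L2 (fun x => im_kernel d x t) by exact: L2_im_kernel2.
have mG (k : R -> R -> R) t : measurable2 k ->
    measurable_fun setT (fun u => \int[mu]_(x in D) (k x t * k x u)).
  move=> mk; apply: (measurable_Rint (fun u x => k x t * k x u)).
  apply: measurable_funM; last exact: measurable2C _ mk.
  exact: (measurableT_comp (measurable2_2 _ mk t) measurable_snd).
have -> : (\int[mu]_(x in D) (kernel_op (re_kernel d) f x ^+ 2)%:E =
    \int[mu]_(x in D) (kernel_op (im_kernel d) f x ^+ 2)%:E)%E.
  have LS := gram_L2 _ _ (measurable2_re_kernel d) sS1 sS2 colS _ f1 f2.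
  have LR := gram_L2 _ _ (measurable2_im_kernel d) sR1 sR2 colR _ f1 f2.
  apply: L2_eint_eq; [exact: LS|exact: LR|].
  rewrite (gram_norm _ _ (measurable2_re_kernel d) sS1 sS2 colS _ f1 f2).
  rewrite (gram_norm _ _ (measurable2_im_kernel d) sR1 sR2 colR _ f1 f2).
  apply: eq_RintD => t t0; apply: (congr1 (fun z => f t * z)).
  apply: (eq_Rint_ne _ _ t).
  - apply: measurable_funM => //; exact: mG (measurable2_re_kernel d).
  - apply: measurable_funM => //; exact: mG (measurable2_im_kernel d).
  - by move=> u u0 ut; rewrite re_im_gram// eq_sym.
apply: (schur (im_kernel d) (fun=> 1)) => //; first exact: measurable2_im_kernel.
- exact: pi_gt0.
- by move=> x t x0 t0; exact: im_kernel_ge0.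
- move=> x x0; rewrite mulr1.
  apply: (le_trans _ (poisson_int d x d0 x0)); apply: ge0_le_integral => //.
  + by move=> t; rewrite RplusE => t0; rewrite mulr1 lee_fin im_kernel_ge0.
  + apply/measurable_EFinP/measurable_funTS; have ? := measurable2_1 _ (measurable2_im_kernel d) x; by meas.
  + by apply/measurable_EFinP/measurable_funTS; rewrite /poisson; meas.
  + by move=> t; rewrite RplusE => t0; rewrite mulr1 lee_fin -poissonC im_kernel_le.
- move=> t t0; rewrite mulr1.
  apply: (le_trans _ (poisson_int d t d0 t0)); apply: ge0_le_integral => //.
  + by move=> x; rewrite RplusE => x0; rewrite mulr1 lee_fin im_kernel_ge0.
  + apply/measurable_EFinP/measurable_funTS; have ? := measurable2_2 _ (measurable2_im_kernel d) t; by meas.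
  + by apply/measurable_EFinP/measurable_funTS; rewrite /poisson; meas.
  + by move=> x; rewrite RplusE => x0; rewrite mulr1 lee_fin im_kernel_le.
Qed.

Lemma dominated_Rint (F : nat -> R -> R) (G H : R -> R) :
  (forall n, measurable_fun setT (F n)) -> measurable_fun setT G ->
  {ae mu, forall x, D x -> F n x @[n --> \oo] --> G x} -> intD H ->
  (forall n x, 0 < x -> `|F n x| <= H x) ->
  \int[mu]_(x in D) F n x @[n --> \oo] --> \int[mu]_(x in D) G x.
Proof.
move=> mF mG FG iH FH.
have [] // := @dominated_convergence _ _ _ mu D measurable_Rplus
  (fun n x => (F n x)%:E) (fun x => (G x)%:E) (fun x => (H x)%:E).
- by move=> n; apply/measurable_EFinP; apply: measurable_funTS; apply: mF.
- by apply/measurable_EFinP; apply: measurable_funTS.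
- move: FG; apply: ae_imp => x h Dx; apply: cvg_EFin; first exact: nearW.
  exact: h.
- by apply: aeW => x n; rewrite RplusE lee_fin; exact: FH.
move=> iG _ h.
have {}h : (\int[mu]_(x in D) F n x)%:E @[n --> \oo] --> (\int[mu]_(x in D) G x)%:E.
  rewrite -(intD_fin G iG); move: h; apply: cvg_trans; apply: near_eq_cvg.
  apply: nearW => n /=; rewrite intD_fin//.
  by apply: (intD_dom _ _ _ _ iH) => // x; exact: FH.
by move/fine_cvgP : h => [].
Qed.

(** Cutting f at n gives functions in L1, and Fatou's lemma removes the cut. *)
Lemma re_kernel_bound d f : 0 < d -> L2 f ->
  (\int[mu]_(x in D) (kernel_op (re_kernel d) f x ^+ 2)%:E <=
   (pi ^+ 2)%:E * \int[mu]_(t in D) (f t ^+ 2)%:E)%E.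
Proof.
move=> d0 f2; have mf : measurable_fun setT f by case: f2.
pose chi (n : nat) t : R := \1_`]-oo, n%:R] t.
have mchi n : measurable_fun setT (chi n) by exact: measurable_indic.
pose fn n t := f t * chi n t.
have mfn n : measurable_fun setT (fn n) by rewrite /fn; have ? := mchi n; meas.
have chi01 n t : chi n t ^+ 2 = chi n t.
  by rewrite /chi indicE; case: (_ \in _); rewrite ?expr1n ?expr0n.
have fn_le n t : `|fn n t| <= `|f t|.
  rewrite /fn /chi indicE; case: (_ \in _); first by rewrite mulr1.
  by rewrite mulr0 normr0.
have fn2 n : L2 (fn n) by apply: (L2_dom _ f).
have fn1 n : intD (fn n).
  apply: L2_mul => //; apply: L2P => //.
  apply: (eq_intD (chi n)) => [t _|]; first by rewrite chi01.
  apply: intDP => //; under eq_integral do rewrite ger0_norm ?indicE//.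
  have -> : (\int[mu]_(t in D) (chi n t)%:E = mu (`]-oo, n%:R] `&` D))%E.
    by apply: integral_indic => //; exact: measurable_itv.
  apply: (@le_lt_trans _ _ (mu `]0, n%:R]%classic)).
    apply: le_measure; rewrite ?inE; [| |].
    - by apply: measurableI => //; exact: measurable_itv.
    - exact: measurable_itv.
    - by move=> t /= []; rewrite RplusE !in_itv/= => -> ->.
  by rewrite lebesgue_measure_itv; case: ifP => _; rewrite -?EFinB ltry.
apply: (fatou_sqr (fun n => kernel_op (re_kernel d) (fn n))).
- by move=> n; apply: measurable_op => //; exact: measurable2_re_kernel.
- by apply: measurable_op => //; exact: measurable2_re_kernel.
- apply: aeW => x; rewrite RplusE => x0.
  apply: (dominated_Rint _ _ (fun t => `|re_kernel d x t * f t|)).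
  + by move=> n; apply: measurable_funM => //; exact: (measurable2_1 _ (measurable2_re_kernel d)).
  + by apply: measurable_funM => //; exact: (measurable2_1 _ (measurable2_re_kernel d)).
  + apply: aeW => t Dt; apply: cvg_near_cst; near=> n.
    rewrite /fn /chi indicE mem_set ?mulr1//= in_itv/=.
    by rewrite (le_trans (ltW (truncnS_gt _)))// ler_nat; near: n; exact: nbhs_infty_ge.
  + by apply: intD_norm; apply: L2_mul => //; exact: L2_re_kernel1.
  + by move=> n t t0; rewrite normrM [leRHS]normrM ler_wpM2l.
- move=> n; apply: le_trans (re_kernel_bound_L1 _ _ d0 (fn1 n) (fn2 n)) _.
  apply: lee_wpmul2l; first by rewrite lee_fin sqr_ge0.
  apply: ge0_le_integral => //.
  + by move=> t _; rewrite lee_fin sqr_ge0.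
  + by apply/measurable_EFinP/measurable_funTS; apply: measurable_funX; exact: mfn.
  + by apply/measurable_EFinP/measurable_funTS; apply: measurable_funX.
  + move=> t _; rewrite lee_fin -(real_normK (num_real (fn n t))) -(real_normK (num_real (f t))).
    by rewrite ler_pXn2r ?nnegrE.
Unshelve. all: by end_near. Qed.
End ReKernelBound.

(** * Weak limits, and the regularization parameter tending to zero *)

Section Weak.
Context {R : realType}.
Local Notation mu := (@lebesgue_measure R).
Local Notation D := (@Rplus R).
Implicit Types (x y t d : R).

(** Bounded sequences in L2 that converge almost everywhere converge weakly.
    With w = u_n - v and eta > 0, one has
    |p w| <= eta w^2 + min(|w|, |p|/eta) |p|:
    the first term is small in mean by boundedness, the second tends to 0 by
    domination by p^2 / eta. *)
Lemma weak_cvg (u : nat -> R -> R) (v p : R -> R) (C : R) :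
  (forall n, measurable_fun setT (u n)) -> measurable_fun setT v ->
  (forall n, (\int[mu]_(x in D) (u n x ^+ 2)%:E <= C%:E)%E) ->
  {ae mu, forall x, D x -> u n x @[n --> \oo] --> v x} ->
  L2 p ->
  L2 v /\ \int[mu]_(x in D) (p x * u n x) @[n --> \oo] --> \int[mu]_(x in D) (p x * v x).
Proof.
move=> mU mv uC uv p2.
have u2 n : L2 (u n) by split=> //; apply: le_lt_trans (uC n) _; exact: ltry.
have v2 : L2 v.
  by split=> //; apply: le_lt_trans (fatou_sqr _ _ _ mU mv uv uC) _; exact: ltry.
split=> //.
have mp : measurable_fun setT p by case: p2.
have Cle w : L2 w -> (\int[mu]_(x in D) (w x ^+ 2)%:E <= C%:E)%E ->
    \int[mu]_(x in D) (w x ^+ 2) <= C.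
  by move=> w2; rewrite intD_fin// L2_sqr.
have uC' n := Cle _ (u2 n) (uC n).
have vC := Cle _ v2 (fatou_sqr _ _ _ mU mv uv uC).
have C0 : 0 <= C by apply: le_trans vC; apply: Rintegral_ge0 => x _; exact: sqr_ge0.
pose w n x := u n x - v x.
have w2 n : L2 (w n).
  apply: L2P; first by apply: measurable_funB.
  apply: (eq_intD (fun x => (u n x ^+ 2 + v x ^+ 2) + (- 2) * (u n x * v x))).
    by move=> x _; rewrite /w; ring.
  by apply: intDD; [apply: intDD; exact: L2_sqr|exact/intDZ/L2_mul].
have mw n : measurable_fun setT (w n) by case: (w2 n).
have wC n : \int[mu]_(x in D) (w n x ^+ 2) <= 4 * C.
  apply: (@le_trans _ _ (\int[mu]_(x in D) (2 * (u n x ^+ 2 + v x ^+ 2)))).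
    apply: le_RintD => [||x _]; first exact: L2_sqr.
      by apply: intDZ; apply: intDD; exact: L2_sqr.
    by rewrite /w; have := sqr_ge0 (u n x + v x); nra.
  rewrite RintD_Z; last by apply: intDD; exact: L2_sqr.
  by rewrite RintegralD//; [have := uC' n; lra|exact: L2_sqr|exact: L2_sqr].
apply/cvgrPdist_lt => e e0.
(* 4 C bounds the squared norm of u_n - v *)
pose eta := e / (2 * (4 * C + 1)).
have eta0 : 0 < eta by rewrite divr_gt0// mulr_gt0// ltr_wpDl// mulr_ge0.
pose g n x := Num.min `|w n x| (`|p x| / eta) * `|p x|.
have mg n : measurable_fun setT (g n).
  apply: measurable_funM; last by meas.
  by apply: measurable_minr; [have ? := mw n; meas|meas].
have g_dom n x : `|g n x| <= eta^-1 * p x ^+ 2.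
  rewrite ger0_norm; last by rewrite mulr_ge0// le_min normr_ge0 divr_ge0// ltW.
  rewrite -(real_normK (num_real (p x))) expr2 mulrA [_^-1 * _]mulrC ler_wpM2r//.
  by rewrite ge_min lexx orbT.
have gi : intD (fun x => eta^-1 * p x ^+ 2) by apply/intDZ/L2_sqr.
have gin n : intD (g n) by apply: (intD_dom _ _ _ _ gi).
have g0 : \int[mu]_(x in D) g n x @[n --> \oo] --> \int[mu]_(x in D) (0 : R).
  apply: (dominated_Rint g (fun=> 0) (fun x => eta^-1 * p x ^+ 2)) => //.
  move: uv; apply: ae_imp => x h Dx; have {}h := h Dx.
  have w0 : `|w n x| @[n --> \oo] --> (0 : R).
    apply/norm_cvg0P; rewrite /w -(subrr (v x)); apply: cvgB => //; exact: cvg_cst.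
  apply: (@squeeze_cvgr _ _ _ _ (fun=> 0) (fun n => `|w n x| * `|p x|)).
  - apply: nearW => n; rewrite /g; apply/andP; split.
      by rewrite mulr_ge0// le_min normr_ge0 divr_ge0// ltW.
    by rewrite ler_wpM2r// ge_min lexx.
  - exact: cvg_cst.
  - by rewrite -(mul0r `|p x|); apply: cvgMl.
have {}g0 : \forall n \near \oo, \int[mu]_(x in D) g n x < e / 2.
  rewrite Rintegral_cst ?mul0r// in g0.
  move/cvgrPdist_lt : g0 => /(_ (e / 2)); rewrite divr_gt0// => /(_ isT).
  apply: filterS => n; rewrite sub0r normrN => h; apply: le_lt_trans h; exact: ler_norm.
near=> n.
have gn : \int[mu]_(x in D) g n x < e / 2 by near: n.
rewrite -RintegralB//; [|exact: L2_mul|exact: L2_mul].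
apply: le_lt_trans (le_normr_Rintegral _ _) _ => //.
  by apply: intDB; exact: L2_mul.
apply: (@le_lt_trans _ _ (\int[mu]_(x in D) (eta * w n x ^+ 2 + g n x))).
  apply: le_RintD => [||x _].
  - by apply: intD_norm; apply: intDB; exact: L2_mul.
  - by apply: intDD => //; exact/intDZ/L2_sqr.
  - rewrite -mulrBr normrM distrC -/(w n x) /g.
    rewrite -(real_normK (num_real (w n x))).
    set a := `|w n x|; set b := `|p x|; have a0 : 0 <= a by exact: normr_ge0.
    have b0 : 0 <= b by exact: normr_ge0.
    have [ab|ab] := leP a (b / eta).
      by rewrite mulrC lerDr mulr_ge0 ?sqr_ge0// ltW.
    rewrite ltr_pdivrMr// in ab.
    have h : 0 <= b / eta * b by rewrite mulr_ge0// divr_ge0// ltW.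
    by nra.
rewrite RintD_D; [|by apply: intDZ; exact: L2_sqr|exact: gin].
rewrite RintD_Z; last exact: L2_sqr.
rewrite [e]splitr; apply: ler_ltD => //.
apply: (@le_trans _ _ (eta * (4 * C + 1))).
  by rewrite ler_pM2l//; have := wC n; lra.
rewrite /eta le_eqVlt; apply/orP; left; apply/eqP; field.
by apply/lt0r_neq0; rewrite ltr_wpDl// mulr_ge0.
Unshelve. all: by end_near. Qed.

Lemma intD_poisson y : 0 < y -> intD (poisson y).
Proof.
move=> y0; apply: intDP; first by rewrite /poisson; meas.
have nz x := lt0r_neq0 (sqrD_gt0 x y y0); have yn := lt0r_neq0 y0.
rewrite (_ : integral _ _ _ = \int[mu]_(x in D) (poisson y x)%:E)%E; last first.
  by apply: eq_integral => x _; rewrite ger0_norm// /poisson divr_ge0 ?ltW// sqrD_gt0.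
rewrite (FTC_ge0_at0 (poisson y) (fun x => atan (x / y)) (pi / 2)) ?ltry//.
- by move=> x _; derivE => //; rewrite /poisson; field; rewrite nz.
- by move=> x _; rewrite /poisson; apply: isd_continuous; deriv.
- by apply: isd_continuous; deriv.
- exact: cvgy_atan_div0.
- by move=> x _; rewrite /poisson divr_ge0 ?ltW// sqrD_gt0.
Qed.

Lemma L2_poisson y : 0 < y -> L2 (poisson y).
Proof. by move=> y0; exact: (carleman_dom_L2 _ (carleman_domC _ carleman_dom_stieltjes) y y0). Qed.

(** Absolute convergence of the double integral uses d > 0: for a fixed d the
    rows of the kernel are bounded in L2 uniformly in x, and the Poisson kernel
    is integrable. *)
Lemma poisson_re_kernel_pairing f y d : L2 f -> 0 < y -> 0 < d ->
  \int[mu]_(x in D) (poisson y x * kernel_op (re_kernel d) f x) =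
  - (pi / 2) * \int[mu]_(t in D) (t / (t ^+ 2 + (y + d) ^+ 2) * f t).
Proof.
move=> f2 y0 d0; have mf : measurable_fun setT f by case: f2.
have msk := measurable2_re_kernel d.
have intsf x : 0 < x -> intD (fun t => re_kernel d x t * f t).
  by move=> x0; apply: L2_mul => //; exact: L2_re_kernel1.
have yd : 0 < y + d by rewrite addr_gt0.
rewrite pairing//.
- rewrite -RintD_Z; last first.
    apply: (eq_intD (fun t => stieltjes (y + d) t * f t)); first by move=> t _; rewrite /stieltjes addrC.
    exact: (carleman_dom_int _ _ carleman_dom_stieltjes).
  by apply: eq_RintD => t t0; rewrite poisson_re_kernel_int// mulrC mulrA.
- by rewrite /poisson; meas.
- pose B := pi / d + \int[mu]_(t in D) (f t ^+ 2).
  have hB x : 0 < x -> \int[mu]_(t in D) `|re_kernel d x t * f t| <= B.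
    move=> x0; have s2 := L2_re_kernel1 _ _ d0 x0.
    apply: (@le_trans _ _ (\int[mu]_(t in D) (re_kernel d x t ^+ 2 + f t ^+ 2))).
      apply: le_RintD => [||t _]; first exact/intD_norm/intsf.
        by apply: intDD; exact: L2_sqr.
      rewrite normrM -(real_normK (num_real (re_kernel d x t))) -(real_normK (num_real (f t))).
      by have := sqr_ge0 (`|re_kernel d x t| - `|f t|); have := sqr_ge0 (`|re_kernel d x t| + `|f t|); nra.
    rewrite RintegralD//; [|exact: L2_sqr|exact: L2_sqr].
    rewrite lerD2r; apply: (column_norm_le d x (fun t x => re_kernel d x t)) => //.
    by move=> t t0; rewrite poissonC; apply: le_trans (re_im_sqr_le _ _ _ d0 x0 t0); rewrite lerDl sqr_ge0.
  have B0 : 0 <= B by apply: le_trans (hB 1 ltr01); apply: Rintegral_ge0.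
  apply: (@le_lt_trans _ _ (\int[mu]_(x in D) (B * poisson y x)%:E)%E); last first.
    by rewrite intD_fin ?ltry//; exact/intDZ/intD_poisson.
  apply: ge0_le_integral => //.
  + by move=> x _; apply: integral_ge0 => t _; rewrite lee_fin.
  + apply: measurable_funTS; apply: (measurable_int_ge0 (fun x t => `|poisson y x * re_kernel d x t * f t|%:E)) => //.
    by apply/measurable_EFinP; rewrite /measurable2 in msk; rewrite /poisson; meas.
  + by apply/measurable_EFinP/measurable_funTS; rewrite /poisson; meas.
  + move=> x; rewrite RplusE => x0.
    have p0 : 0 <= poisson y x by rewrite /poisson divr_ge0 ?ltW// sqrD_gt0.
    rewrite (_ : integral _ _ _ = \int[mu]_(t in D) (poisson y x * `|re_kernel d x t * f t|)%:E)%E; last first.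
      by apply: eq_integral => t _; rewrite -mulrA normrM (ger0_norm p0).
    have i := intD_norm _ (intsf x x0).
    rewrite (intD_fin (fun t => poisson y x * `|re_kernel d x t * f t|)); last exact: intDZ.
    by rewrite RintD_Z// lee_fin mulrC ler_wpM2r// hB.
- by move=> t t0; apply: L2_mul; [exact: L2_poisson|exact: L2_re_kernel2].
Qed.

(** The identity N' H = - (pi/2) N, for the almost everywhere limit h of the
    regularized operators; in particular the existence of the limit forces it to
    be square integrable. *)
Lemma re_kernel_limit f (h : R -> R) : L2 f -> measurable_fun setT h ->
  {ae mu, forall x, D x -> kernel_op (re_kernel n.+1%:R^-1) f x @[n --> \oo] --> h x} ->
  L2 h /\ forall y, 0 < y ->
    \int[mu]_(x in D) (poisson y x * h x) = - (pi / 2) * kernel_op stieltjes f y.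
Proof.
move=> f2 mh fh; have mf : measurable_fun setT f by case: f2.
pose d n : R := n.+1%:R^-1.
have d0 n : 0 < d n by rewrite invr_gt0.
have bd n : (\int[mu]_(x in D) (kernel_op (re_kernel (d n)) f x ^+ 2)%:E <=
    (pi ^+ 2 * \int[mu]_(t in D) (f t ^+ 2))%:E)%E.
  by rewrite EFinM -intD_fin ?re_kernel_bound//; exact: L2_sqr.
have mo n : measurable_fun setT (kernel_op (re_kernel (d n)) f)
  by apply: measurable_op => //; exact: measurable2_re_kernel.
split.
  by have [] := weak_cvg _ _ f _ mo mh bd fh f2.
move=> y y0.
have [_ h1] := weak_cvg _ _ _ _ mo mh bd fh (L2_poisson y y0).
apply: cvg_unique h1 _ => //.
have -> : (fun n => \int[mu]_(x in D) (poisson y x * kernel_op (re_kernel (d n)) f x)) =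
  (fun n => - (pi / 2) * \int[mu]_(t in D) (t / (t ^+ 2 + (y + d n) ^+ 2) * f t)).
  by apply/funext => n; rewrite poisson_re_kernel_pairing.
apply: cvgMr.
have cd : d n @[n --> \oo] --> (0 : R).
  apply/cvgrPdist_lt => e e0; near=> n; rewrite sub0r normrN gtr0_norm//.
  by near: n; exact: near_infty_natSinv_lt (PosNum e0).
apply: (dominated_Rint (fun n t => t / (t ^+ 2 + (y + d n) ^+ 2) * f t) (fun t => stieltjes y t * f t)
  (fun t => `|stieltjes y t * f t|)).
- by move=> n; meas.
- by rewrite /stieltjes; meas.
- apply: aeW => t; rewrite RplusE => t0; apply: cvgMl.
  have -> : stieltjes y t = t / (t ^+ 2 + (y + 0) ^+ 2) by rewrite /stieltjes addr0 addrC.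
  apply: cvgMr; apply: cvgV; first by rewrite addrC; apply/lt0r_neq0/sqrD_gt0.
  apply: cvgD; first exact: cvg_cst.
  have hy : y + d n @[n --> \oo] --> y + 0 by apply: cvgD => //; exact: cvg_cst.
  by rewrite !expr2; apply: cvgM.
- apply: intD_norm; exact: (carleman_dom_int _ _ carleman_dom_stieltjes).
- move=> n t t0; rewrite normrM [leRHS]normrM ler_wpM2r//.
  have h1 : 0 < t ^+ 2 + (y + d n) ^+ 2 by rewrite addrC; exact: sqrD_gt0.
  rewrite ger0_norm; last by apply: divr_ge0; exact: ltW.
  rewrite ger0_norm ?stieltjes_ge0// /stieltjes ler_pM2l// lef_pV2 ?posrE//; last exact: sqrD_gt0.
  by rewrite addrC lerD2l; have := d0 n; nra.
Unshelve. all: by end_near. Qed.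
End Weak.

(** * The principal value as a limit of smooth averages *)

Section PV.
Context {R : realType}.
Local Notation mu := (@lebesgue_measure R).
Local Notation D := (@Rplus R).
Implicit Types (x t d e a : R).

(** The truncation in the definition of the principal value, as a factor, so
    that it can be averaged over its radius. *)
Definition far x e t : R := if e <= `|x - t| then 1 else 0.

Lemma far01 x e t : 0 <= far x e t <= 1.
Proof. by rewrite /far; case: ifP => _; rewrite ?lexx ler01. Qed.

Lemma measurable2_far x d : measurable2 (fun t a => far x (a * d) t).
Proof.
rewrite /measurable2 /far; apply: measurable_fun_ifT => //=.
by apply: measurable_fun_ler; meas.
Qed.

Lemma PV_domainE x e : PV_domain x e = D `&` [set t | e <= `|x - t|].
Proof. by apply/seteqP; split => t; rewrite /PV_domain/= RplusE. Qed.

Lemma measurable_far_set x e : measurable [set t : R | e <= `|x - t|].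
Proof.
have h : measurable_fun setT (fun t : R => e <= `|x - t|) by apply: measurable_fun_ler; meas.
have : measurable ([set: R] `&` (fun t : R => e <= `|x - t|) @^-1` [set true]) by exact: h.
by rewrite setTI.
Qed.

Lemma far_patch x e (g : R -> R) : (fun t => g t * far x e t) = g \_ [set t | e <= `|x - t|].
Proof.
apply/funext => t; rewrite /far patchE; case: ifPn => h.
  by rewrite mem_set// mulr1.
by rewrite memNset ?mulr0//; exact/negP.
Qed.

Lemma far_intD x e (g : R -> R) :
  mu.-integrable (PV_domain x e) (EFin \o g) -> intD (fun t => g t * far x e t).
Proof.
rewrite PV_domainE => h; rewrite /intD far_patch.
rewrite (_ : EFin \o _ = (EFin \o g) \_ [set t | e <= `|x - t|]); last first.
  by apply/funext => t; rewrite /= !patchE; case: ifP.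
apply/integrable_restrict => //; exact: measurable_far_set.
Qed.

Lemma far_Rint x e (g : R -> R) :
  \int[mu]_(t in PV_domain x e) g t = \int[mu]_(t in D) (g t * far x e t).
Proof. by rewrite PV_domainE Rintegral_mkcondr far_patch. Qed.

(** The probability density of the truncation radius, in units of d.  Its
    distribution function is a^2 / (1 + a^2), so that averaging the truncation
    over it produces the factor [rho]. *)
Definition avg_weight a : R := 2 * a / (1 + a ^+ 2) ^+ 2.

Lemma avg_weight_ge0 a : 0 <= a -> 0 <= avg_weight a.
Proof. by move=> a0; rewrite /avg_weight divr_ge0 ?sqr_ge0// mulr_ge0. Qed.

Lemma oneD_neq0 a : 1 + a ^+ 2 != 0.
Proof. by apply: lt0r_neq0; rewrite ltr_wpDr ?sqr_ge0. Qed.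

Lemma avg_weight_total : (\int[mu]_(a in D) (avg_weight a)%:E = 1%:E)%E.
Proof.
have nz := oneD_neq0.
rewrite (FTC_ge0_at0 avg_weight (fun a => - (1 + a ^+ 2)^-1) 0).
- by rewrite expr0n/= addr0 invr1 sub0r opprK.
- by move=> a _; derivE => //; rewrite /avg_weight; field; exact: nz.
- by move=> a _; rewrite /avg_weight; apply: isd_continuous; deriv => //; rewrite expf_neq0.
- by apply: isd_continuous; deriv.
- rewrite -[X in _ --> X]oppr0; apply: cvgN.
  under eq_fun do rewrite addrC.
  exact: cvgy_sqrDV.
- by move=> a /ltW; exact: avg_weight_ge0.
Qed.

Lemma measurable_avg_weight : measurable_fun setT avg_weight.
Proof. by rewrite /avg_weight; meas. Qed.

Lemma intD_avg_weight : intD avg_weight.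
Proof.
apply: intDP; first exact: measurable_avg_weight.
rewrite (_ : integral _ _ _ = \int[mu]_(a in D) (avg_weight a)%:E)%E; first by rewrite avg_weight_total ltry.
by apply: eq_integral => a; rewrite inE RplusE => /ltW a0; rewrite ger0_norm// avg_weight_ge0.
Qed.

(** The factor relating the regularized kernel to the singular one:
    u / (u^2 + d^2) = rho / u for u = x - t. *)
Definition rho x d t : R := (x - t) ^+ 2 / ((x - t) ^+ 2 + d ^+ 2).

Lemma avg_weight_far x d t : 0 < d -> t != x ->
  \int[mu]_(a in D) (avg_weight a * far x (a * d) t) = rho x d t.
Proof.
move=> d0 tx; have nz := oneD_neq0.
pose b := `|x - t| / d.
have b0 : 0 < b by rewrite divr_gt0// normr_gt0 subr_eq0 eq_sym.
rewrite (eq_RintD _ (avg_weight \_ `]-oo, b])) => [|a a0]; last first.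
  rewrite patchE /far -ler_pdivlMr// -/b; case: ifPn => ab.
    by rewrite mem_set ?mulr1//= in_itv.
  by rewrite memNset ?mulr0//= in_itv/=; exact/negP.
rewrite -Rintegral_mkcondr.
rewrite (_ : D `&` _ = `]0, b]%classic); last first.
  apply/seteqP; split => a /=; rewrite RplusE !in_itv/=; first by move=> [-> ->].
  by move=> /andP[-> ->].
rewrite Rintegral_itv_obnd_cbnd; last first.
  have sI : `]0, b]%classic `<=` D by move=> a /=; rewrite RplusE in_itv/= => /andP[].
  have := intD_avg_weight; rewrite /intD; apply: integrableS => //; exact: measurable_itv.
have cF a : isd a (fun a => - (1 + a ^+ 2)^-1) (avg_weight a).
  by eapply isd_eq; [by deriv|cbv beta; rewrite /avg_weight; field; exact: nz].
have := @continuous_FTC2 R avg_weight (fun a => - (1 + a ^+ 2)^-1) 0 b b0.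
rewrite /Rintegral => -> //.
- rewrite /= expr0n/= addr0 invr1 opprK /rho /b expr_div_n real_normK ?num_real//.
  have h : (x - t) ^+ 2 + d ^+ 2 != 0 by apply/lt0r_neq0/sqrD_gt0.
  have h' : d ^+ 2 + (x - t) ^+ 2 != 0 by rewrite addrC.
  by field; rewrite ?h ?h' ?(gt_eqF d0).
- apply: continuous_subspaceT => a; rewrite /avg_weight; apply: (isd_continuous (fun a => 2 * a / (1 + a ^+ 2) ^+ 2)).
  by deriv => //; rewrite expf_neq0.
- split; [by move=> a _; have [] := cF a| |].
  + by apply: cvg_at_right_filter; exact: (isd_continuous _ _ _ (cF 0)).
  + by apply: cvg_at_left_filter; exact: (isd_continuous _ _ _ (cF b)).
- by move=> a _; have [_ <-] := cF a; rewrite derive1E.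
Qed.

(** The left-hand side is the average of the truncated integrals
    at radius a d over the density [avg_weight], by Fubini.  These are bounded: by
    convergence for small radii, and by the integral of |g| away from x for the
    others.  Dominated convergence then gives the limit v. *)
Lemma PV_average (g : R -> R) x v : 0 < x ->
  measurable_fun setT g -> is_PV g x v ->
  (forall d, 0 < d -> intD (fun t => g t * rho x d t)) ->
  \int[mu]_(t in D) (g t * rho x n.+1%:R^-1 t) @[n --> \oo] --> v.
Proof.
move=> x0 mg [ig lg] irho.
pose H e := \int[mu]_(t in PV_domain x e) g t.
have HE e : H e = \int[mu]_(t in D) (g t * far x e t) by exact: far_Rint.
have HB : exists B, forall e, 0 < e -> `|H e| <= B.
  have /cvgrPdist_lt /(_ 1 ltr01) := lg.
  rewrite /at_right /within /= => -[r /= r0 hr].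
  have r20 : 0 < r / 2 by rewrite divr_gt0.
  pose B2 := \int[mu]_(t in D) (`|g t| * far x (r / 2) t).
  have iB2 : intD (fun t => `|g t| * far x (r / 2) t).
    have := intD_norm _ (far_intD _ _ _ (ig _ r20)); apply: eq_intD => t _.
    by rewrite normrM [X in _ * X]ger0_norm//; have /andP[] := far01 x (r / 2) t.
  exists (`|v| + 1 + B2) => e e0.
  have B20 : 0 <= B2.
    by apply: Rintegral_ge0 => t _; rewrite mulr_ge0//; have /andP[] := far01 x (r / 2) t.
  have [elt|ege] := ltP e (r / 2).
    have /(_ _ _) := hr e; rewrite /ball_/= sub0r normrN gtr0_norm// => /(_ _ e0) h.
    have {}h : `|v - H e| < 1 by apply: h; apply: lt_trans elt _; rewrite ltr_pdivrMr// ltr_pMr// ltr1n.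
    have : `|H e| <= `|v| + `|v - H e|.
      by rewrite -[X in `|X|](subKr v (H e)); apply: le_trans (ler_normB _ _) _.
    lra.
  have : `|H e| <= B2.
    rewrite HE; apply: le_trans (le_normr_Rintegral _ _) _ => //.
      exact: far_intD (ig _ e0).
    apply: le_RintD => // [|t _]; first exact/intD_norm/far_intD/ig.
    rewrite normrM ler_wpM2l// /far.
    case: ifP => h1; case: ifP => h2; rewrite ?normr1 ?normr0 ?ler01//.
    by rewrite (le_trans ege h1) in h2.
  by have := normr_ge0 v; lra.
have [B hB] := HB.
have mF d : measurable2 (fun t a => g t * (avg_weight a * far x (a * d) t)).
  have := measurable2_far x d; rewrite /measurable2 => ?; have ? := measurable_avg_weight.
  by meas.
have swap d : 0 < d -> \int[mu]_(t in D) (g t * rho x d t) =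
    \int[mu]_(a in D) (avg_weight a * H (a * d)).
  move=> d0.
  have iwf t : intD (fun a => avg_weight a * far x (a * d) t).
    apply: (intD_dom _ _ _ _ (intD_norm _ intD_avg_weight)).
      apply: measurable_funM; first exact: measurable_avg_weight.
      exact: (measurable2_1 _ (measurable2_far x d) t).
    move=> a a0; rewrite normrM ler_piMr//.
    by have /andP[h1 h2] := far01 x (a * d) t; rewrite ger0_norm.
  have inner (h : R -> R) : measurable_fun setT h ->
      \int[mu]_(t in D) (h t * rho x d t) =
      \int[mu]_(t in D) \int[mu]_(a in D) (h t * (avg_weight a * far x (a * d) t)).
    move=> mh; apply: (eq_Rint_ne _ _ x).
    - by apply: measurable_funM => //; rewrite /rho; meas.
    - apply: (measurable_Rint (fun t a => h t * (avg_weight a * far x (a * d) t))).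
      have := measurable2_far x d; rewrite /measurable2 => ?; have ? := measurable_avg_weight.
      by meas.
    - by move=> t t0 tx; rewrite RintD_Z// avg_weight_far.
  rewrite inner// fubini_Rint//.
    apply: eq_RintD => a a0; rewrite HE -RintD_Z; last first.
      by apply/far_intD/ig; exact: mulr_gt0.
    by apply: eq_RintD => t _; rewrite mulrCA.
  apply: le_lt_trans (intD_norm_lty _ (irho d d0)).
  rewrite le_eqVlt; apply/orP; left; apply/eqP.
  apply: ae_eq_integral => //.
  - apply: measurable_funTS; apply: (measurable_int_ge0 (fun t a => `|g t * (avg_weight a * far x (a * d) t)|%:E)) => //.
    apply/measurable_EFinP; apply: (measurableT_comp (@normr_measurable _ setT)).
    exact: mF.
  - apply/measurable_EFinP/measurable_funTS; apply: (measurableT_comp (@normr_measurable _ setT)).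
    by rewrite /rho; meas.
  - exists [set x]; split; [exact: measurable_set1|exact: lebesgue_measure_set1|].
    move=> t /= h; apply: contrapT => /eqP tx; apply: h; rewrite RplusE => t0.
    rewrite -(avg_weight_far _ _ _ d0 tx).
    have wf0 a : 0 < a -> 0 <= avg_weight a * far x (a * d) t.
      by move=> a0; apply: mulr_ge0; [exact/avg_weight_ge0/ltW|have /andP[] := far01 x (a * d) t].
    rewrite normrM (ger0_norm (x := Rintegral _ _ _)); last first.
      by apply: Rintegral_ge0 => a; rewrite RplusE; exact: wf0.
    rewrite -RintD_Z// -intD_fin; last exact: intDZ.
    apply: eq_integral => a; rewrite inE RplusE => a0; congr EFin.
    by rewrite normrM (ger0_norm (wf0 _ a0)).
have -> : (fun n => \int[mu]_(t in D) (g t * rho x n.+1%:R^-1 t)) =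
  (fun n => \int[mu]_(a in D) (avg_weight a * H (a * n.+1%:R^-1))).
  by apply/funext => n; rewrite swap// invr_gt0.
have -> : v = \int[mu]_(a in D) (avg_weight a * v).
  have := RintD_Z v avg_weight intD_avg_weight; under eq_Rintegral do rewrite mulrC.
  by move=> ->; rewrite /Rintegral avg_weight_total mulr1.
apply: (dominated_Rint (fun n a => avg_weight a * H (a * n.+1%:R^-1))
  (fun a => avg_weight a * v) (fun a => B * avg_weight a)).
- move=> n; apply: measurable_funM; first exact: measurable_avg_weight.
  under eq_fun do rewrite HE.
  apply: (measurable_Rint (fun a t => g t * far x (a * n.+1%:R^-1) t)).
  have := measurable2C _ (measurable2_far x n.+1%:R^-1); rewrite /measurable2 => ?; by meas.
- by have ? := measurable_avg_weight; meas.
- apply: aeW => a; rewrite RplusE => a0; apply: cvgMr.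
  apply: (cvg_comp (fun n : nat => a * n.+1%:R^-1) H _ lg).
  move=> P [r /= r0 hr]; near=> n; apply: hr => /=; last by rewrite mulr_gt0.
  rewrite sub0r normrN gtr0_norm ?mulr_gt0// mulrC -ltr_pdivlMr//.
  by near: n; exact: near_infty_natSinv_lt (PosNum (divr_gt0 r0 a0)).
- by apply: intDZ; exact: intD_avg_weight.
- move=> n a a0; have w0 := avg_weight_ge0 a (ltW a0).
  by rewrite normrM mulrC (ger0_norm w0) ler_wpM2r// hB// mulr_gt0.
Unshelve. all: by end_near. Qed.
End PV.

(** * Convergence of the regularized operators to the principal value *)

Section PVlimit.
Context {R : realType}.
Local Notation mu := (@lebesgue_measure R).
Local Notation D := (@Rplus R).
Implicit Types (x t d e a : R).

Lemma measurable_PV_kernel x : measurable_fun setT (PV_kernel x).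
Proof.
rewrite /PV_kernel; apply: measurable_funM; last by meas.
apply: measurable_funB; last by meas.
apply: measurable_funM; first by meas.
by apply: (measurableT_comp (@measurable_ln R)); meas.
Qed.

Lemma rho01 x d t : 0 < d -> 0 <= rho x d t <= 1.
Proof.
move=> d0; have h := sqrD_gt0 (x - t) d d0; rewrite /rho; apply/andP; split.
  by apply: divr_ge0; [exact: sqr_ge0|exact: ltW].
by rewrite ler_pdivrMr// mul1r lerDl sqr_ge0.
Qed.

(** The part of the regularized kernel that comes from the nonsingular fraction
    1/(x + t). *)
Definition re_kernel_err x d t : R := (conj_poisson d (x + t) - rho x d t * carleman x t) / 2.

(** In the factor of rho, the logarithms cancel and t/(x^2 - t^2) is left; its
    partial fractions are 1/(x - t), which rho regularizes, and 1/(x + t), which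
    the error term corrects.  At t = x the factor rho vanishes. *)
Lemma re_kernel_split x d t : 0 < d -> 0 < x -> 0 < t ->
  re_kernel d x t = (pi^-1 * (\int[mu]_(s in D) (stieltjes x s * stieltjes s t)) - PV_kernel x t) * rho x d t
    - re_kernel_err x d t.
Proof.
move=> d0 x0 t0; rewrite /re_kernel_err /re_kernel.
have [->|tx] := eqVneq t x.
  by rewrite /rho subrr expr0n/= mul0r /conj_poisson mul0r; ring.
have xt : x != t by rewrite eq_sym.
rewrite stieltjes_iter// /PV_kernel /rho /conj_poisson /carleman.
have h1 : (x + t) ^+ 2 + d ^+ 2 != 0 by exact/lt0r_neq0/sqrD_gt0.
have h5 : (x - t) ^+ 2 + d ^+ 2 != 0 by exact/lt0r_neq0/sqrD_gt0.
have h3 : x + t != 0 by exact/lt0r_neq0/addr_gt0.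
have h2 : x ^+ 2 - t ^+ 2 != 0.
  by rewrite subr_sqr; apply: mulf_neq0; [rewrite subr_eq0|].
have h4 : (pi : R) != 0 by exact/lt0r_neq0/pi_gt0.
move: (pi : R) h4 => p h4; set l := ln _.
by field; rewrite ?h1 ?h2 ?h3 ?h4 ?h5.
Qed.

Lemma re_kernel_err_le x d t : 0 < d -> 0 < x -> 0 < t -> `|re_kernel_err x d t| <= carleman x t.
Proof.
move=> d0 x0 t0; rewrite /re_kernel_err.
have /andP[r0 r1] := rho01 x d t d0; have c0 := carleman_gt0 _ _ x0 t0.
have xt0 : 0 < x + t by exact: addr_gt0.
have Q0 := sqrD_gt0 (x + t) d d0.
have q0 : 0 <= conj_poisson d (x + t) by rewrite /conj_poisson; apply: divr_ge0; exact: ltW.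
have q1 : conj_poisson d (x + t) <= carleman x t.
  rewrite /conj_poisson /carleman ler_pdivrMr// -(@ler_pM2l _ (x + t))//.
  rewrite mulrA divff ?mul1r; last exact: lt0r_neq0.
  by rewrite -expr2 lerDl sqr_ge0.
have rc0 : 0 <= rho x d t * carleman x t by apply: mulr_ge0 => //; exact: ltW.
have rc1 : rho x d t * carleman x t <= carleman x t by rewrite ler_piMl// ltW.
by rewrite ler_norml; apply/andP; split; lra.
Qed.

Lemma measurable_rho x d : measurable_fun setT (rho x d).
Proof. by rewrite /rho; meas. Qed.

Lemma measurable_re_kernel_err x d : measurable_fun setT (re_kernel_err x d).
Proof. by rewrite /re_kernel_err /conj_poisson /rho /carleman; meas. Qed.

(** The three terms of the splitting are treated separately: the logarithmic
    part and the error by dominated convergence, the singular part by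
    [PV_average].  Integrability of the singular part is obtained by difference
    from that of the others. *)
Lemma PV_re_kernel_cvg_aux (f g lf : R -> R) x v : L2 f -> 0 < x ->
  measurable_fun setT f -> measurable_fun setT g -> measurable_fun setT lf ->
  intD lf -> is_PV g x v ->
  (forall d t, 0 < d -> 0 < t ->
    re_kernel d x t * f t = pi^-1 * (lf t * rho x d t) - g t * rho x d t - re_kernel_err x d t * f t) ->
  kernel_op (re_kernel n.+1%:R^-1) f x @[n --> \oo] --> pi^-1 * (\int[mu]_(t in D) lf t) - v.
Proof.
move=> f2 x0 mf mg mlf ilf hPV split_.
have mer d : measurable_fun setT (fun t => re_kernel_err x d t * f t).
  by apply: measurable_funM => //; exact: measurable_re_kernel_err.
have mrho := measurable_rho x.
have isk d : 0 < d -> intD (fun t => re_kernel d x t * f t).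
  by move=> d0; apply: L2_mul => //; exact: L2_re_kernel1.
have icar : intD (fun t => carleman x t * `|f t|).
  by apply: L2_mul; [exact: L2_carleman|exact: L2_norm].
have erf_le d t : 0 < d -> 0 < t -> `|re_kernel_err x d t * f t| <= carleman x t * `|f t|.
  by move=> d0 t0; rewrite normrM ler_wpM2r// re_kernel_err_le.
have ier d : 0 < d -> intD (fun t => re_kernel_err x d t * f t).
  by move=> d0; apply: (intD_dom _ _ _ _ icar) => // t; exact: erf_le.
have ilr d : 0 < d -> intD (fun t => lf t * rho x d t).
  move=> d0; apply: (intD_dom _ _ _ _ (intD_norm _ ilf)); first exact: measurable_funM.
  move=> t _; have /andP[r0 r1] := rho01 x d t d0.
  by rewrite normrM (ger0_norm r0) ler_piMr.
have igr d : 0 < d -> intD (fun t => g t * rho x d t).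
  move=> d0.
  apply: (eq_intD (fun t => pi^-1 * (lf t * rho x d t) - re_kernel d x t * f t - re_kernel_err x d t * f t)).
    by move=> t t0; rewrite split_//; ring.
  by apply: intDB; [apply: intDB; [exact/intDZ/ilr|exact: isk]|exact: ier].
pose dn (n : nat) : R := n.+1%:R^-1.
have dn0 n : 0 < dn n by rewrite invr_gt0.
have cd : dn n @[n --> \oo] --> (0 : R).
  apply/cvgrPdist_lt => e e0; near=> n; rewrite sub0r normrN gtr0_norm//.
  by near: n; exact: near_infty_natSinv_lt (PosNum e0).
have cd2 : dn n ^+ 2 @[n --> \oo] --> (0 : R).
  by rewrite -(mulr0 0); under eq_fun do rewrite expr2; exact: cvgM.
have crho t : t != x -> rho x (dn n) t @[n --> \oo] --> (1 : R).
  move=> tx; have xt : (x - t) ^+ 2 != 0 by rewrite expf_neq0// subr_eq0 eq_sym.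
  rewrite -(divff xt) /rho; apply: cvgMr; apply: cvgV => //.
  by rewrite -[X in _ --> X]addr0; apply: cvgD => //; exact: cvg_cst.
have -> : (fun n => kernel_op (re_kernel (dn n)) f x) = (fun n =>
    pi^-1 * \int[mu]_(t in D) (lf t * rho x (dn n) t) -
    \int[mu]_(t in D) (g t * rho x (dn n) t) - \int[mu]_(t in D) (re_kernel_err x (dn n) t * f t)).
  apply/funext => n; rewrite /kernel_op.
  rewrite (eq_RintD _ _ (fun t => split_ (dn n) t (dn0 n))).
  have i1 := intDZ pi^-1 _ (ilr _ (dn0 n)).
  have i2 := intDB _ _ i1 (igr _ (dn0 n)).
  rewrite (RintegralB _ i2 (ier _ (dn0 n)))// (RintegralB _ i1 (igr _ (dn0 n)))//.
  by rewrite RintD_Z//; exact: ilr.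
rewrite -[X in _ --> X]subr0; apply: cvgB; first apply: cvgB.
- apply: cvgMr.
  apply: (dominated_Rint (fun n t => lf t * rho x (dn n) t) lf (fun t => `|lf t|)) => //.
  + by move=> n; exact: measurable_funM (mrho _).
  + exists [set x]; split; [exact: measurable_set1|exact: lebesgue_measure_set1|].
    move=> t /= h; apply: contrapT => /eqP tx; apply: h => _.
    by rewrite -[X in _ --> X]mulr1; apply: cvgMr; exact: crho.
  + exact: intD_norm.
  + move=> n t _; have /andP[r0 r1] := rho01 x (dn n) t (dn0 n).
    by rewrite normrM (ger0_norm r0) ler_piMr.
- exact: PV_average.
- have -> : (0 : R) = \int[mu]_(t in D) (0 : R) by rewrite Rintegral_cst ?mul0r.
  apply: (dominated_Rint (fun n t => re_kernel_err x (dn n) t * f t) (fun=> 0) (fun t => carleman x t * `|f t|)) => //.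
  + exists [set x]; split; [exact: measurable_set1|exact: lebesgue_measure_set1|].
    move=> t /= h; apply: contrapT => /eqP tx; apply: h; rewrite RplusE => t0.
    rewrite -(mul0r (f t)) /re_kernel_err; apply: cvgMl.
    rewrite -(mul0r 2^-1); apply: cvgMl.
    rewrite -(subrr (carleman x t)); apply: cvgB.
      have xt0 : x + t != 0 by rewrite gt_eqF// addr_gt0.
      have -> : carleman x t = (x + t) / (x + t) ^+ 2 by rewrite /carleman; field.
      rewrite /conj_poisson; apply: cvgMr; apply: cvgV; first by rewrite expf_neq0.
      by rewrite -[X in _ --> X]addr0; apply: cvgD => //; exact: cvg_cst.
    by rewrite -[X in _ --> X]mul1r; apply: cvgMl; exact: crho.
  + by move=> n t t0; exact: erf_le.
Unshelve. all: by end_near. Qed.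

Lemma PV_re_kernel_cvg f x v : L2 f -> 0 < x -> is_PV (fun t => PV_kernel x t * f t) x v ->
  kernel_op (re_kernel n.+1%:R^-1) f x @[n --> \oo] -->
  pi^-1 * kernel_op stieltjes (kernel_op stieltjes f) x - v.
Proof.
move=> f2 x0 hPV; have mf : measurable_fun setT f by case: f2.
have mN : measurable2 (@stieltjes R) by case: (@carleman_dom_stieltjes R).
have Nx2 : L2 (stieltjes x) := carleman_dom_L2 _ carleman_dom_stieltjes _ x0.
have -> : kernel_op stieltjes (kernel_op stieltjes f) x =
    \int[mu]_(t in D) (f t * \int[mu]_(s in D) (stieltjes x s * stieltjes s t)).
  exact: (carleman_dom_pairing _ _ _ carleman_dom_stieltjes Nx2 f2).
apply: (PV_re_kernel_cvg_aux _ (fun t => PV_kernel x t * f t)) => //.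
- by apply: measurable_funM => //; exact: measurable_PV_kernel.
- apply: measurable_funM => //.
  apply: (measurable_Rint (fun t s => stieltjes x s * stieltjes s t)).
  apply: measurable_funM; last exact: measurable2C _ mN.
  exact: (measurableT_comp (measurable2_1 _ mN x) measurable_snd).
- exact: carleman_dom_pairing_int _ _ _ carleman_dom_stieltjes Nx2 f2.
- by move=> d t d0 t0; rewrite re_kernel_split//; ring.
Qed.
End PVlimit.

(** * The change of variables x -> 1/x *)

Section InversionMeasure.
Context {R : realType}.
Local Notation mu := (@lebesgue_measure R).
Local Notation D := (@Rplus R).

(** Extending the inversion by the identity makes it an involution of the whole
    line, so that Lebesgue measure on R can be compared with its weighted image. *)
Definition invp (x : R) : R := if 0 < x then x^-1 else x.
Definition invw (x : R) : R := if 0 < x then (x^-1) ^+ 2 else 1.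

Lemma measurable_invp : measurable_fun setT invp.
Proof.
rewrite /invp; apply: measurable_fun_ifT => //=; last by meas.
by apply: measurable_fun_ltr; meas.
Qed.

Lemma measurable_invw : measurable_fun setT invw.
Proof.
rewrite /invw; apply: measurable_fun_ifT => //=; [|by meas..].
by apply: measurable_fun_ltr; meas.
Qed.

Lemma invw_ge0 x : 0 <= invw x.
Proof. by rewrite /invw; case: ifP => _; rewrite ?sqr_ge0. Qed.

(** The image under [invp] of Lebesgue measure with density [invw]. *)
Definition inv_measure (A : set (measurableTypeR R)) : \bar R :=
  (\int[mu]_(x in invp @^-1` A) (invw x)%:E)%E.

Let inv_measure0 : inv_measure set0 = 0%E.
Proof. by rewrite /inv_measure preimage_set0 integral_set0. Qed.

Let inv_measure_ge0 A : (0 <= inv_measure A)%E.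
Proof. by apply: integral_ge0 => x _; rewrite lee_fin invw_ge0. Qed.

Let inv_measure_sigma : semi_sigma_additive inv_measure.
Proof.
move=> F mF tF mUF.
have h := @semi_sigma_additive_nng_induced _ (measurableTypeR R) R mu (fun x => (invw x)%:E).
rewrite /inv_measure preimage_bigcup.
apply: (h _ _ (fun n => invp @^-1` F n)) => //.
- by apply/measurable_EFinP; exact: measurable_invw.
- by move=> x; rewrite lee_fin invw_ge0.
- by move=> n; rewrite -[X in measurable X]setTI; apply: measurable_invp => //; exact: mF.
- apply/trivIsetP => i j _ _ ij; rewrite -preimage_setI.
  by move/trivIsetP : tF => ->//; rewrite preimage_set0.
- by rewrite -preimage_bigcup -[X in measurable X]setTI; apply: measurable_invp.
Qed.

HB.instance Definition _ := isMeasure.Build _ _ _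
  inv_measure inv_measure0 inv_measure_ge0 inv_measure_sigma.

(** The mass that the image measure gives to the part of (-oo, b] lying in D. *)
Let T (b : R) : \bar R := (\int[mu]_(x in D) (if x^-1 <= b then (x^-1) ^+ 2 else 0)%:E)%E.

Let TE b : T b = (Num.max b 0)%:E.
Proof.
rewrite /T; have [b0|b0] := ltP 0 b; last first.
  apply: integral0_eq => x; rewrite RplusE => x0.
  by rewrite leNgt (le_lt_trans b0) ?invr_gt0.
pose J : set R := `[b^-1, +oo[%classic.
transitivity (\int[mu]_(x in D) ((fun x : R => ((x^-1) ^+ 2)%:E) \_ J) x)%E.
  apply: eq_integral => x; rewrite inE RplusE => x0; rewrite patchE.
  have -> : (x^-1 <= b) = (b^-1 <= x) by rewrite -{1}(invrK b) lef_pV2 ?posrE ?invr_gt0.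
  case: ifPn => h; first by rewrite mem_set//= /J/= in_itv/= h.
  by rewrite memNset// /J/= in_itv/= andbT; exact/negP.
rewrite -integral_mkcondr (_ : D `&` _ = J); last first.
  apply/setIidr => x; rewrite /J/=; rewrite in_itv/= andbT RplusE; apply: lt_le_trans.
  by rewrite invr_gt0.
have pos (x : R) : b^-1 <= x -> x != 0.
  by move=> h; apply/lt0r_neq0/(lt_le_trans _ h); rewrite invr_gt0.
rewrite (@ge0_continuous_FTC2y R (fun x => (x^-1) ^+ 2) (fun x => - x^-1) b^-1 0).
- by rewrite invrK -EFinB sub0r opprK.
- by move=> x _; exact: sqr_ge0.
- apply: continuous_in_subspaceT => x; rewrite inE/= in_itv/= andbT => h.
  by apply: (isd_continuous (fun x => (x^-1) ^+ 2)); deriv; exact: pos.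
- rewrite -[X in _ --> X]oppr0; apply: cvgN; apply: cvgy_inv; exact: cvg_id.
- move=> x /ltW h; suff [] : is_derive x 1 (fun x : R => - x^-1) ((x^-1) ^+ 2) by [].
  by derivE; [exact: pos|have := pos x h => ?; field].
- apply: cvg_at_right_filter; apply: (isd_continuous (fun x => - x^-1)); deriv; exact: pos.
- move=> x; rewrite in_itv/= andbT => /ltW h.
  have [_ <-] : is_derive x 1 (fun x : R => - x^-1) ((x^-1) ^+ 2).
    by derivE; [exact: pos|have := pos x h => ?; field].
  by rewrite derive1E.
Qed.

(** Lebesgue measure is determined by its values on half-open intervals, and
    the part of ]a, b] in D is a difference of two values of [T]. *)
Lemma inv_measureE (A : set R) : measurable A -> lebesgue_measure A = inv_measure A.
Proof.
apply: lebesgue_measure_unique => X [[a b]] /= _ <-.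
rewrite /inv_measure.
pose I : set R := `]a, b]%classic.
have mI : measurable I by exact: measurable_itv.
have mP : measurable (invp @^-1` I).
  by rewrite -[X in measurable X]setTI; exact: measurable_invp.
have mw : measurable_fun (invp @^-1` I) (fun x => (invw x)%:E).
  by apply/measurable_EFinP/measurable_funTS; exact: measurable_invw.
have -> : invp @^-1` I = (invp @^-1` I `&` D) `|` (invp @^-1` I `&` ~` D).
  by rewrite -setIUr setUv setIT.
rewrite ge0_integral_setU//; last 5 first.
- exact: measurableI.
- by apply: measurableI => //; exact: measurableC.
- by rewrite -setIUr setUv setIT.
- by move=> x _; rewrite lee_fin invw_ge0.
- by apply/disj_setPS => x [[_ ?] []].
pose K : set R := `]a, Num.min b 0]%classic.
have -> : (\int[mu]_(x in invp @^-1` I `&` ~` D) (invw x)%:E = mu K)%E.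
  transitivity (\int[mu]_(x in K) (1%:E))%E; last first.
    by rewrite integral_cst ?mul1e//; exact: measurable_itv.
  have -> : invp @^-1` I `&` ~` D = K.
    apply/seteqP; split => x /=; rewrite RplusE /invp /I /K/= !in_itv/= le_min.
      move=> [+ /negP]; rewrite -leNgt => + x0.
      have -> : (0 < x) = false by rewrite ltNge x0.
      by move=> /andP[-> ->].
    move=> /and3P[ax xb x0]; have -> : (0 < x) = false by rewrite ltNge x0.
    by rewrite ax xb.
  apply: eq_integral => x; rewrite inE /K/= in_itv/= le_min => /and3P[_ _ x0].
  rewrite /invw; have -> : (0 < x) = false by rewrite ltNge x0.
  by [].
have eT c : T c = (\int[mu]_(x in D) (if x^-1 <= c then (x^-1) ^+ 2 else 0)%:E)%E by [].
have mT c : measurable_fun setT (fun x : R => if x^-1 <= c then (x^-1) ^+ 2 else 0).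
  by apply: measurable_fun_ifT => //=; [apply: measurable_fun_ler|]; meas.
have T0 c x : 0 <= (if x^-1 <= c then (x^-1) ^+ 2 else 0 : R).
  by case: ifP => _ //; exact: sqr_ge0.
have -> : (\int[mu]_(x in invp @^-1` I `&` D) (invw x)%:E)%E =
    if a <= b then (Num.max b 0 - Num.max a 0)%:E else 0%E.
  rewrite setIC integral_mkcondr; case: ifPn => [ab|]; last first.
    rewrite -ltNge => ba; apply: integral0_eq => x _; rewrite patchE memNset//.
    by rewrite /I/= in_itv/= => /andP[h1 h2]; have := lt_le_trans h1 h2; rewrite ltNge ltW.
  have h : (T b = T a + \int[mu]_(x in D) ((fun x => (invw x)%:E) \_ (invp @^-1` I)) x)%E.
    rewrite !eT -ge0_integralD//.
    - apply: eq_integral => x; rewrite inE RplusE => x0.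
      rewrite patchE /invw x0.
      have -> : (x \in invp @^-1` I) = (a < x^-1 <= b).
        by apply/idP/idP; [rewrite inE|move=> ?; rewrite inE]; rewrite /I/= in_itv/= /invp x0.
      rewrite ltNge; case: (leP x^-1 a) => h1 /=.
        by rewrite (le_trans h1 ab) -EFinD addr0.
      by case: ifP; rewrite -EFinD add0r.
    - by move=> x _; rewrite lee_fin.
    - by apply/measurable_EFinP; apply: measurable_funTS; exact: mT.
    - by move=> x _; rewrite patchE; case: ifP => _; rewrite ?lee_fin ?invw_ge0.
    - by apply: measurable_funTS; apply/(measurable_restrict _ mP) => //; rewrite setTI.
  move: h; rewrite !TE; case: (integral _ _ _) => [r| |]//= [] e.
  by congr EFin; rewrite e addrAC subrr add0r.
rewrite !lebesgue_measure_itv/= !lte_fin.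
have [ab|ba] := ltP a b; last first.
  case: ifPn => h1; last first.
    by case: ifP; rewrite ?adde0//; rewrite lt_min => /andP[h2]; have := lt_le_trans h2 ba; rewrite ltxx.
  have -> : a = b by apply/eqP; rewrite eq_le h1 ba.
  by rewrite subrr add0e; case: ifP => //; rewrite lt_min ltxx.
rewrite (ltW ab) -EFinB.
case: (ltP a (Num.min b 0)) => [|]; rewrite ?lt_min ?ge_min.
  move=> /andP[_ a0]; rewrite -EFinB -EFinD; congr EFin.
  rewrite (max_r (ltW a0)) subr0.
  by case: (leP b 0) => b0; lra.
rewrite leNgt ab/= => a0; rewrite adde0; congr EFin.
by rewrite (max_l a0) max_l// (le_trans a0)// ltW.
Qed.

End InversionMeasure.

Section Inversion.
Context {R : realType}.
Local Notation mu := (@lebesgue_measure R).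
Local Notation D := (@Rplus R).

Lemma invw_gt0 (x : R) : 0 < invw x.
Proof. by rewrite /invw; case: ifP => // x0; rewrite exprn_gt0// invr_gt0. Qed.

(** The density is positive, so preimages of null sets under [invp] are null. *)
Lemma inv_ae (P : R -> Prop) :
  {ae mu, forall x, D x -> P x} -> {ae mu, forall x, D x -> P x^-1}.
Proof.
move=> [Z [mZ Z0 PZ]].
have mP : measurable (@invp R @^-1` Z).
  by rewrite -[X in measurable X]setTI; apply: measurable_invp.
have i0 : (\int[mu]_(x in @invp R @^-1` Z) `|(invw x)%:E|%E = 0)%E.
  rewrite (_ : integral _ _ _ = inv_measure Z); first by rewrite -inv_measureE.
  by apply: eq_integral => x _; rewrite gee0_abs// lee_fin invw_ge0.
have [Z' [mZ' Z'0 h]] : ae_eq mu (@invp R @^-1` Z) (fun x => (invw x)%:E) (cst 0%E).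
  apply/ae_eq_integral_abs => //.
  by apply/measurable_EFinP/measurable_funTS; exact: measurable_invw.
exists Z'; split => // x /= hx; apply: h => /= h; apply: hx; rewrite RplusE => x0.
apply: contrapT => nP.
have Zx : Z (invp x).
  by apply: PZ => /= hP; apply: nP; rewrite /invp x0 in hP; apply: hP; rewrite RplusE invr_gt0.
by have := h Zx => -[] /eqP; rewrite gt_eqF// invw_gt0.
Qed.

(** The layer-cake representation g = int_0^oo 1_{s < g} ds reduces the change
    of variables for functions to that for sets. *)
Let cake (g s : R) : R := if (0 < s) && (s < g) then 1 else 0.

Let cake_int (g : R) : 0 <= g -> (\int[mu]_s (cake g s)%:E = g%:E)%E.
Proof.
move=> g0.
pose J : set R := `]0, g[%classic.
transitivity (\int[mu]_s (\1_J s)%:E)%E.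
  apply: eq_integral => s _; rewrite /cake indicE; case: ifPn => h.
    by rewrite mem_set// /J/= in_itv.
  by rewrite memNset// /J/= in_itv/=; exact/negP.
rewrite integral_indic//; last exact: measurable_itv.
rewrite setIT; change (lebesgue_measure J = g%:E).
rewrite /J lebesgue_measure_itv/= lte_fin; case: ltP => h; first by rewrite -EFinB subr0.
by congr EFin; apply/eqP; rewrite eq_le g0 h.
Qed.

Let mcake (h : R * R -> R) (k : R * R -> R) : measurable_fun setT h -> measurable_fun setT k ->
  measurable_fun setT (fun z => cake (h z) (k z)).
Proof.
move=> mh mk; rewrite /cake; apply: measurable_fun_ifT => //=.
by apply: measurable_and; apply: measurable_fun_ltr.
Qed.

Let tonelliT (F : R -> R -> \bar R) :
  measurable_fun setT (fun z : R * R => F z.1 z.2) -> (forall x t, (0 <= F x t)%E) ->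
  (\int[mu]_x \int[mu]_s F x s = \int[mu]_s \int[mu]_x F x s)%E.
Proof.
move=> mF F0.
exact: (fubini_tonelli (m1 := mu) (m2 := mu) (fun z => F z.1 z.2) mF (fun z => F0 z.1 z.2)).
Qed.

Let inv_int_T (G : R -> R) : measurable_fun setT G -> (forall x, 0 <= G x) ->
  (\int[mu]_x (G (invp x) * invw x)%:E = \int[mu]_x (G x)%:E)%E.
Proof.
move=> mG G0; have mi := @measurable_invp R; have mw := @measurable_invw R.
have mGi : measurable_fun setT (fun x => G (invp x)) by exact: (measurableT_comp mG mi).
transitivity (\int[mu]_x \int[mu]_s (cake (G (invp x)) s * invw x)%:E)%E.
  apply: eq_integral => x _; rewrite mulrC EFinM -(cake_int (G (invp x)))//.
  rewrite -ge0_integralZl//.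
  - by apply: eq_integral => s _; rewrite -EFinM mulrC.
  - apply/measurable_EFinP; rewrite /cake; apply: measurable_fun_ifT => //=.
    by apply: measurable_and; apply: measurable_fun_ltr; meas.
  - by move=> s _; rewrite lee_fin /cake; case: ifP.
  - by rewrite lee_fin invw_ge0.
rewrite (tonelliT (fun x s => (cake (G (invp x)) s * invw x)%:E))//=; last 2 first.
- apply/measurable_EFinP; apply: measurable_funM.
    apply: mcake; last exact: measurable_snd.
    exact: (measurableT_comp mGi measurable_fst).
  exact: (measurableT_comp mw measurable_fst).
- by move=> x s; rewrite lee_fin mulr_ge0 ?invw_ge0// /cake; case: ifP.
transitivity (\int[mu]_s \int[mu]_x (cake (G x) s)%:E)%E; last first.
  rewrite -(tonelliT (fun x s => (cake (G x) s)%:E))//=.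
  - by apply: eq_integral => x _; rewrite cake_int.
  - apply/measurable_EFinP; apply: mcake; last exact: measurable_snd.
    exact: (measurableT_comp mG measurable_fst).
  - by move=> x s; rewrite lee_fin /cake; case: ifP.
apply: eq_integral => s _; rewrite /cake.
case: (ltP 0 s) => s0 /=; last first.
  by rewrite !integral0_eq// => x _; rewrite ?mul0r.
pose A : set R := [set x | s < G x].
have mA : measurable A.
  have h : measurable_fun setT (fun x => s < G x) by exact: measurable_fun_ltr.
  have : measurable ([set: R] `&` (fun x => s < G x) @^-1` [set true]) by exact: h.
  by rewrite setTI.
transitivity (lebesgue_measure A); last first.
  rewrite -(setIT A) -integral_indic//; apply: eq_integral => x _; rewrite indicE.
  by case: ifPn => h; [rewrite mem_set|rewrite memNset//; exact/negP].
rewrite inv_measureE// /inv_measure [RHS]integral_mkcond.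
apply: eq_integral => x _; rewrite patchE.
by case: ifPn => h; [rewrite mem_set// mul1r|rewrite memNset ?mul0r//; exact/negP].
Qed.

Lemma inv_int (G : R -> R) : measurable_fun setT G -> (forall x, 0 <= G x) ->
  (\int[mu]_(x in D) (G x^-1 * (x^-1) ^+ 2)%:E = \int[mu]_(x in D) (G x)%:E)%E.
Proof.
move=> mG G0; pose H x := if 0 < x then G x else 0.
have mH : measurable_fun setT H.
  by rewrite /H; apply: measurable_fun_ifT => //=; apply: measurable_fun_ltr; meas.
have H0 x : 0 <= H x by rewrite /H; case: ifP.
have inD x : (x \in D) = (0 < x) by apply/idP/idP; rewrite ?inE RplusE.
rewrite integral_mkcond [RHS]integral_mkcond.
transitivity (\int[mu]_x (H (invp x) * invw x)%:E)%E.
  apply: eq_integral => x _; rewrite patchE inD /H /invp /invw.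
  by case: (ltP 0 x) => x0; rewrite ?invr_gt0 ?x0// ltNge x0 /= mul0r.
rewrite inv_int_T//; apply: eq_integral => x _; rewrite patchE inD /H.
by case: ifP.
Qed.

Lemma inv_intD (G : R -> R) : measurable_fun setT G -> intD G ->
  intD (fun x => G x^-1 * (x^-1) ^+ 2).
Proof.
move=> mG /intD_norm_lty iG.
have mGi : measurable_fun setT (fun x : R => G x^-1).
  exact: (measurableT_comp mG (measurable_inv)).
apply: intDP; first by meas.
have mnG : measurable_fun setT (fun x => `|G x|) by meas.
have := inv_int (fun x => `|G x|) mnG (fun x => normr_ge0 _).
move=> e; rewrite -e in iG; apply: le_lt_trans iG.
rewrite le_eqVlt; apply/orP; left; apply/eqP; apply: eq_integral => x _.
by rewrite normrM [X in _ * X]ger0_norm ?sqr_ge0.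
Qed.

Lemma inv_Rint (G : R -> R) : measurable_fun setT G -> intD G ->
  \int[mu]_(x in D) (G x^-1 * (x^-1) ^+ 2) = \int[mu]_(x in D) G x.
Proof.
move=> mG iG.
pose p x := `|G x| + G x; pose n x := `|G x|.
have mn : measurable_fun setT n by rewrite /n; meas.
have mp : measurable_fun setT p by apply: measurable_funD.
have inn : intD n by exact: intD_norm.
have ip : intD p by exact: intDD.
have p0 x : 0 <= p x by rewrite /p; have := ler_norm (- G x); rewrite normrN; lra.
have n0 x : 0 <= n x by exact: normr_ge0.
have e (h : R -> R) : measurable_fun setT h -> (forall x, 0 <= h x) ->
    \int[mu]_(x in D) (h x^-1 * (x^-1) ^+ 2) = \int[mu]_(x in D) h x.
  by move=> mh h0; rewrite /Rintegral inv_int.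
transitivity (\int[mu]_(x in D) (p x^-1 * (x^-1) ^+ 2) - \int[mu]_(x in D) (n x^-1 * (x^-1) ^+ 2)).
  rewrite -RintegralB//; [|exact: inv_intD|exact: inv_intD].
  by apply: eq_RintD => x _; rewrite /p /n; ring.
rewrite !e// -RintegralB//; apply: eq_RintD => x _; rewrite /p /n; ring.
Qed.
End Inversion.

(** * Injectivity of the Stieltjes transform *)

Section Injectivity.
Context {R : realType}.
Local Notation mu := (@lebesgue_measure R).
Local Notation D := (@Rplus R).

(** All the integrals over (-oo, y] vanish, so their derivative does; by
    Lebesgue's differentiation theorem it is the function almost everywhere. *)
Lemma tail_int0_ae0 (w : R -> R) : measurable_fun setT w -> intD w ->
  \int[mu]_(t in D) w t = 0 ->
  (forall b : R, 0 < b -> \int[mu]_(t in D) (w t * \1_(`]b, +oo[%classic) t) = 0) ->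
  {ae mu, forall t, D t -> w t = 0}.
Proof.
move=> mw iw w0 wb.
have iW : mu.-integrable setT (EFin \o (w \_ D)).
  rewrite -restrict_EFin;
  have [h _] := @integrable_mkcond _ _ _ mu _ (EFin \o w) measurable_Rplus; exact: h iw.
have F0 (y : R) : \int[mu]_(t in `]-oo, y]) (w \_ D) t = 0.
  have [y0|y0] := leP y 0.
    transitivity (\int[mu]_(t in `]-oo, y]) (0 : R)); last by rewrite Rintegral_cst// mul0r.
    apply: eq_Rintegral => t; rewrite inE/= in_itv/= => ty.
    by rewrite patchE ifF//; apply/negP; rewrite inE RplusE ltNge (le_trans ty y0).
  have iwb : intD (fun t => w t * \1_(`]y, +oo[%classic) t).
    apply: (intD_dom _ (fun t => `|w t|)); last exact: intD_norm.
      by apply: measurable_funM => //; exact: measurable_indic.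
    by move=> t _; rewrite normrM ler_piMr// indicE; case: (_ \in _) => /=; rewrite ?normr1 ?normr0.
  rewrite -[RHS](subrr 0) -[X in _ = X - _]w0 -[X in _ = _ - X](wb y y0) -RintegralB//.
  rewrite Rintegral_mkcond [RHS]Rintegral_mkcond; congr Rintegral; apply/funext => t.
  rewrite !patchE indicE.
  have -> : (t \in `]-oo, y]%classic) = (t <= y) by apply/idP/idP; rewrite inE/= in_itv.
  have -> : (t \in `]y, +oo[%classic) = ~~ (t <= y).
    by rewrite -ltNge; apply/idP/idP; rewrite inE/= in_itv/= andbT.
  by case: (t \in D); case: (t <= y); rewrite /= ?mulr0 ?mulr1 ?subr0 ?subrr.
have h1 (y : R) : mu.-integrable `]-oo, y] (EFin \o (w \_ D)).
  by apply: integrableS iW.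
have h2 : locally_integrable [set: R] (w \_ D) by exact: integrable_locally.
have := @FTC1Ny R _ h1 h2.
apply: ae_imp => t [_]; rewrite (_ : (fun x => _) = cst 0).
  by rewrite derive1_cst patchE => h Dt; rewrite [RHS]h mem_set.
by apply/funext => x; exact: F0.
Qed.
(** For r = s this is, up to a constant, the integrand of the m-th derivative of
    the Stieltjes transform at r; the case r <> s serves to reach it without
    differentiating under the integral. *)
Definition moment (f : R -> R) (m : nat) (r s t : R) : R :=
  t * f t / (r + t ^+ 2) ^+ m / (s + t ^+ 2).

Lemma addsqr_gt0 (r t : R) : 0 < r -> 0 < r + t ^+ 2.
Proof. by move=> r0; rewrite ltr_wpDr ?sqr_ge0. Qed.

Lemma measurable_moment f m r s : measurable_fun setT f -> measurable_fun setT (moment f m r s).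
Proof.
move=> mf; have mr (a : R) : measurable_fun [set: R] (fun t : R => a + t ^+ 2).
  by apply: measurable_funD => //; exact: measurable_funX.
apply: measurable_funM; last by apply: measurable_funV; exact: mr.
apply: measurable_funM; first exact: measurable_funM.
by apply: measurable_funV; apply: measurable_funX; exact: mr.
Qed.

Lemma moment0 f (s t : R) : 0 < s -> moment f 0 s s t = stieltjes (Num.sqrt s) t * f t.
Proof.
by move=> s0; rewrite /moment /stieltjes expr0 divr1 sqr_sqrtr ?ltW// mulrAC.
Qed.

Lemma intD_moment f m (r s : R) : L2 f -> 0 < r -> 0 < s -> intD (moment f m r s).
Proof.
move=> f2 r0 s0; have [mf _] := f2.
apply: (intD_dom _ (fun t => (r ^+ m)^-1 * `|moment f 0 s s t|)); first exact: measurable_moment.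
  move=> t t0; rewrite /moment !normrM expr0 invr1 normr1 mulr1 mulrA ler_wpM2r// mulrC.
  rewrite ler_wpM2r ?mulr_ge0// ger0_norm ?invr_ge0 ?exprn_ge0 ?(ltW (addsqr_gt0 _ _ _))//.
  rewrite lef_pV2 ?posrE ?exprn_gt0 ?addsqr_gt0//.
  by rewrite lerXn2r ?nnegrE ?(ltW r0) ?(ltW (addsqr_gt0 _ _ _))// lerDl sqr_ge0.
apply: intDZ; apply: intD_norm.
apply: (eq_intD (fun t => stieltjes (Num.sqrt s) t * f t)) => [t _|]; first by rewrite moment0.
by apply: (carleman_dom_int _ _ carleman_dom_stieltjes) => //; rewrite sqrtr_gt0.
Qed.

(** Induction on m.  For s <> r the partial fraction of 1/((r + u) (s + u))
    expresses the integral through two integrals of lower order; s = r is the limit of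
    r + 1/(n+1). *)
Lemma moment_eq0 f m (r s : R) : L2 f -> (forall y : R, 0 < y -> kernel_op stieltjes f y = 0) ->
  0 < r -> 0 < s -> \int[mu]_(t in D) moment f m r s t = 0.
Proof.
move=> f2 Nf r0 s0; have [mf _] := f2.
elim: m s s0 => [|m IH] s s0.
  rewrite -(Nf (Num.sqrt s)) ?sqrtr_gt0// /kernel_op; apply: eq_RintD => t _.
  by rewrite -moment0 // /moment !expr0.
have off (s' : R) : 0 < s' -> s' != r -> \int[mu]_(t in D) moment f m.+1 r s' t = 0.
  move=> s'0 sr.
  transitivity (\int[mu]_(t in D) ((s' - r)^-1 * (moment f m r r t + (-1) * moment f m r s' t))).
    apply: eq_RintD => t _; rewrite /moment.
    have h1 := addsqr_gt0 _ t r0; have h2 := addsqr_gt0 _ t s'0.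
    have -> : (r + t ^+ 2) ^- m.+1 = (r + t ^+ 2) ^- m / (r + t ^+ 2).
      by rewrite exprSr invfM.
    by field; rewrite subr_eq0 sr !gt_eqF ?exprn_gt0.
  have i1 := intD_moment _ m _ _ f2 r0 r0; have i2 := intD_moment _ m _ _ f2 r0 s'0.
  rewrite RintD_Z; last by apply: intDD => //; exact: intDZ.
  by rewrite RintD_D//; [rewrite RintD_Z// !IH// mulr0 addr0 mulr0|exact: intDZ].
have [->|sr] := eqVneq s r; last exact: off.
have h : \int[mu]_(t in D) moment f m.+1 r (r + n.+1%:R^-1) t @[n --> \oo] -->
    \int[mu]_(t in D) moment f m.+1 r r t.
  apply: (dominated_Rint _ _ (fun t => `|moment f m.+1 r r t|)).
  - by move=> n; exact: measurable_moment.
  - exact: measurable_moment.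
  - apply: aeW => t _; rewrite /moment; apply: cvgMr; apply: cvgV.
      by rewrite gt_eqF// addsqr_gt0.
    apply: cvgD; last exact: cvg_cst.
    by rewrite -[X in _ --> X]addr0; apply: cvgD; [exact: cvg_cst|exact: cvg_harmonic].
  - by apply: intD_norm; exact: intD_moment.
  - move=> n t t0; rewrite /moment normrM [leRHS]normrM ler_wpM2l//.
    have rn : 0 < r + n.+1%:R^-1 by rewrite addr_gt0.
    rewrite !ger0_norm ?invr_ge0 ?(ltW (addsqr_gt0 _ _ _))//.
    by rewrite lef_pV2 ?posrE ?addsqr_gt0// lerD2r lerDl.
have e n : \int[mu]_(t in D) moment f m.+1 r (r + n.+1%:R^-1) t = 0.
  apply: off; first by rewrite addr_gt0.
  by rewrite gt_eqF// ltrDl.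
have E : (fun n => \int[mu]_(t in D) moment f m.+1 r (r + n.+1%:R^-1) t) = cst 0.
  by apply/funext => n; exact: e.
by rewrite E in h; apply: (cvg_unique _ h (cvg_cst 0)); exact: Rhausdorff.
Qed.

Lemma bernoulli_inequality (x : R) n : -1 <= x -> 1 + n%:R * x <= (1 + x) ^+ n.
Proof.
move=> x1; have x10 : 0 <= 1 + x by lra.
elim: n => [|n IH]; first by rewrite mul0r addr0.
rewrite exprS; apply: (le_trans _ (ler_wpM2l x10 IH)).
have := sqr_ge0 x; have : 0 <= n%:R :> R by [].
rewrite -natr1; nra.
Qed.

(** By Bernoulli's inequality the power is at least 1 - (2 v)^(n+1).  Together with
    [bernoulli_power_cvg0], this gives polynomials in v bounded by 1 on [0, 1] that
    converge off v = 1/2 to the indicator of v < 1/2, as in Kuhn's proof of the Weierstrass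
    theorem. *)
Lemma bernoulli_power_cvg1 (v : R) : 0 < v -> v < 2^-1 ->
  (1 - v ^+ n.+1) ^+ (2 ^ n.+1) @[n --> \oo] --> (1 : R).
Proof.
move=> v0 v2.
have v1 n : v ^+ n <= 1 by rewrite exprn_ile1//; lra.
have lb n : 1 - (2 * v) ^+ n.+1 <= (1 - v ^+ n.+1) ^+ (2 ^ n.+1).
  have := @bernoulli_inequality (- v ^+ n.+1) (2 ^ n.+1); rewrite lerN2 => /(_ (v1 _)).
  by rewrite natrX mulrN -exprMn.
have ub n : (1 - v ^+ n.+1) ^+ (2 ^ n.+1) <= 1.
  by rewrite exprn_ile1// ?subr_ge0// gerBl exprn_ge0 ?ltW.
apply: (squeeze_cvgr _ (_ : (fun n => 1 - (2 * v) ^+ n.+1) @ \oo --> (1 : R))); last exact: cvg_cst.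
  by near=> n; rewrite lb ub.
rewrite -[X in _ --> X]subr0; apply: cvgB; first exact: cvg_cst.
rewrite (cvg_shiftS (fun n => (2 * v) ^+ n)); apply: cvg_expr; rewrite ger0_norm; lra.
Unshelve. all: by end_near. Qed.

(** Since (1 - z) (1 + z) <= 1, the power is at most the inverse of
    (1 + v^(n+1))^(2^(n+1)), which is at least (2 v)^(n+1) by Bernoulli. *)
Lemma bernoulli_power_cvg0 (v : R) : 2^-1 < v -> v < 1 ->
  (1 - v ^+ n.+1) ^+ (2 ^ n.+1) @[n --> \oo] --> (0 : R).
Proof.
move=> v2 v1; have v0 : 0 < v by lra.
have v01 n : v ^+ n <= 1 by rewrite exprn_ile1//; lra.
have ub n : (1 - v ^+ n.+1) ^+ (2 ^ n.+1) <= (2 * v)^-1 ^+ n.+1.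
  have p0 : 0 < (2 * v) ^+ n.+1 by rewrite exprn_gt0//; lra.
  rewrite exprVn -[leRHS]mul1r ler_pdivlMr//.
  have := @bernoulli_inequality (v ^+ n.+1) (2 ^ n.+1).
  rewrite (le_trans _ (exprn_ge0 _ (ltW v0))) ?lerN10// => /(_ isT).
  rewrite natrX -exprMn => h.
  have h0 : 0 <= (1 - v ^+ n.+1) ^+ (2 ^ n.+1) by rewrite exprn_ge0 ?subr_ge0.
  have h' : (2 * v) ^+ n.+1 <= (1 + v ^+ n.+1) ^+ (2 ^ n.+1) by apply: le_trans h; rewrite lerDr.
  apply: (le_trans (ler_wpM2l h0 h')); rewrite -exprMn exprn_ile1//.
    by rewrite mulr_ge0 ?subr_ge0 ?addr_ge0// exprn_ge0// ltW.
  by have := sqr_ge0 (v ^+ n.+1); nra.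
apply: (squeeze_cvgr (f := cst 0) _ _ (_ : (fun n => (2 * v)^-1 ^+ n.+1) @ \oo --> (0 : R))); last 1 first.
- rewrite (cvg_shiftS (fun n => (2 * v)^-1 ^+ n)); apply: cvg_expr.
  rewrite ger0_norm ?invr_ge0; last by lra.
  by rewrite invf_lt1; lra.
- by near=> n; rewrite ub andbT /cst exprn_ge0 ?subr_ge0.
- exact: cvg_cst.
Unshelve. all: by end_near. Qed.

(** Only the polynomials v^k (1 - v^n)^m are needed, and the factor v^k makes
    the induction on m close. *)
Lemma moment_poly_eq0 (f : R -> R) (a : R) (k n m : nat) : L2 f ->
  (forall y : R, 0 < y -> kernel_op stieltjes f y = 0) -> 0 < a ->
  let G := fun t : R => moment f 0 1 1 t * ((a / (a + t ^+ 2)) ^+ k * (1 - (a / (a + t ^+ 2)) ^+ n) ^+ m) in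
  intD G /\ \int[mu]_(t in D) G t = 0.
Proof.
move=> f2 Nf a0; elim: m k => [|m IH] k G.
  have E (t : R) : 0 < t -> a ^+ k * moment f k a 1 t = G t.
    move=> _; rewrite /G /moment !expr0 !divr1 mulr1 expr_div_n.
    have h := addsqr_gt0 _ t a0; have h1 := addsqr_gt0 _ t ltr01.
    by field; rewrite !gt_eqF ?exprn_gt0.
  split; first by apply: (eq_intD _ _ E); apply/intDZ/intD_moment.
  by rewrite -(eq_RintD _ _ E) RintD_Z ?moment_eq0 ?mulr0//; exact: intD_moment.
have [i1 e1] := IH k; have [i2 e2] := IH (k + n)%N.
pose V (t : R) := a / (a + t ^+ 2).
have E (t : R) : 0 < t -> moment f 0 1 1 t * (V t ^+ k * (1 - V t ^+ n) ^+ m)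
    - moment f 0 1 1 t * (V t ^+ (k + n) * (1 - V t ^+ n) ^+ m) = G t.
  move=> _; rewrite /G -/(V t) (exprS _ m) (exprD _ k n).
  by move: (moment _ _ _ _ _) (V t ^+ k) (V t ^+ n) ((1 - _) ^+ m) => A B C F; ring.
split; first by apply: (eq_intD _ _ E); exact: intDB.
by rewrite -(eq_RintD _ _ E) RintegralB// e1 e2 subrr.
Qed.

(** In the variable v = b^2 / (b^2 + t^2) the condition t > b is v < 1/2, so the
    integral over t > b is a limit of integrals against polynomials in v. *)
Lemma stieltjes_inj (f : R -> R) : L2 f -> (forall y : R, 0 < y -> kernel_op stieltjes f y = 0) ->
  {ae mu, forall t, D t -> f t = 0}.
Proof.
move=> f2 Nf; have [mf _] := f2.
suff : {ae mu, forall t, D t -> moment f 0 1 1 t = 0}.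
  apply: ae_imp => t h Dt; move/h: (Dt) => /eqP.
  move: Dt; rewrite RplusE => t0.
  rewrite /moment expr0 divr1 mulf_eq0 invr_eq0 (gt_eqF (addsqr_gt0 _ _ _))//.
  by rewrite orbF mulf_eq0 gt_eqF//= => /eqP.
apply: tail_int0_ae0; [exact: measurable_moment|exact: intD_moment|exact: moment_eq0|].
move=> b b0; pose a : R := b ^+ 2.
have a0 : 0 < a by rewrite exprn_gt0.
pose v (t : R) := a / (a + t ^+ 2).
have v01 t : 0 < v t <= 1.
  have h := addsqr_gt0 _ t a0.
  by rewrite /v divr_gt0//= ler_pdivrMr// mul1r lerDl sqr_ge0.
have mv : measurable_fun setT v.
  apply: measurable_funM => //; apply: measurable_funV.
  by apply: measurable_funD => //; exact: measurable_funX.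
have h : \int[mu]_(t in D) (moment f 0 1 1 t * (1 - v t ^+ n.+1) ^+ (2 ^ n.+1)) @[n --> \oo] -->
    \int[mu]_(t in D) (moment f 0 1 1 t * \1_(`]b, +oo[%classic) t).
  apply: (dominated_Rint _ _ (fun t => `|moment f 0 1 1 t|)).
  - move=> n; apply: measurable_funM; first exact: measurable_moment.
    by apply: measurable_funX; apply: measurable_funB => //; exact: measurable_funX.
  - by apply: measurable_funM; [exact: measurable_moment|exact: measurable_indic].
  - exists [set b]; split; [exact: measurable_set1|exact: lebesgue_measure_set1|].
    move=> t /= ht; apply/eqP/negP => /negP tb; apply: ht; rewrite RplusE => t0.
    apply: cvgM; first exact: cvg_cst.
    have h := addsqr_gt0 _ t a0.
    have [bt|tb'] := ltP b t.
      rewrite indicE mem_set/= ?in_itv/= ?bt//; apply: bernoulli_power_cvg1; first by case/andP: (v01 t).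
      rewrite /v ltr_pdivrMr//.
      have : a < t ^+ 2 by rewrite /a ltrXn2r// ?nnegrE ltW.
      by lra.
    rewrite indicE memNset/=; last by rewrite in_itv/= andbT ltNge tb'.
    have tb2 : t ^+ 2 < a by rewrite /a ltrXn2r// ?nnegrE ?(ltW t0) ?(ltW b0)// lt_neqAle tb.
    by apply: bernoulli_power_cvg0; rewrite /v ?ltr_pdivlMr ?ltr_pdivrMr//; have := exprn_gt0 2 t0; lra.
  - exact/intD_norm/intD_moment.
  - move=> n t _; rewrite normrM ler_piMr//; have /andP[v0 v1] := v01 t.
    have vn : v t ^+ n.+1 <= 1 by rewrite exprn_ile1// ltW.
    rewrite ger0_norm ?exprn_ge0 ?subr_ge0// exprn_ile1 ?subr_ge0// gerBl exprn_ge0//.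
    exact: ltW.
have E : (fun n => \int[mu]_(t in D) (moment f 0 1 1 t * (1 - v t ^+ n.+1) ^+ (2 ^ n.+1))) = cst 0.
  apply/funext => n; rewrite -[RHS](proj2 (moment_poly_eq0 f a 0 n.+1 (2 ^ n.+1) f2 Nf a0)).
  by apply: eq_RintD => t _; rewrite expr0 mul1r.
by rewrite E in h; apply: (cvg_unique _ h (cvg_cst 0)); exact: Rhausdorff.
Qed.
End Injectivity.

(** * The equation satisfied by the Stieltjes transform of a solution *)

Section Gequation.
Context {R : realType}.
Local Notation mu := (@lebesgue_measure R).
Local Notation D := (@Rplus R).

Lemma measurable_inv_div (f : R -> R) : measurable_fun setT f ->
  measurable_fun setT (fun x : R => f x^-1 / x).
Proof.
move=> mf; apply: measurable_funM; last exact: measurable_inv.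
exact: (measurableT_comp mf measurable_inv).
Qed.

Lemma L2_inversion (f : R -> R) : L2 f ->
  L2 (fun x => f x^-1 / x) /\
  \int[mu]_(x in D) ((f x^-1 / x) ^+ 2) = \int[mu]_(x in D) (f x ^+ 2).
Proof.
move=> f2; have [mf _] := f2.
have mG : measurable_fun setT (fun x : R => f x ^+ 2) by exact: measurable_funX.
have E (x : R) : 0 < x -> f x^-1 ^+ 2 * x^-1 ^+ 2 = (f x^-1 / x) ^+ 2.
  by move=> _; rewrite exprMn.
split; last by rewrite -(eq_RintD _ _ E) (inv_Rint _ mG (L2_sqr _ f2)).
apply: L2P; first exact: measurable_inv_div.
exact: (eq_intD _ _ E (inv_intD _ mG (L2_sqr _ f2))).
Qed.

(** The Stieltjes kernel is compatible with inversion: N' J = J N. *)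
Lemma poisson_inv_Rint (f : R -> R) (y : R) : L2 f -> 0 < y ->
  \int[mu]_(x in D) (poisson y x * (f x^-1 / x)) = kernel_op stieltjes f y^-1 / y.
Proof.
move=> f2 y0; have [mf _] := f2.
have yi0 : 0 < y^-1 by rewrite invr_gt0.
have iN := carleman_dom_int _ _ carleman_dom_stieltjes f2 y^-1 yi0.
have mN : measurable_fun setT (fun t => stieltjes y^-1 t * f t).
  by apply: measurable_funM => //; apply: measurable2_1; case: (@carleman_dom_stieltjes R).
have mG : measurable_fun setT (fun t => y^-1 * (stieltjes y^-1 t * f t)) by apply: measurable_funM.
rewrite mulrC -RintD_Z// -(inv_Rint _ mG (intDZ _ _ iN)).
apply: eq_RintD => x x0; rewrite /poisson /stieltjes.
have h1 := sqrD_gt0 x _ y0; have h2 : 0 < x^-1 by rewrite invr_gt0.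
have h3 := sqrD_gt0 y^-1 _ h2.
field; rewrite !gt_eqF//=.
Qed.

Lemma poisson_op_stieltjes (g : R -> R) (y : R) : L2 g -> 0 < y ->
  \int[mu]_(x in D) (poisson y x * kernel_op stieltjes g x) = pi / 2 * kernel_op carleman g y.
Proof.
move=> g2 y0; rewrite (carleman_dom_pairing _ _ _ carleman_dom_stieltjes (L2_poisson _ y0) g2).
rewrite /kernel_op -RintD_Z; last exact: L2_mul (L2_carleman _ y0) g2.
apply: eq_RintD => t t0; rewrite mulrA -stieltjes_gram// mulrC.
by congr (_ * _); apply: eq_RintD.
Qed.

(** The quadratic form of the Carleman operator is nonnegative, being a multiple
    of the squared norm of the Stieltjes transform. *)
Lemma carleman_form_eq (g : R -> R) : L2 g ->
  \int[mu]_(t in D) (g t * kernel_op carleman g t) =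
  2 / pi * \int[mu]_(x in D) (kernel_op stieltjes g x ^+ 2).
Proof.
move=> g2; have N2 := carleman_dom_L2_op _ _ carleman_dom_stieltjes g2.
have E (p a b : R) : 0 < p -> 2 / p * (a * (p / 2 * b)) = a * b.
  by move=> p0; field; rewrite gt_eqF.
transitivity (2 / pi * \int[mu]_(x in D) (kernel_op stieltjes g x * kernel_op stieltjes g x)); last first.
  by congr (_ * _); apply: eq_RintD => t _; rewrite expr2.
rewrite (carleman_dom_pairing _ _ _ carleman_dom_stieltjes N2 g2) -RintD_Z; last first.
  exact: carleman_dom_pairing_int carleman_dom_stieltjes N2 g2.
apply: eq_RintD => t t0; rewrite (_ : \int[mu]_(x in D) _ = pi / 2 * kernel_op carleman g t).
  by rewrite E ?pi_gt0.
by rewrite -poisson_op_stieltjes//; apply: eq_RintD => x _; rewrite mulrC.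
Qed.

Lemma sqr_Rint_eq0 (g : R -> R) : L2 g -> \int[mu]_(t in D) (g t ^+ 2) <= 0 ->
  {ae mu, forall t, D t -> g t = 0}.
Proof.
move=> g2 le0; have [mg _] := g2.
have : (\int[mu]_(t in D) `|(g t ^+ 2)%:E| = 0)%E.
  under eq_integral do rewrite /= ger0_norm ?sqr_ge0//.
  rewrite (intD_fin _ (L2_sqr _ g2)); congr EFin; apply/eqP; rewrite eq_le le0/=.
  by apply: Rintegral_ge0 => t _; exact: sqr_ge0.
have mg2 : measurable_fun D (fun t => (g t ^+ 2)%:E).
  by apply/measurable_EFinP; apply: measurable_funTS; exact: measurable_funX.
move/(proj1 (ae_eq_integral_abs mu measurable_Rplus mg2)).
by apply: ae_imp => t h /h [] /eqP; rewrite sqrf_eq0 => /eqP.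
Qed.

Lemma Rint_mul_ae0 (k g : R -> R) : measurable_fun setT k -> measurable_fun setT g ->
  {ae mu, forall t, D t -> g t = 0} -> \int[mu]_(t in D) (k t * g t) = 0.
Proof.
move=> mk mg h; rewrite /Rintegral (ae_eq_integral (cst 0%E))//= ?integral0//.
- by apply/measurable_EFinP; apply: measurable_funTS; exact: measurable_funM.
- by apply: ae_imp h => t h /h ->; rewrite mulr0.
Qed.

Lemma amgm_weighted (l x y : R) : 0 <= l -> x * (l * y) <= l / 2 * (x ^+ 2 + y ^+ 2).
Proof. by move=> l0; have := mulr_ge0 l0 (sqr_ge0 (x - y)); lra. Qed.

(** The conclusion of the energy estimate: p and l are pi/2 and the modulus of the
    coefficient of the inversion, b half the Carleman form and a the squared norm. *)
Lemma sum_le_scale0 (p l a b : R) : l < p -> 0 <= b -> b + p * a <= l * a -> a <= 0.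
Proof.
move=> lp b0 h; rewrite leNgt; apply/negP => a0.
by have := mulr_gt0 a0 (_ : 0 < p - l); rewrite subr_gt0 => /(_ lp); lra.
Qed.

(** The energy estimate gives g = 0 almost everywhere.  The relation at every
    point, rather than almost everywhere, turns this into g = 0 everywhere. *)
Lemma inversion_equation_eq0 (g : R -> R) (l : R) : L2 g -> `|l| < pi / 2 ->
  (forall y : R, 0 < y -> 2^-1 * kernel_op carleman g y + pi / 2 * g y = l * (g y^-1 / y)) ->
  forall y : R, 0 < y -> g y = 0.
Proof.
move=> g2 hl gE; have [mg _] := g2; have pi0 := @pi_gt0 R.
have [J2 JE] := L2_inversion _ g2.
have C2 := L2_op_carleman _ g2.
pose A := \int[mu]_(t in D) (g t ^+ 2).
have gC := carleman_form_eq _ g2.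
have N0 : 0 <= \int[mu]_(x in D) (kernel_op stieltjes g x ^+ 2).
  by apply: Rintegral_ge0 => t _; exact: sqr_ge0.
have i1 : intD (fun t => 2^-1 * (g t * kernel_op carleman g t)) by apply/intDZ/L2_mul.
have i2 : intD (fun t => pi / 2 * g t ^+ 2) by apply/intDZ/L2_sqr.
have i3 : intD (fun t => (`|l| / 2) * (g t ^+ 2 + (g t^-1 / t) ^+ 2)).
  by apply/intDZ/intDD; exact: L2_sqr.
have le : 2^-1 * (2 / pi * \int[mu]_(x in D) (kernel_op stieltjes g x ^+ 2)) + pi / 2 * A <= `|l| * A.
  rewrite -gC -(RintD_Z _ _ (L2_mul _ _ g2 C2)) -(RintD_Z _ _ (L2_sqr _ g2)).
  rewrite -RintD_D//.
  apply: (le_trans (le_RintD _ _ (intDD _ _ i1 i2) i3 _)).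
    move=> t t0.
    have -> : 2^-1 * (g t * kernel_op carleman g t) + pi / 2 * g t ^+ 2 =
        g t * (2^-1 * kernel_op carleman g t + pi / 2 * g t) by ring.
    rewrite gE//; apply: (le_trans (ler_norm _)).
    rewrite !normrM -(real_normK (num_real (g t))) -(real_normK (num_real (_ / t))) normrM.
    exact: amgm_weighted.
  rewrite RintD_Z; last by apply/intDD; exact: L2_sqr.
  rewrite RintD_D; try exact: L2_sqr.
  rewrite JE.
  have hA (p q : R) : p / 2 * (q + q) = p * q by field.
  by rewrite hA.
have A0 : A <= 0.
  by apply: (sum_le_scale0 _ _ _ _ hl _ le); rewrite mulr_ge0// mulr_ge0// divr_ge0// ltW.
have gae := sqr_Rint_eq0 _ g2 A0.
have gE' (y : R) : 0 < y -> pi / 2 * g y = l * (g y^-1 / y).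
  move=> y0; rewrite -gE// /kernel_op (Rint_mul_ae0 _ _ (measurable2_1 _ measurable2_carleman y) mg gae).
  by rewrite mulr0 add0r.
move=> y y0; have yi0 : 0 < y^-1 by rewrite invr_gt0.
have := gE' _ yi0; have := gE' _ y0; rewrite invrK => e1 e2.
have : (pi / 2) ^+ 2 * g y = l ^+ 2 * g y.
  rewrite expr2 -mulrA e1 expr2.
  transitivity (l * (pi / 2 * g y^-1) / y); first by ring.
  by rewrite e2; field; rewrite gt_eqF.
have : l ^+ 2 < (pi / 2) ^+ 2.
  by rewrite -(real_normK (num_real l)) ltrXn2r// ?nnegrE// divr_ge0// ltW.
move=> h /eqP; rewrite -subr_eq0 -mulrBl mulf_eq0 subr_eq0 gt_eqF//= => /eqP.
exact.
Qed.

(** The coefficient l is normalized so that the equation reads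
    H f = (1/pi) N N f - l J f. *)
Lemma real_uniqueness (f : R -> R) (l : R) : L2 f -> `|l| < pi / 2 ->
  {ae mu, forall x, D x -> exists2 v : R,
     is_PV (fun t => PV_kernel x t * f t) x v & v = l * (f x^-1 / x)} ->
  {ae mu, forall x, D x -> f x = 0}.
Proof.
move=> f2 hl hf; have [mf _] := f2.
have g2 := carleman_dom_L2_op _ _ carleman_dom_stieltjes f2.
have NN2 := carleman_dom_L2_op _ _ carleman_dom_stieltjes g2.
have [J2 _] := L2_inversion _ f2.
apply: stieltjes_inj => //; apply: (inversion_equation_eq0 _ l) => // y y0.
(* a measurable representative of the limit, whatever the measurability of the principal value *)
have mh : measurable_fun setT (fun x => pi^-1 * kernel_op stieltjes (kernel_op stieltjes f) x
    + (- l) * (f x^-1 / x)).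
  by apply: measurable_funD; apply: measurable_funM => //; [case: NN2|case: J2].
have [] := re_kernel_limit f _ f2 mh.
  apply: ae_imp hf => x h Dx; have [v PV vE] := h Dx.
  by rewrite mulNr -vE; apply: (PV_re_kernel_cvg _ _ _ f2 _ PV); rewrite -RplusE.
move=> _ /(_ y y0).
have i1 := L2_mul _ _ (L2_poisson _ y0) NN2; have i2 := L2_mul _ _ (L2_poisson _ y0) J2.
rewrite (eq_RintD _ (fun x => pi^-1 * (poisson y x * kernel_op stieltjes (kernel_op stieltjes f) x)
  + (- l) * (poisson y x * (f x^-1 / x)))); last first.
  by move=> x _; ring.
rewrite RintD_D; try exact: intDZ.
rewrite !RintD_Z// poisson_op_stieltjes// poisson_inv_Rint// mulrA.
have pi0 := @pi_gt0 R.
have -> : pi^-1 * (pi / 2) = 2^-1 :> R by rewrite mulKf// gt_eqF.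
by lra.
Qed.
End Gequation.

(** * Complex solutions and the constants of the equation *)

Section Assembly.
Context {R : realType}.
Local Notation mu := (@lebesgue_measure R).
Local Notation D := (@Rplus R).

Lemma PV_domain_sub (x e : R) : PV_domain x e `<=` D.
Proof. by move=> t [t0 _]; rewrite RplusE. Qed.

Lemma measurable_PV_domain (x e : R) : measurable (PV_domain x e).
Proof. by rewrite PV_domainE; apply: measurableI => //; exact: measurable_far_set. Qed.

Lemma eq_is_PV (g h : R -> R) (x v : R) : (forall t : R, 0 < t -> g t = h t) ->
  is_PV g x v -> is_PV h x v.
Proof.
move=> gh [ig lg].
have E (e : R) t : t \in PV_domain x e -> g t = h t by rewrite inE => -[t0 _]; exact: gh.
split.
  move=> e e0; apply: eq_integrable (ig e e0); first exact: measurable_PV_domain.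
  by move=> t /E /= ->.
apply: cvg_trans lg; apply: near_eq_cvg; near=> e.
by apply: eq_Rintegral => t /E ->.
Unshelve. all: by end_near. Qed.

(** Every truncated integral vanishes. *)
Lemma ae0_is_PV (h : R -> R) (x : R) : measurable_fun D h ->
  {ae mu, forall t, D t -> h t = 0} -> is_PV h x 0.
Proof.
move=> mh h0.
have mhE (e : R) : measurable_fun (PV_domain x e) (EFin \o h).
  apply/measurable_EFinP; apply: measurable_funS mh => //; exact: PV_domain_sub.
have hE (e : R) : ae_eq mu (PV_domain x e) (EFin \o h) (cst 0%E).
  by apply: ae_imp h0 => t ht [t0 _] /=; rewrite ht// RplusE.
have mP := @measurable_PV_domain x.
split => [e e0|].
  apply/integrableP; split; first exact: mhE.
  by rewrite (proj2 (ae_eq_integral_abs mu (mP e) (mhE e)) (hE e)) ltry.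
rewrite (_ : (fun e => _) = cst 0); first exact: cvg_cst.
apply/funext => e; rewrite /Rintegral (ae_eq_integral (cst 0%E) _ _ _ _ (hE e)).
- by rewrite integral0.
- exact: mP.
- exact: mhE.
- exact: measurable_cst.
Qed.

Lemma powR_sqrt_pi : 2 `^ (3 / 2) / Num.sqrt pi * (pi / 2) = Num.sqrt (2 * pi) :> R.
Proof.
have pi0 := @pi_gt0 R; have p2 : 0 <= 2 `^ (3 / 2) :> R := powR_ge0 _ _.
have s : (2 `^ (3 / 2)) ^+ 2 = 8 :> R.
  by rewrite -powR_mulrn// -powRrM divfK// powR_mulrn//; ring.
have E (p q c : R) : 0 < q -> p = q ^+ 2 -> c ^+ 2 = 8 -> (c / q * (p / 2)) ^+ 2 = 2 * p.
  move=> q0 -> c2; rewrite (_ : _ ^+ 2 = c ^+ 2 * (q ^+ 2 / 4)); first by rewrite c2; field.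
  by field; rewrite gt_eqF.
rewrite -(E _ (Num.sqrt pi) _ _ _ s) ?sqrtr_gt0 ?sqr_sqrtr ?ltW// sqrtr_sqr ger0_norm//.
by rewrite mulr_ge0 ?divr_ge0 ?sqrtr_ge0 ?ltW.
Qed.

Lemma le_sqr_lty (a b : R -> R) : measurable_fun D a -> measurable_fun D b ->
  (forall t, a t ^+ 2 <= b t) -> (\int[mu]_(t in D) (b t)%:E < +oo)%E ->
  (\int[mu]_(t in D) (a t ^+ 2)%:E < +oo)%E.
Proof.
move=> ma mb ab; apply: le_lt_trans; apply: ge0_le_integral => //.
- by move=> t _; rewrite lee_fin sqr_ge0.
- by apply/measurable_EFinP; exact: measurable_funX.
- exact/measurable_EFinP.
- by move=> t _; rewrite lee_fin.
Qed.

Lemma in_L2_sqr (f : R -> R[i]) : in_L2 f ->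
  (\int[mu]_(t in D) (complex.Re (f t) ^+ 2)%:E < +oo)%E /\
  (\int[mu]_(t in D) (complex.Im (f t) ^+ 2)%:E < +oo)%E.
Proof.
move=> [mr mi fi].
have nE t : Normc.normc (f t) ^+ 2 = complex.Re (f t) ^+ 2 + complex.Im (f t) ^+ 2.
  by case: (f t) => a b /=; rewrite sqr_sqrtr// addr_ge0// sqr_ge0.
have mn : measurable_fun D (fun t => Normc.normc (f t) ^+ 2).
  under eq_fun do rewrite nE.
  by apply: measurable_funD; exact: measurable_funX.
split; apply: (le_sqr_lty _ _ _ mn) fi => // t.
  by rewrite nE lerDl sqr_ge0.
by rewrite nE lerDr sqr_ge0.
Qed.

(** Applied to the real and to the imaginary part.  The function is extended by
    0 to the whole line to be measurable there. *)
Lemma part_uniqueness (lambda : R) (f : R -> R[i]) (p : R[i] -> R) :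
  - Num.sqrt (2 * pi) < lambda < Num.sqrt (2 * pi) ->
  measurable_fun D (p \o f) ->
  (\int[mu]_(t in D) (p (f t) ^+ 2)%:E < +oo)%E ->
  (forall (a : R) (z : R[i]), p (a%:C%C * z) = a * p z) ->
  {ae mu, forall x, D x -> exists v : R[i],
     is_PV (fun t => p ((PV_kernel x t)%:C%C * f t)) x (p v) /\
     (2 `^ (3 / 2) / Num.sqrt pi)%:C%C * v = (lambda / x)%:C%C * f x^-1} ->
  {ae mu, forall x, D x -> p (f x) = 0}.
Proof.
move=> hl mpf f2 pZ hf; have pi0 := @pi_gt0 R.
set C := 2 `^ (3 / 2) / Num.sqrt pi in hf.
have C0 : 0 < C by rewrite divr_gt0 ?sqrtr_gt0// powR_gt0.
pose g : R -> R := (p \o f) \_ D.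
have gE (t : R) : 0 < t -> g t = p (f t).
  by move=> t0; rewrite /g patchE mem_set// RplusE.
have mg : measurable_fun setT g by exact/(measurable_restrictT _ measurable_Rplus).
have g2 : L2 g.
  split=> //; apply: le_lt_trans f2; rewrite le_eqVlt; apply/orP; left; apply/eqP.
  by apply: eq_integral => t; rewrite inE RplusE => t0; rewrite gE.
have lC : `|lambda / C| < pi / 2.
  rewrite normrM normfV (gtr0_norm C0) ltr_pdivrMr// mulrC powR_sqrt_pi.
  by rewrite ltr_norml.
have := real_uniqueness g (lambda / C) g2 lC.
have hg : {ae mu, forall x, D x -> exists2 v : R,
    is_PV (fun t => PV_kernel x t * g t) x v & v = lambda / C * (g x^-1 / x)}.
  apply: ae_imp hf => x h Dx; have [v [PV vE]] := h Dx.
  move: Dx; rewrite RplusE => x0; exists (p v).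
    by apply: (eq_is_PV _ _ _ _ _ PV) => t t0; rewrite pZ gE.
  have := congr1 p vE; rewrite !pZ gE ?invr_gt0// => e.
  apply: (mulfI (lt0r_neq0 C0)); rewrite e; field.
  by rewrite !gt_eqF.
move=> /(_ hg); apply: ae_imp => x h Dx; rewrite -gE ?h//.
by rewrite -RplusE.
Qed.

Lemma uniqueness (lambda : R)
    (hlambda : - Num.sqrt (2 * pi) < lambda < Num.sqrt (2 * pi))
    (f : R -> R[i]) (hf : in_L2 f) :
  solves_equation lambda f ->
  {ae lebesgue_measure, forall x : R, Rplus x -> f x = 0}.
Proof.
move=> sf; have [mr mi _] := hf; have [r2 i2] := in_L2_sqr _ hf.
have hr := part_uniqueness lambda f (@complex.Re R) hlambda mr r2.
have hi := part_uniqueness lambda f (@complex.Im R) hlambda mi i2.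
have Z (a : R) (z : R[i]) : complex.Re (a%:C%C * z) = a * complex.Re z /\
    complex.Im (a%:C%C * z) = a * complex.Im z.
  by case: z => u v /=; rewrite !mul0r subr0 addr0.
apply: ae_imp (ae_and _ _ (hr _ _) (hi _ _)).
- move=> x [h1 h2] Dx; have := h2 Dx; have := h1 Dx.
  by case: (f x) => u v /= -> ->.
- by move=> a z; case: (Z a z).
- by apply: ae_imp sf => x h Dx; have [v [[PV _] vE]] := h Dx; exists v.
- by move=> a z; case: (Z a z).
- by apply: ae_imp sf => x h Dx; have [v [[_ PV] vE]] := h Dx; exists v.
Qed.

(** Inversion preserves negligible sets, so the right-hand side vanishes almost
    everywhere as well. *)
Lemma zero_solves (lambda : R) (f : R -> R[i]) (hf : in_L2 f) :
  {ae lebesgue_measure, forall x : R, Rplus x -> f x = 0} ->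
  solves_equation lambda f.
Proof.
move=> f0; have [mr mi _] := hf.
have mK x : measurable_fun D (PV_kernel x) by apply: measurable_funTS; exact: measurable_PV_kernel.
apply: ae_imp (inv_ae _ f0) => x fx Dx; exists 0; split; last by rewrite fx// !mulr0.
split; apply: ae0_is_PV.
- rewrite (_ : (fun t => _) = (fun t => PV_kernel x t * complex.Re (f t))).
    exact: measurable_funM.
  by apply/funext => t; case: (f t) => u v /=; rewrite mul0r subr0.
- by apply: ae_imp f0 => t h Dt; rewrite h// mulr0.
- rewrite (_ : (fun t => _) = (fun t => PV_kernel x t * complex.Im (f t))).
    exact: measurable_funM.
  by apply/funext => t; case: (f t) => u v /=; rewrite mul0r addr0.
- by apply: ae_imp f0 => t h Dt; rewrite h// mulr0.
Qed.
End Assembly.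

Local Open Scope complex_scope.

Theorem corollary8 (R : realType) (lambda : R)
    (hlambda : - Num.sqrt (2 * pi) < lambda < Num.sqrt (2 * pi))
    (f : R -> R[i]) (hf : in_L2 f) :
  solves_equation lambda f <->
  {ae lebesgue_measure, forall x : R, Rplus x -> f x = 0}.
Proof. by split; [exact: uniqueness|exact: zero_solves]. Qed.
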